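(* Let $K$ be a finite field with $q$ elements. Consider the conjugation action of $G=\mathrm{GL}_2(K)$ on $T=\mathrm{Sym}(\mathfrak{sl}_2^* )=K[a,b,c]$. Let $\det=-a^2-bc\in T$, and let $\pi$, $f_4$, $\mathcal P^1$ be as in the context. (i) If $q$ is even, then $\pi(f_4)$ has a square root in $T$ and $T^G$ is a polynomial ring given as $$T^G=K\big[\det,\ \mathcal P^1(\det),\ \sqrt{\pi(f_4)}\,\big].$$ The $a$-invariant of $T^G$ is $-\left(3+q+\binom q2\right)$. (ii) If $q$ is odd, then $\pi(S^G)=T^G$. Thus $T^G$ is a hypersurface given as $$T^G=K\big[\det,\ \mathcal P^1(\det),\ \pi(f_4),\ \pi(h)\big],$$ where $h$ is any secondary invariant for $S^G$ (i.e. any homogeneous $h\in S^G$ of degree $q^2$ with $S^G=R\oplus Rh$). We may also replace $\pi(h)$ with the Jacobian of the other three invariants $\det,\mathcal P^1(\det),\pi(f_4)$. The Hilbert series of $T^G$ is $$\mathrm{Hilb}(T^G,z)=\frac{1+z^{q^2}}{(1-z^2)(1-z^{q+1})(1-z^{q^2-q})}.$$ Additionally, $T^G$ is not $F$-regular, has class group $\mathbb Z/2$, and has $a$-invariant $-3$.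
   Context: $S=K[a,b,c,d]$, with $\sigma\in G$ acting by the $K$-algebra automorphism sending each variable to the corresponding entry of $\sigma^{-1}\begin{pmatrix}a&b\\c&d\end{pmatrix}\sigma$. $\mathfrak{sl}_2$ is the space of traceless $2\times2$ matrices over $K$; $T=K[a,b,c]$ where $\{a,b,c\}$ is the basis dual to $\begin{pmatrix}1&0\\0&-1\end{pmatrix},\begin{pmatrix}0&1\\0&0\end{pmatrix},\begin{pmatrix}0&0\\1&0\end{pmatrix}$, and $\sigma\in G$ acts on $T$ by sending each variable to the corresponding entry of $\sigma^{-1}\begin{pmatrix}a&b\\c&-a\end{pmatrix}\sigma$. The map $\pi\colon S\to T$ is the $G$-equivariant surjective $K$-algebra map with $a\mapsto a$, $b\mapsto b$, $c\mapsto c$, $d\mapsto -a$. Fix an irreducible quadratic $g(x)=x^2-\tau x+\delta\in K[x]$ and set $$f_1=a+d,\quad f_2=ad-bc,\quad f_3=a^qd+ad^q-b^qc-bc^q,\quad f_4=\prod_{A\in K,\,B\in K^\times}\Big(Aa+Bb-\tfrac{g(A)}{B}c+(\tau-A)d\Big)$$ in $S$, and $R=K[f_1,f_2,f_3,f_4]$. For a polynomial ring over $K$, $\mathcal P^1(f)$ is the coefficient of $t$ in the image of $f$ under the $K$-algebra map sending each variable $x$ to $x+x^qt$, where $t$ is a new variable. For $\det=-a^2-bc\in T$ this gives $\mathcal P^1(\det)=-2a^{q+1}-b^qc-bc^q$. Rings have the standard grading with variables in degree 1. $\mathrm{Hilb}(R,z)=\sum_n\dim_K(R_n)z^n$. The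 $a$-invariant of a graded Cohen–Macaulay ring equals the degree (numerator degree minus denominator degree) of its Hilbert series. A hypersurface is a graded $K$-algebra isomorphic to a (weighted) polynomial ring modulo one homogeneous element. The Jacobian is the determinant of the matrix of partial derivatives with respect to $a,b,c$. *)

(* Defs.v *)
From HB Require Import structures.
From mathcomp Require Import all_boot all_order all_fingroup all_algebra.
From mathcomp Require Import mpoly.

Set Implicit Arguments.
Unset Strict Implicit.
Unset Printing Implicit Defensive.

Import Order.TTheory GRing.Theory Num.Theory.
Local Open Scope ring_scope.
Local Notation "x %:F" := (@FracField.tofrac _ x).

Definition mx2 (R : nzRingType) (x y z w : R) : 'M[R]_2 :=
  \matrix_(i < 2, j < 2) nth 0 (nth [::] [:: [:: x; y]; [:: z; w]] i) j.

(* S = K[a, b, c, d] and T = K[a, b, c]. *)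
Definition aS (K : finFieldType) : {mpoly K[4]} := 'X_(@Ordinal 4 0 isT).
Definition bS (K : finFieldType) : {mpoly K[4]} := 'X_(@Ordinal 4 1 isT).
Definition cS (K : finFieldType) : {mpoly K[4]} := 'X_(@Ordinal 4 2 isT).
Definition dS (K : finFieldType) : {mpoly K[4]} := 'X_(@Ordinal 4 3 isT).

Definition aT (K : finFieldType) : {mpoly K[3]} := 'X_(@Ordinal 3 0 isT).
Definition bT (K : finFieldType) : {mpoly K[3]} := 'X_(@Ordinal 3 1 isT).
Definition cT (K : finFieldType) : {mpoly K[3]} := 'X_(@Ordinal 3 2 isT).

Definition conj_gen (K : finFieldType) n (s : {'GL_2[K]})
    (M : 'M[{mpoly K[n]}]_2) : 'M[{mpoly K[n]}]_2 :=
  map_mx (@mpolyC n K) (invmx (GLval s)) *m M *m map_mx (@mpolyC n K) (GLval s).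

Definition actS (K : finFieldType) (s : {'GL_2[K]}) :
    {mpoly K[4]} -> {mpoly K[4]} :=
  let M := conj_gen s (mx2 (aS K) (bS K) (cS K) (dS K)) in
  comp_mpoly [tuple M 0 0; M 0 1; M 1 0; M 1 1].

Definition actT (K : finFieldType) (s : {'GL_2[K]}) :
    {mpoly K[3]} -> {mpoly K[3]} :=
  let M := conj_gen s (mx2 (aT K) (bT K) (cT K) (- aT K)) in
  comp_mpoly [tuple M 0 0; M 0 1; M 1 0].

HB.instance Definition _ (K : finFieldType) (s : {'GL_2[K]}) :=
  GRing.LRMorphism.copy (actS s) (comp_mpoly _).
HB.instance Definition _ (K : finFieldType) (s : {'GL_2[K]}) :=
  GRing.LRMorphism.copy (actT s) (comp_mpoly _).

Definition invS (K : finFieldType) : {pred {mpoly K[4]}} :=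
  fun p => [forall s : {'GL_2[K]}, actS s p == p].
Arguments invS K : clear implicits.

Definition invT (K : finFieldType) : {pred {mpoly K[3]}} :=
  fun p => [forall s : {'GL_2[K]}, actT s p == p].
Arguments invT K : clear implicits.

Definition piST (K : finFieldType) (p : {mpoly K[4]}) : {mpoly K[3]} :=
  p \mPo [tuple aT K; bT K; cT K; - aT K].

(* The coefficient of t in the image of f under x |-> x + x^q t. *)
Definition steenrodP1 (K : finFieldType) n (f : {mpoly K[n]}) : {mpoly K[n]} :=
  (mmap (polyC \o @mpolyC n K)
        (fun i => ('X_i)%:P + ('X_i ^+ #|K|)%:P * 'X) f)`_1.

Definition detT (K : finFieldType) : {mpoly K[3]} :=
  - aT K ^+ 2 - bT K * cT K.

Definition jacobian (K : finFieldType) n (F : n.-tuple {mpoly K[n]}) :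
    {mpoly K[n]} :=
  \det (\matrix_(i < n, j < n) (tnth F i)^`M(j)).

Definition quad (K : finFieldType) (tau delta : K) : {poly K} :=
  'X^2 - tau *: 'X + delta%:P.

Definition f1 (K : finFieldType) : {mpoly K[4]} := aS K + dS K.
Definition f2 (K : finFieldType) : {mpoly K[4]} := aS K * dS K - bS K * cS K.
Definition f3 (K : finFieldType) : {mpoly K[4]} :=
  aS K ^+ #|K| * dS K + aS K * dS K ^+ #|K|
  - bS K ^+ #|K| * cS K - bS K * cS K ^+ #|K|.
Definition f4 (K : finFieldType) (tau delta : K) : {mpoly K[4]} :=
  \prod_(A : K) \prod_(B : K | B != 0)
    (A *: aS K + B *: bS K - ((quad tau delta).[A] / B) *: cS K
     + (tau - A) *: dS K).

(* x \in K[t_0, ..., t_(k-1)], the K-subalgebra generated by the t_i. *)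
Definition in_subalg (K : fieldType) n k (t : k.-tuple {mpoly K[n]})
    (x : {mpoly K[n]}) : Prop :=
  exists P : {mpoly K[k]}, x = P \mPo t.

Definition alg_indep (K : fieldType) n k (t : k.-tuple {mpoly K[n]}) : Prop :=
  forall P : {mpoly K[k]}, P \mPo t = 0 -> P = 0.

(* h is homogeneous of degree q^2 and S^G is the internal direct sum of
   R = K[f1, f2, f3, f4] and R h. *)
Definition secondary_invariant (K : finFieldType) (tau delta : K)
    (h : {mpoly K[4]}) : Prop :=
  let R := in_subalg [tuple f1 K; f2 K; f3 K; f4 tau delta] in
  [/\ h \is (#|K| ^ 2)%N.-homog,
      h \in invS K,
      forall p, p \in invS K <->
        exists r1 r2, [/\ R r1, R r2 & p = r1 + r2 * h]
    & forall r1 r2, R r1 -> R r2 -> r1 + r2 * h = 0 -> r1 = 0 /\ r2 * h = 0].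

(* Below, A is a K-subalgebra of a polynomial ring over K that is graded by the
   standard grading, i.e. contains the homogeneous components of its elements. *)

Definition weighted_homog (K : fieldType) k (w : 'I_k -> nat)
    (F : {mpoly K[k]}) : Prop :=
  exists D : nat, forall m, m \in msupp F -> (\sum_(i < k) w i * m i)%N = D.

(* A = K[t_0, ..., t_(k-1)] with t_i homogeneous of degree w_i > 0, and the
   kernel of K[x_0, ..., x_(k-1)] -> A, x_i |-> t_i, is generated by one
   element that is homogeneous for deg x_i = w_i. *)
Definition hypersurface_on (K : fieldType) n (A : {pred {mpoly K[n]}}) k
    (t : k.-tuple {mpoly K[n]}) : Prop :=
  exists w : 'I_k -> nat,
  [/\ forall i, (0 < w i)%N /\ tnth t i \is (w i).-homog,
      forall x, x \in A <-> in_subalg t x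
    & exists2 F : {mpoly K[k]}, weighted_homog w F &
        forall P : {mpoly K[k]}, P \mPo t = 0 <-> exists Q, P = Q * F].

(* dim_K A_d = H d for all d. *)
Definition hilbert_function (K : fieldType) n (A : {pred {mpoly K[n.+1]}})
    (H : nat -> nat) : Prop :=
  forall d, exists2 V : {vspace dhomog n.+1 K d},
    forall v, (v \in V) = (val v \in A) & \dim V = H d.

(* Hilb(A, z) = N / D, that is, D(z) * \sum_d dim_K(A_d) z^d = N(z) as formal
   power series. *)
Definition hilbert_series (K : fieldType) n (A : {pred {mpoly K[n.+1]}})
    (N D : {poly rat}) : Prop :=
  D != 0 /\
  exists2 H : nat -> nat, hilbert_function A H &
    forall d, \sum_(i < d.+1) D`_i * (H (d - i)%N)%:R = N`_d.

(* x lies in the ideal of A generated by the elements of s. *)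
Definition in_ideal (K : fieldType) n (A : {pred {mpoly K[n]}})
    (s : seq {mpoly K[n]}) (x : {mpoly K[n]}) : Prop :=
  exists2 y : 'I_(size s) -> {mpoly K[n]},
    forall i, y i \in A & x = \sum_(i < size s) y i * s`_i.

(* A is module-finite over K[theta], and theta is a regular sequence on A. As a
   regular sequence of forms of positive degree is algebraically independent,
   this says that theta is a homogeneous system of parameters that is regular. *)
Definition graded_CM (K : fieldType) n (A : {pred {mpoly K[n]}}) : Prop :=
  exists d (theta : d.-tuple {mpoly K[n]}),
  [/\ forall i, tnth theta i \in A /\
        exists2 e, (0 < e)%N & tnth theta i \is e.-homog,
      exists k (b : k.-tuple {mpoly K[n]}),
        (forall i, tnth b i \in A) /\
        forall x, x \in A ->
          exists2 c : 'I_k -> {mpoly K[n]}, forall i, in_subalg theta (c i) &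
            x = \sum_(i < k) c i * tnth b i
    & forall (i : 'I_d) x, x \in A ->
        in_ideal A (take i theta) (tnth theta i * x) ->
        in_ideal A (take i theta) x].

(* The a-invariant of a graded Cohen-Macaulay ring: the degree of its Hilbert
   series N / D as a rational function. *)
Definition a_invariant (K : fieldType) n (A : {pred {mpoly K[n.+1]}})
    (a : int) : Prop :=
  graded_CM A /\
  exists N D : {poly rat},
    [/\ hilbert_series A N D, N != 0 & a = (size N)%:Z - (size D)%:Z].

(* From here on, B is a subring of the field L. *)

Definition ideal_of (L : fieldType) (B I : L -> Prop) : Prop :=
  [/\ forall x, I x -> B x,
      I 0,
      forall x y, I x -> I y -> I (x + y)
    & forall b x, B b -> I x -> I (b * x)].

(* x lies in the ideal of B generated by the m-th powers of elements of I. *)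
Definition frobenius_power (L : fieldType) (B I : L -> Prop) (m : nat) (x : L) :
    Prop :=
  exists k (b y : 'I_k -> L),
    [/\ forall i, B (b i), forall i, I (y i)
      & x = \sum_(i < k) b i * y i ^+ m].

Definition in_tight_closure (p : nat) (L : fieldType) (B I : L -> Prop) (z : L) :
    Prop :=
  B z /\
  exists c, [/\ B c, c != 0 &
    exists e0, forall e, (e0 <= e)%N ->
      frobenius_power B I (p ^ e)%N (c * z ^+ (p ^ e)%N)].

Definition mult_set (A : idomainType) (W : A -> Prop) : Prop :=
  [/\ W 1, ~ W 0 & forall x y, W x -> W y -> W (x * y)].

Definition localization (A : idomainType) (W : A -> Prop) (x : {fraction A}) :
    Prop :=
  exists a w, W w /\ x = a%:F / w%:F.

(* The domain A of characteristic p is F-regular: every ideal of every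
   localization of A is tightly closed. *)
Definition F_regular (p : nat) (A : idomainType) : Prop :=
  forall W : A -> Prop, mult_set W ->
  forall I : {fraction A} -> Prop, ideal_of (localization W) I ->
  forall z, in_tight_closure p (localization W) I z -> I z.

(* The divisor class group of a normal Noetherian domain A: divisorial
   fractional ideals under (I, J) |-> A : (A : I J), modulo principal ones. *)

Definition fractional_ideal (A : idomainType) (I : {fraction A} -> Prop) :
    Prop :=
  [/\ I 0, forall x y, I x -> I y -> I (x + y),
      forall (a : A) x, I x -> I (a%:F * x),
      exists2 x, x != 0 & I x
    & exists2 d : A, d != 0 & forall x, I x -> exists a : A, d%:F * x = a%:F].

Definition colon (A : idomainType) (I : {fraction A} -> Prop)
    (x : {fraction A}) : Prop :=
  forall y, I y -> exists a : A, x * y = a%:F.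

Definition divisorial (A : idomainType) (I : {fraction A} -> Prop) : Prop :=
  fractional_ideal I /\ forall x, I x <-> colon (colon I) x.

Definition prod_ideal (A : idomainType) (I J : {fraction A} -> Prop)
    (x : {fraction A}) : Prop :=
  exists k (y z : 'I_k -> {fraction A}),
    [/\ forall i, I (y i), forall i, J (z i) & x = \sum_(i < k) y i * z i].

Definition div_prod (A : idomainType) (I J : {fraction A} -> Prop) :
    {fraction A} -> Prop :=
  colon (colon (prod_ideal I J)).

Definition principal (A : idomainType) (I : {fraction A} -> Prop) : Prop :=
  exists2 x, x != 0 & forall y, I y <-> exists a : A, y = a%:F * x.

(* Cl(A) is isomorphic to Z: there is a surjective homomorphism onto Z from the
   divisorial fractional ideals whose kernel is the principal ones. *)
Definition class_group_iso (A : idomainType) (Z : zmodType) : Prop :=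
  exists cl : ({fraction A} -> Prop) -> Z,
  [/\ forall I J, divisorial I -> divisorial J ->
        cl (div_prod I J) = cl I + cl J,
      forall z, exists2 I, divisorial I & cl I = z
    & forall I, divisorial I -> (cl I = 0 <-> principal I)].

Lemma invT_divring_closed (K : finFieldType) : divring_closed (invT K).
Proof.
split=> [|p r /forallP hp /forallP hr|p r /forallP hp /forallP hr].
- by apply/forallP=> s; rewrite rmorph1.
- by apply/forallP=> s; rewrite rmorphB /= (eqP (hp s)) (eqP (hr s)).
apply/forallP=> s; rewrite rmorphM /= (eqP (hp s)).
have [ru|rnu] := boolP (r \is a GRing.unit).
  by rewrite rmorphV //= (eqP (hr s)).
by rewrite invr_out // (eqP (hr s)).
Qed.

Record ringTG (K : finFieldType) :=
  RingTG { ringTG_val :> {mpoly K[3]}; _ : ringTG_val \in invT K }.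

HB.instance Definition _ (K : finFieldType) := [isSub for @ringTG_val K].
HB.instance Definition _ (K : finFieldType) := [Choice of ringTG K by <:].
HB.instance Definition _ (K : finFieldType) :=
  GRing.SubChoice_isSubIntegralDomain.Build _ _ (ringTG K)
    (@invT_divring_closed K).

(* Main.v *)
Require Import Defs.
From Stdlib Require Import Classical ClassicalEpsilon.
From HB Require Import structures.
From mathcomp Require Import all_boot all_order all_fingroup all_algebra.
From mathcomp Require Import all_solvable all_field generic_quotient.
From mathcomp Require Import ring zify.
From mathcomp Require Import mpoly.

(* Let X = [[a, b], [c, -a]] and linf C = tr (C X), so that s in G sends linf C to
   linf (s C s^-1). Up to a scalar, p4 = pi(f4) is the product of the linf C over
   the matrices C with characteristic polynomial g, which form one conjugacy
   class; as C and tau - C give the same line, p4 = u E^2 with E squarefree.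

   The plane l0 = 0 of one factor of E meets the conic det = 0 in two points that
   are conjugate over the quadratic extension of K. The stabiliser of l0 contains
   a nonsplit torus and an element that swaps the two points; evaluating there
   shows that an invariant agrees modulo l0 with a polynomial in det and P1(det).
   The difference is divisible by l0, hence by E, and one descends on the degree.
   If q is even, E is invariant, and T^G = K[det, P1(det), E]. If q is odd, a
   reflection in -Ad(G) maps E to -E, so that E can be divided out twice from
   invariants of even degree; those of odd degree vanish on the q^2 nonisotropic
   planes, whose product is the Jacobian J up to a scalar. So T^G = A + A J with
   A = K[det, P1(det), p4].

   For q odd, the degree q^2 - q of p4 vanishes in K, so by Euler's formula the
   gradient of p4 is a Koszul cycle, and J lies in (det, P1(det)) T. Applying the
   trace T -> T^G to q-th powers puts J in the tight closure of
   (det, P1(det)) T^G, an ideal that does not contain J.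

   A divisorial ideal of T^G has a greatest common divisor in the factorial ring
   T. It is semi-invariant, with a character of order at most 2 that factors
   through det, and the ideal is principal if and only if it is invariant. The
   multiples of E form a nonprincipal divisorial ideal, since E and J / E are
   coprime and neither is invariant. *)

Set Implicit Arguments.
Unset Strict Implicit.
Unset Printing Implicit Defensive.

Import Order.TTheory GRing.Theory Num.Theory.
Local Open Scope ring_scope.

Local Notation o0 := (@Ordinal 3 0 isT).
Local Notation o1 := (@Ordinal 3 1 isT).
Local Notation o2 := (@Ordinal 3 2 isT).
Local Notation "x %:F" := (@FracField.tofrac _ x).

(** * Divisibility and homogeneous polynomials *)

(** The two points in which the plane of [l0] meets the conic have coordinates (-m, -m^2, 1) with m
    a root of g, so evaluating there needs the quadratic extension L. If v is the value there of an
    invariant form of degree d, a generator z of the units of L acting through the torus gives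
    z^(qd) v = z^d v. Hence v is zero unless q + 1 divides d; and P1(det) has value (lam - mu)^2,
    the nonzero discriminant of g, so a multiple of one of its powers cancels v. A form that
    vanishes at both points is det times a cofactor modulo [l0], but this cofactor need not be
    invariant. This is the obstacle that shapes the restriction step: it is run for forms invariant
    only modulo [l0], and only under the stabiliser of the plane. Over odd q the degree of J equals
    the number q^2 of nonisotropic planes, which is what makes J the product of their equations up
    to a scalar and lets J be divided out of every invariant of odd degree. Freeness of T^G over a
    polynomial subring, with basis 1 or 1, J, then yields Cohen-Macaulayness, the Hilbert series and
    the a-invariant by one argument for both parities. *)

Definition divides (R : comNzRingType) (x y : R) : Prop := exists z, y = z * x.

Section Divides.
Variable R : comNzRingType.
Implicit Types x y z d : R.

Lemma divides0 d : divides d 0. Proof. by exists 0; rewrite mul0r. Qed.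
Lemma dividesxx d : divides d d. Proof. by exists 1; rewrite mul1r. Qed.
Lemma divides1 x : divides 1 x. Proof. by exists x; rewrite mulr1. Qed.
Lemma dividesD d x y : divides d x -> divides d y -> divides d (x + y).
Proof. by case=> u -> [v ->]; exists (u + v); rewrite mulrDl. Qed.
Lemma dividesN d x : divides d x -> divides d (- x).
Proof. by case=> u ->; exists (- u); rewrite mulNr. Qed.
Lemma dividesB d x y : divides d x -> divides d y -> divides d (x - y).
Proof. by move=> hx hy; apply: dividesD => //; apply: dividesN. Qed.
Lemma divides_mull d x y : divides d y -> divides d (x * y).
Proof. by case=> u ->; exists (x * u); rewrite mulrA. Qed.
Lemma divides_mulr d x y : divides d x -> divides d (x * y).
Proof. by rewrite mulrC; apply: divides_mull. Qed.
Lemma divides_trans x y z : divides x y -> divides y z -> divides x z.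
Proof. by case=> u -> [v ->]; exists (v * u); rewrite mulrA. Qed.
Lemma divides_mul x y x' y' :
  divides x y -> divides x' y' -> divides (x * x') (y * y').
Proof. by case=> u -> [v ->]; exists (u * v); rewrite mulrACA. Qed.
End Divides.

Lemma divides_rmorph (R S : comNzRingType) (f : {rmorphism R -> S}) x y :
  divides x y -> divides (f x) (f y).
Proof. by case=> z ->; exists (f z); rewrite rmorphM. Qed.

Lemma dividesM2 (R : idomainType) (x y z : R) :
  x != 0 -> divides (x * y) (x * z) -> divides y z.
Proof.
move=> x0 [u hu]; exists u; apply: (mulfI x0).
by rewrite hu mulrCA.
Qed.

Definition prime_elt (R : comNzRingType) (p : R) : Prop :=
  [/\ p != 0, ~ divides p 1
    & forall x y, divides p (x * y) -> divides p x \/ divides p y].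

Lemma prime_elt_neq0 (R : comNzRingType) (p : R) : prime_elt p -> p != 0.
Proof. by case. Qed.

Lemma prime_elt_prod (R : comNzRingType) (I : eqType) (p : R) (s : seq I)
    (F : I -> R) :
  prime_elt p -> divides p (\prod_(i <- s) F i) ->
  exists2 i, i \in s & divides p (F i).
Proof.
case=> p0 p1 pM; elim: s => [|i s IH]; first by rewrite big_nil.
rewrite big_cons => /pM [h|/IH [j js h]]; first by exists i; rewrite ?mem_head.
by exists j; rewrite ?inE ?js ?orbT.
Qed.

(** Each prime divided off leaves a quotient that the remaining primes still divide, since none of
    them divides the prime removed. *)
Lemma prod_primes_divides (R : idomainType) (I : eqType) (s : seq I)
    (F : I -> R) (f : R) :
  uniq s -> (forall i, i \in s -> prime_elt (F i)) ->
  (forall i j, i \in s -> j \in s -> divides (F i) (F j) -> i = j) ->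
  (forall i, i \in s -> divides (F i) f) ->
  divides (\prod_(i <- s) F i) f.
Proof.
elim: s f => [|i s IH] f /=; first by rewrite big_nil => *; apply: divides1.
case/andP=> nis us pF dF h.
have [g Eg] := h i (mem_head _ _).
rewrite big_cons Eg mulrC; apply: divides_mul; last exact: dividesxx.
have sub j : j \in s -> j \in i :: s by move=> js; rewrite inE js orbT.
apply: IH => //.
- by move=> j /sub/pF.
- by move=> j k /sub js /sub ks; apply: dF.
move=> j js; have := h j (sub _ js); rewrite Eg.
case: (pF j (sub _ js)) => _ _ pM /pM [//|/dF e].
by move: nis; rewrite -(e (sub _ js) (mem_head _ _)) js.
Qed.

(** Congruence modulo [d] respects sums and products, so the variables decide. The case [d = 0]
    gives equality of morphisms; with [d] a linear form this yields reduction modulo a plane and the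
    effect of a reflection. *)
Lemma mpoly_hom_divides n (R S : comNzRingType)
    (f g : {rmorphism {mpoly R[n]} -> S}) (d : S) :
  (forall c, f c%:MP = g c%:MP) ->
  (forall i, divides d (f 'X_i - g 'X_i)) ->
  forall p, divides d (f p - g p).
Proof.
move=> hC hX.
have hM p r : divides d (f p - g p) -> divides d (f r - g r) ->
    divides d (f (p * r) - g (p * r)).
  move=> hp hr; rewrite !rmorphM.
  have -> : f p * f r - g p * g r = f p * (f r - g r) + (f p - g p) * g r.
    by ring.
  by apply: dividesD; [apply: divides_mull|apply: divides_mulr].
have h1 : divides d (f 1 - g 1) by rewrite !rmorph1 subrr; apply: divides0.
move=> p; elim/mpolyind: p => [|c m p _ _ IH]; first by rewrite !rmorph0 subrr; apply: divides0.
rewrite !rmorphD opprD addrACA; apply: dividesD => //.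
rewrite -mul_mpolyC; apply: (hM); first by rewrite hC subrr; apply: divides0.
rewrite mpolyXE_id.
apply: (big_ind (fun p => divides d (f p - g p))) => // i _.
elim: (X in 'X_i ^+ X) => [|k IHk]; first by rewrite expr0.
by rewrite exprS; apply: (hM) => //; apply: hX.
Qed.

Lemma mpoly_hom_eq n (R S : comNzRingType)
    (f g : {rmorphism {mpoly R[n]} -> S}) :
  (forall c, f c%:MP = g c%:MP) -> (forall i, f 'X_i = g 'X_i) -> f =1 g.
Proof.
move=> hC hX p; apply/eqP; rewrite -subr_eq0.
have [|z ->] := @mpoly_hom_divides n R S f g 0 hC _ p; last by rewrite mulr0.
by move=> i; rewrite hX subrr; apply: divides0.
Qed.

Lemma tnth_comp_mpolyXU n k (R : comNzRingType) (i : 'I_n)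
    (t : n.-tuple {mpoly R[k]}) : 'X_i \mPo t = tnth t i.
Proof. by rewrite comp_mpolyXU (tnth_nth 0). Qed.

Lemma comp_mpolyA n k l (R : comNzRingType) (t : n.-tuple {mpoly R[k]})
    (u : k.-tuple {mpoly R[l]}) (p : {mpoly R[n]}) :
  (p \mPo t) \mPo u = p \mPo [tuple of map (comp_mpoly u) t].
Proof.
pose f : {rmorphism {mpoly R[n]} -> {mpoly R[l]}} :=
  GRing.RMorphism.clone _ _ (comp_mpoly u \o comp_mpoly t) _.
apply: (@mpoly_hom_eq n R _ f (comp_mpoly _)) => [c|i] /=.
  by rewrite !comp_mpolyC.
by rewrite !tnth_comp_mpolyXU tnth_map.
Qed.

Lemma ord3P (P : 'I_3 -> Prop) :
  P o0 -> P o1 -> P o2 ->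
  forall i, P i.
Proof.
move=> h0 h1 h2 [[|[|[|//]]] lt]; first by rewrite (bool_irrelevance lt isT).
  by rewrite (bool_irrelevance lt isT).
by rewrite (bool_irrelevance lt isT).
Qed.

Lemma tuple3E (A : Type) (x y z : A) :
  (tnth [tuple x; y; z] o0 = x)
  * (tnth [tuple x; y; z] o1 = y)
  * (tnth [tuple x; y; z] o2 = z).
Proof. by []. Qed.

Section Ternary.
Variable K : finFieldType.
Local Notation T := {mpoly K[3]}.
Local Notation a := (aT K).
Local Notation b := (bT K).
Local Notation c := (cT K).

Lemma compT x y z :
  (a \mPo [tuple x; y; z] = x :> T) * (b \mPo [tuple x; y; z] = y :> T)
  * (c \mPo [tuple x; y; z] = z :> T).
Proof. by rewrite !tnth_comp_mpolyXU. Qed.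

Definition lf (x y z : K) : T := x%:MP * a + y%:MP * b + z%:MP * c.

Lemma compT_lf x y z x' y' z' :
  lf x y z \mPo [tuple x'; y'; z'] =
    x%:MP * x' + y%:MP * y' + z%:MP * z' :> T.
Proof. by rewrite /lf !rmorphD /= !rmorphM /= !comp_mpolyC !compT. Qed.

(** Solving for the first variable with a nonzero coefficient gives a substitution whose kernel is
    the ideal of the form. Its values lie in a domain, so the form is prime. *)
Lemma lf_retract x y z : (x, y, z) != (0, 0, 0) ->
  exists t : 3.-tuple T,
    lf x y z \mPo t = 0 /\ forall p : T, divides (lf x y z) (p - (p \mPo t)).
Proof.
have red (t : 3.-tuple T) :
    (forall i, divides (lf x y z) ('X_i - tnth t i)) ->
    forall p : T, divides (lf x y z) (p - (p \mPo t)).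
  move=> h p; pose f : {rmorphism T -> T} := GRing.RMorphism.clone _ _ idfun _.
  have := @mpoly_hom_divides 3 K T f (comp_mpoly t) (lf x y z) _ _ p.
  apply=> [e|i] /=.
    by rewrite comp_mpolyC.
  by rewrite tnth_comp_mpolyXU.
have [hx|x0] := eqVneq x 0; last first.
  move=> _; exists [tuple - (x^-1)%:MP * (y%:MP * b + z%:MP * c); b; c].
  have E : x%:MP * (x^-1)%:MP = 1 :> T by rewrite -rmorphM divff // rmorph1.
  split; first by rewrite compT_lf mulrA mulrN E; ring.
  apply: red; apply: ord3P; rewrite tuple3E ?subrr; try exact: divides0.
  exists (x^-1)%:MP; rewrite /lf -[X in X - _]/a.
  by rewrite -[a in LHS]mul1r -E; ring.
have [hy|y0] := eqVneq y 0; last first.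
  move=> _; exists [tuple a; - (y^-1)%:MP * (z%:MP * c); c].
  have E : y%:MP * (y^-1)%:MP = 1 :> T by rewrite -rmorphM divff // rmorph1.
  split; first by rewrite compT_lf hx !mulrA mulrN E rmorph0; ring.
  apply: red; apply: ord3P; rewrite tuple3E ?subrr; try exact: divides0.
  exists (y^-1)%:MP; rewrite /lf -[X in X - _]/b hx rmorph0.
  by rewrite -[b in LHS]mul1r -E; ring.
rewrite hx hy in red *; rewrite !xpair_eqE !eqxx /= => z0; exists [tuple a; b; 0].
split; first by rewrite compT_lf !rmorph0; ring.
have E : z%:MP * (z^-1)%:MP = 1 :> T by rewrite -rmorphM divff // rmorph1.
apply: red; apply: ord3P; rewrite tuple3E ?subrr; try exact: divides0.
exists (z^-1)%:MP; rewrite /lf -[X in X - _]/c !rmorph0.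
by rewrite -[c in LHS]mul1r -E; ring.
Qed.

Lemma prime_lf x y z : (x, y, z) != (0, 0, 0) -> prime_elt (lf x y z).
Proof.
move=> h; have [t [t0 tP]] := lf_retract h.
have dvdP p : divides (lf x y z) p <-> p \mPo t = 0.
  split=> [[q ->]|e]; first by rewrite rmorphM /= t0 mulr0.
  by have := tP p; rewrite e subr0.
split; last 1 first.
- move=> p q /dvdP; rewrite rmorphM /= => /eqP; rewrite mulf_eq0.
  by case/orP=> /eqP; [left|right]; apply/dvdP.
- apply/eqP => e; move: h; apply/negP; rewrite negbK.
  have C i : (lf x y z)@_(U_(i)) =
     x * (@Ordinal 3 0 isT == i)%:R + y * (@Ordinal 3 1 isT == i)%:R
     + z * (@Ordinal 3 2 isT == i)%:R.
    by rewrite /lf !mcoeffD !mcoeffCM !mcoeffXU.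
  have := C o0; have := C o1.
  have := C o2; rewrite e !mcoeff0 /=.
  by rewrite !mulr0 !mulr1 !addr0 !add0r => <- <- <-.
by move/dvdP/eqP; rewrite rmorph1 oner_eq0.
Qed.

End Ternary.

Lemma measureE n (mf : measure n) (m : 'X_{1..n}) :
  mf m = (\sum_(i < n) mf U_(i)%MM * m i)%N.
Proof.
rewrite [in LHS](multinomUE_id m) (big_morph mf mfD mf0).
apply: eq_bigr => i _; move: (fun_of_multinom m i) => k.
elim: k => [|k IH]; first by rewrite mulm0n mf0 muln0.
by rewrite mulmS mfD IH mulnS.
Qed.

Section HomogComp.
Variables (n k : nat) (R : comNzRingType) (mf : measure n).
Variable t : n.-tuple {mpoly R[k]}.

Lemma dhomog_bigprod (I : Type) (s : seq I) (P : pred I) (F : I -> {mpoly R[k]}) d :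
  (forall i, P i -> F i \is (d i).-homog) ->
  \prod_(i <- s | P i) F i \is (\sum_(i <- s | P i) d i)%N.-homog.
Proof.
move=> h; apply: (big_ind2 (fun (p : {mpoly R[k]}) e => p \is e.-homog)) => //.
  exact: dhomog1.
by move=> p e q f; apply: dhomogM.
Qed.

Hypothesis ht : forall i, tnth t i \is (mf U_(i)%MM).-homog.

Lemma dhomog_compX m : 'X_[m] \mPo t \is (mf m).-homog.
Proof.
rewrite comp_mpolyX measureE; apply: dhomog_bigprod => i _.
exact: dhomogMn.
Qed.

Lemma pihomog_comp_mpoly d (p : {mpoly R[n]}) :
  pihomog mdeg d (p \mPo t) = pihomog mf d p \mPo t.
Proof.
elim/mpolyind: p => [|e m p _ _ IH]; first by rewrite !(comp_mpoly0, pihomog0).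
rewrite comp_mpolyD !pihomogD comp_mpolyD IH comp_mpolyZ !linearZ /=.
congr (_ *: _ + _); rewrite pihomogX; case: eqP => [<-|/eqP ne].
  exact/pihomog_dE/dhomog_compX.
by rewrite comp_mpoly0; apply: pihomog_ne0 ne (dhomog_compX m).
Qed.

Lemma dhomog_comp_mpoly d (p : {mpoly R[n]}) :
  p \is d.-homog for mf -> p \mPo t \is d.-homog.
Proof. by rewrite !homog_piE pihomog_comp_mpoly => /eqP->. Qed.
End HomogComp.

Lemma homog0C (K : fieldType) n (f : {mpoly K[n]}) : f \is 0.-homog -> f = (f@_0%MM)%:MP.
Proof.
move=> h; apply: msize1_polyC; rewrite mmeasureE big_seq; apply/bigmax_leqP_seq=> m hm _.
by move/dhomogP: h => ->.
Qed.

Lemma mx2E (R : nzRingType) (x y z w : R) :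
  (mx2 x y z w 0 0 = x) * (mx2 x y z w 0 1 = y)
  * (mx2 x y z w 1 0 = z) * (mx2 x y z w 1 1 = w).
Proof. by rewrite !mxE. Qed.

Lemma mx2_eta (R : nzRingType) (A : 'M[R]_2) :
  A = mx2 (A 0 0) (A 0 1) (A 1 0) (A 1 1).
Proof.
by apply/matrixP => -[[|[|//]] i] [[|[|//]] j]; rewrite mxE /=;
   congr (A _ _); apply/val_inj.
Qed.

Lemma mulmx2E (R : nzRingType) (A B : 'M[R]_2) i j :
  (A *m B) i j = A i 0 * B 0 j + A i 1 * B 1 j.
Proof. by rewrite mxE big_ord_recl big_ord1; congr (_ + A i _ * B _ j); apply/val_inj. Qed.

Lemma mxtrace2E (R : nzRingType) (A : 'M[R]_2) : \tr A = A 0 0 + A 1 1.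
Proof. by rewrite /mxtrace big_ord_recl big_ord1; congr (_ + A _ _); apply/val_inj. Qed.

Lemma mx2P (R : nzRingType) (A B : 'M[R]_2) :
  A 0 0 = B 0 0 -> A 0 1 = B 0 1 -> A 1 0 = B 1 0 -> A 1 1 = B 1 1 -> A = B.
Proof. by move=> h1 h2 h3 h4; rewrite (mx2_eta A) (mx2_eta B) h1 h2 h3 h4. Qed.

(** * The conjugation action and the linear forms tr (C X) *)

Section Action.
Variable K : finFieldType.
Local Notation T := {mpoly K[3]}.
Local Notation a := (aT K).
Local Notation b := (bT K).
Local Notation c := (cT K).
Local Notation C3 := (map_mx (@mpolyC 3 K)).
Implicit Types s r : {'GL_2[K]}.

Lemma GLval_unitmx s : GLval s \in unitmx.
Proof. by rewrite unitmxE unitfE; apply: GL_det. Qed.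

Definition genX : 'M[T]_2 := mx2 a b c (- a).

Definition linf (C : 'M[K]_2) : T := \tr (C3 C *m genX).

Lemma linfE C : linf C = lf (C 0 0 - C 1 1) (C 1 0) (C 0 1).
Proof.
rewrite /linf mxtrace2E !mulmx2E !mx2E /lf !mxE rmorphB /=; ring.
Qed.

Lemma mxtrace_conj_gen s : \tr (conj_gen s genX) = 0.
Proof.
rewrite /conj_gen mxtrace_mulC mulmxA -map_mxM mulmxV; last exact: GLval_unitmx.
by rewrite map_mx1 mul1mx mxtrace2E !mx2E subrr.
Qed.

Lemma actT_vars s :
  (actT s a = conj_gen s genX 0 0) * (actT s b = conj_gen s genX 0 1)
  * (actT s c = conj_gen s genX 1 0).
Proof. by rewrite /actT !compT. Qed.

(** [actT] prescribes three entries only; the fourth agrees because conjugation preserves trace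
    zero. *)
Lemma actT_genX s : map_mx (actT s) genX = conj_gen s genX.
Proof.
have := mxtrace_conj_gen s; rewrite mxtrace2E => h.
apply: mx2P; rewrite mxE mx2E ?rmorphN /= actT_vars //.
by apply/eqP; rewrite eq_sym -addr_eq0 addrC; apply/eqP.
Qed.

Lemma actTC s e : actT s e%:MP = e%:MP.
Proof. by rewrite /actT comp_mpolyC. Qed.

Lemma map_actTC s (C : 'M[K]_2) : map_mx (actT s) (C3 C) = C3 C.
Proof. by apply/matrixP=> i j; rewrite !mxE actTC. Qed.

Lemma actT_linf s C :
  actT s (linf C) = linf (GLval s *m C *m invmx (GLval s)).
Proof.
rewrite /linf -trace_map_mx /= map_mxM map_actTC actT_genX /conj_gen.
by rewrite !map_mxM !mulmxA mxtrace_mulC !mulmxA.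
Qed.

(** [actT s] fixes constant matrices, so it turns r^-1 X r into r^-1 s^-1 X s r, which is
    conjugation by s r; hence the order of a left action. *)
Lemma actTM s r p : actT s (actT r p) = actT (s * r)%g p.
Proof.
pose f : {rmorphism T -> T} :=
  GRing.RMorphism.clone _ _ (actT s \o actT r) _.
have := @mpoly_hom_eq 3 K T f (actT (s * r)%g) _ _ p; apply=> [e|] /=.
  by rewrite !actTC.
have H i j : actT s (actT r (genX i j)) = actT (s * r)%g (genX i j).
  have E u : actT u (genX i j) = conj_gen u genX i j by rewrite -actT_genX [RHS]mxE.
  rewrite !E.
  transitivity ((map_mx (actT s) (conj_gen r genX)) i j); first by rewrite [RHS]mxE.
  rewrite /conj_gen !map_mxM !map_actTC actT_genX /conj_gen.
  rewrite -!GL_VxE invMg !GL_MxE !GL_VxE.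
  by rewrite !map_mxM !mulmxA.
apply: ord3P; first by have := H 0 0; rewrite !mx2E.
  by have := H 0 1; rewrite !mx2E.
by have := H 1 0; rewrite !mx2E.
Qed.

Lemma actT1 p : @actT K 1%g p = p.
Proof.
pose f : {rmorphism T -> T} := GRing.RMorphism.clone _ _ idfun _.
have := @mpoly_hom_eq 3 K T (actT (1%g : {'GL_2[K]})) f _ _ p; apply=> [e|] /=.
  by rewrite !actTC.
have H i j : @actT K 1%g (genX i j) = genX i j.
  transitivity ((map_mx (@actT K 1%g) genX) i j); first by rewrite [RHS]mxE.
  by rewrite actT_genX /conj_gen GL_1E invmx1 !map_mx1 mulmx1 mul1mx.
apply: ord3P; first by have := H 0 0; rewrite !mx2E.
  by have := H 0 1; rewrite !mx2E.
by have := H 1 0; rewrite !mx2E.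
Qed.

Lemma actTK s p : actT s (actT s^-1%g p) = p.
Proof. by rewrite actTM mulgV actT1. Qed.

Lemma invTP (p : T) : reflect (forall s, actT s p = p) (p \in invT K).
Proof. by apply: (iffP forallP) => h s; apply/eqP. Qed.

End Action.

(** * The quadratic extension *)

Lemma finField_prim_root (F : finFieldType) :
  exists z : F, (#|F|.-1).-primitive_root z.
Proof.
have F1 := finNzRing_gt1 F.
pose rs := [seq x <- enum F | x != 0].
have sz : size rs = #|F|.-1.
  rewrite size_filter -(cardC1 (0 : F)) cardE /enum_mem size_filter.
  by rewrite count_filter; apply: eq_count => x; rewrite !inE andbT.
have [|||//|z zin pz] := @hasP _ _ _ (@has_prim_root F #|F|.-1 rs _ _ _ _).
- by rewrite -ltnS prednK // ltnW.
- apply/allP=> x; rewrite mem_filter => /andP[x0 _].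
  apply/unity_rootP/(mulfI x0); rewrite -exprS prednK ?expf_card ?mulr1 //.
  exact: ltnW.
- exact: filter_uniq (enum_uniq _).
- by rewrite sz.
by exists z.
Qed.

Lemma card_pchar_nat (F : finFieldType) (R : comNzRingType)
    (f : {rmorphism F -> R}) : [pchar R].-nat #|F|.
Proof.
have [p pp pF] := finPcharP F.
have cF : #|F| = (p ^ logn p #|F|)%N by apply: (card_pprimeChar pF).
have pR : p \in [pchar R] by apply: rmorph_pchar pF.
by rewrite cF pnatX (eq_pnat _ (pcharf_eq pR)) pnat_id.
Qed.

Lemma expr_cardD (F : finFieldType) (R : comNzRingType)
    (f : {rmorphism F -> R}) (x y : R) :
  (x + y) ^+ #|F| = x ^+ #|F| + y ^+ #|F|.
Proof. exact/exprDn_pchar/(card_pchar_nat f). Qed.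

Lemma expr_cardN (F : finFieldType) (R : comNzRingType)
    (f : {rmorphism F -> R}) (x : R) : (- x) ^+ #|F| = - x ^+ #|F|.
Proof. exact/exprNn_pchar/(card_pchar_nat f). Qed.

Lemma expr_card_rmorph (F : finFieldType) (R : comNzRingType)
    (f : {rmorphism F -> R}) x : f x ^+ #|F| = f x.
Proof. by rewrite -rmorphXn /= expf_card. Qed.

Section Quad.
Variables (K : finFieldType) (tau delta : K).

Lemma horner_quad x : (quad tau delta).[x] = x ^+ 2 - tau * x + delta.
Proof. by rewrite /quad !hornerE. Qed.

Lemma size_quad : size (quad tau delta) = 3%N.
Proof.
rewrite /quad -addrA size_polyDl size_polyXn //.
apply: leq_ltn_trans (size_polyD _ _) _; rewrite gtn_max size_polyC size_polyN.
apply/andP; split; last by case: (delta == 0).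
by apply: leq_ltn_trans (size_scale_leq _ _) _; rewrite size_polyX.
Qed.

Lemma monic_quad : quad tau delta \is monic.
Proof.
by rewrite monicE lead_coefE size_quad /quad !coefE /=; apply/eqP; ring.
Qed.

Hypothesis hg : irreducible_poly (quad tau delta).

Lemma quad_noroot x : x ^+ 2 - tau * x + delta != 0.
Proof.
rewrite -horner_quad; apply/negP => rx.
have [_ /(_ ('X - x%:P))] := hg.
rewrite size_XsubC dvdp_XsubCl => /(_ isT rx) /eqp_size.
by rewrite size_XsubC size_quad.
Qed.

(** L is K[x]/(g), and the root is the class of x. *)
Lemma quadratic_extension : exists (L : finFieldType) (f : {rmorphism K -> L}) (x : L),
  x ^+ 2 - f tau * x + f delta = 0 /\ #|L| = (#|K| ^ 2)%N.
Proof.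
pose hI : monic_irreducible_poly (quad tau delta) := (hg, monic_quad).
exists {poly %/ quad tau delta with hI}, (qpolyC (quad tau delta)), ('qX).
split; last by rewrite card_qfpoly size_quad.
have mE := mk_monicE hI.
transitivity (in_qpoly (quad tau delta) (quad tau delta)); last first.
  by apply/val_inj; rewrite /= mE Pdiv.RingMonic.rmodpp ?monic_quad.
rewrite [in X in in_qpoly _ X]/quad rmorphD rmorphB /= rmorphXn /= in_qpolyZ.
have E e : in_qpoly (quad tau delta) e%:P = qpolyC (quad tau delta) e.
  apply/val_inj; rewrite /= mE Pdiv.CommonRing.rmodp_small // size_quad size_polyC.
  by case: (e == 0).
rewrite E; congr (_ - _ + _).
by rewrite -E -in_qpolyM mul_polyC in_qpolyZ.
Qed.
End Quad.

(** * The linear factors of the image of f4 *)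

Section QuadExt.
Variables (K L : finFieldType) (io : {rmorphism K -> L}) (tau delta : K) (lam : L).
Hypothesis noroot : forall x, x ^+ 2 - tau * x + delta != 0.
Hypothesis hlam : lam ^+ 2 - io tau * lam + io delta = 0.
Let mu := io tau - lam.

Lemma lam_neq x : io x != lam.
Proof.
apply/eqP=> e; have := noroot x; rewrite -(fmorph_eq0 io).
by rewrite rmorphD rmorphB rmorphXn rmorphM /= e hlam eqxx.
Qed.

Lemma lam_free r s : io r * lam + io s = 0 -> r = 0 /\ s = 0.
Proof.
move=> h; have r0 : r = 0.
  apply/eqP; apply: contraT => rn.
  have /negP[] := lam_neq (- s / r); apply/eqP.
  have ir : io r != 0 by rewrite fmorph_eq0.
  apply: (mulfI ir); rewrite fmorph_div rmorphN /= mulrCA divff // mulr1.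
  by apply/eqP; rewrite eq_sym -subr_eq0 opprK h.
split=> //; apply/eqP; rewrite -(fmorph_eq0 io); move: h.
by rewrite r0 rmorph0 mul0r add0r => ->.
Qed.

(** The polynomial X^q - X has at most q roots in L, and K already supplies q of them. *)
Lemma fixed_card (x : L) : x ^+ #|K| = x -> exists y, io y = x.
Proof.
move=> e; have K1 := finNzRing_gt1 K.
have [/mapP[y _ ->]|nx] := boolP (x \in map io (enum K)); first by exists y.
have u : uniq (x :: map io (enum K)).
  by rewrite /= nx (map_inj_uniq (fmorph_inj io)) enum_uniq.
have nz : 'X^#|K| - 'X != 0 :> {poly L}.
  by rewrite -size_poly_gt0 size_polyDl ?size_polyXn // size_polyN size_polyX.
have := @max_poly_roots L _ _ nz _ u.
rewrite size_polyDl ?size_polyXn ?size_polyN ?size_polyX //= size_map -cardE.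
rewrite ltnn => h; suff /h : root ('X^#|K| - 'X) x && all (root ('X^#|K| - 'X)) (map io (enum K)) by [].
rewrite rootE !hornerE e subrr eqxx /=.
apply/allP=> _ /mapP[y _ ->].
by rewrite rootE !hornerE (expr_card_rmorph io) subrr.
Qed.

Lemma lam_mul : lam * mu = io delta.
Proof. by apply/eqP; rewrite -subr_eq0 -oppr_eq0 -hlam /mu; apply/eqP; ring. Qed.

(** Raising g(lam) = 0 to the q-th power shows that lam^q is a root of g; it is not lam, which does
    not come from K. *)
Lemma lam_exp : lam ^+ #|K| = mu.
Proof.
have : (lam ^+ #|K| - lam) * (lam ^+ #|K| - mu) = 0.
  have : (lam ^+ 2 - io tau * lam + io delta) ^+ #|K| = 0.
    by rewrite hlam expr0n; have := finNzRing_gt1 K; case: #|K|.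
  rewrite !(expr_cardD io) (expr_cardN io) [(io tau * lam) ^+ _]exprMn exprAC.
  by rewrite !(expr_card_rmorph io) -lam_mul /mu => <-; ring.
move/eqP; rewrite mulf_eq0 !subr_eq0 => /orP[/eqP /fixed_card[y hy]|/eqP //].
by have := lam_neq y; rewrite hy eqxx.
Qed.

Lemma lam_neq_mu : lam != mu.
Proof.
apply/eqP=> e; have [|y hy] := @fixed_card lam; first by rewrite lam_exp.
by have := lam_neq y; rewrite hy eqxx.
Qed.

Lemma mu_exp : mu ^+ #|K| = lam.
Proof.
by rewrite /mu (expr_cardD io) (expr_cardN io) (expr_card_rmorph io) lam_exp /mu; ring.
Qed.

(** The discriminant is (lam - mu)^2. In characteristic 2 the statement amounts to tau being
    nonzero. *)
Lemma disc_neq0 : tau ^+ 2 - delta *+ 4 != 0.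
Proof.
rewrite -(fmorph_eq0 io) rmorphB rmorphXn rmorphMn /= -lam_mul.
have -> : io tau = lam + mu by rewrite /mu; ring.
have -> : (lam + mu) ^+ 2 - (lam * mu) *+ 4 = (lam - mu) ^+ 2 by ring.
by rewrite expf_eq0 /= subr_eq0 lam_neq_mu.
Qed.

End QuadExt.

Section Cls.
Variables (K : finFieldType) (tau delta : K).
Hypothesis noroot : forall x, x ^+ 2 - tau * x + delta != 0.
Local Notation T := {mpoly K[3]}.
Implicit Types C : 'M[K]_2.

Definition Cls : {set 'M[K]_2} := [set C | (\tr C == tau) && (\det C == delta)].

(** The lower-left entry of a matrix of the class is nonzero, because g has no root in K; so (A, B)
    parametrises the class. The form [linf] of this matrix is the (A, B) factor of [f4] with d
    replaced by -a. *)
Definition Cmat (A B : K) : 'M[K]_2 :=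
  mx2 A (- ((quad tau delta).[A] / B)) B (tau - A).

(** The coefficients of a and c in [linf C] once that of b, which is [C 1 0], is scaled to 1; they
    encode the plane of C. *)
Definition nline C : K * K := ((C 0 0 - C 1 1) / C 1 0, C 0 1 / C 1 0).
Definition lin (n : K * K) : T := lf n.1 1 n.2.
Definition Nset : {set K * K} := [set nline C | C in Cls].
Definition Eprod : T := \prod_(n in Nset) lin n.

Lemma det2E (R : comNzRingType) (A : 'M[R]_2) :
  \det A = A 0 0 * A 1 1 - A 0 1 * A 1 0.
Proof.
rewrite (expand_det_row _ 0) big_ord_recl big_ord1 /cofactor !det_mx11 !mxE /=.
have E : lift (0 : 'I_2) 0 = 1 by apply/val_inj.
have E' : lift (1 : 'I_2) 0 = 0 by apply/val_inj.
by rewrite !E ?E' expr0 expr1; ring.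
Qed.

Lemma ClsP C : reflect (C 1 1 = tau - C 0 0 /\ C 0 1 * C 1 0 = - (quad tau delta).[C 0 0])
  (C \in Cls).
Proof.
rewrite inE mxtrace2E det2E horner_quad; apply: (iffP andP) => [[/eqP h1 /eqP h2]|[h1 h2]].
  have e : C 1 1 = tau - C 0 0 by rewrite -h1; ring.
  by split=> //; rewrite -h2 e; ring.
by rewrite h2 h1; split; apply/eqP; ring.
Qed.

Lemma Cls_neq0 C : C \in Cls -> C 1 0 != 0.
Proof.
case/ClsP=> _ h; apply/eqP=> e; have := noroot (C 0 0).
by move/eqP: h; rewrite e mulr0 eq_sym oppr_eq0 horner_quad => ->.
Qed.

Lemma linf_nline C : C 1 0 != 0 -> linf C = (C 1 0)%:MP * lin (nline C).
Proof.
move=> h; rewrite linfE /lin /lf /nline /= !mulrDr !mulrA -!rmorphM /=.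
by rewrite mulr1 ![C 1 0 * _]mulrC !divfK.
Qed.

Lemma piST_f4_Cmat :
  piST (f4 tau delta) = \prod_(p : K * K | p.2 != 0) linf (Cmat p.1 p.2).
Proof.
rewrite /f4 pair_big_dep /piST rmorph_prod /=; apply: eq_bigr => -[A B] /= _.
rewrite linfE !mx2E /lf !rmorphD /= !rmorphN /= !comp_mpolyZ.
by rewrite !tnth_comp_mpolyXU !(tnth_nth 0) /= -!mul_mpolyC; ring.
Qed.

Lemma piST_f4 : piST (f4 tau delta) = \prod_(C in Cls) linf C.
Proof.
rewrite piST_f4_Cmat.
rewrite [RHS](reindex_onto (fun p : K * K => Cmat p.1 p.2)
  (fun C => (C 0 0, C 1 0))) /=; last first.
  move=> C hC; have := Cls_neq0 hC; case/ClsP: hC => h1 h2 h3.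
  by apply: mx2P; rewrite mx2E //= -mulNr -h2 -mulrA divff // mulr1.
apply: eq_bigl => -[A B] /=.
rewrite !mx2E eqxx andbT; apply/idP/idP => [hB|/Cls_neq0]; last by rewrite mx2E.
by apply/ClsP; rewrite !mx2E mulNr divfK.
Qed.

Lemma dhomog_var i : 'X_i \is [in K[3], 1.-homog].
Proof. by rewrite dhomogX /= mdeg1. Qed.

Lemma dhomog_lf x y z : lf x y z \is [in K[3], 1.-homog].
Proof. by rewrite /lf !mul_mpolyC !rpredD ?dhomogZ ?dhomog_var. Qed.

Lemma dhomog_linf C : linf C \is [in K[3], 1.-homog].
Proof. by rewrite linfE dhomog_lf. Qed.

Lemma dhomog_piST_f4 : piST (f4 tau delta) \is [in K[3], (#|K| ^ 2 - #|K|).-homog].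
Proof.
rewrite piST_f4_Cmat.
have -> : (#|K| ^ 2 - #|K| = \sum_(p : K * K | p.2 != 0%R) 1)%N.
  rewrite -(pair_big_dep xpredT (fun _ (B : K) => B != 0%R) (fun _ _ => 1%N)) /=.
  rewrite !sum_nat_const muln1.
  have -> : #|(fun i : K => i != 0%R)| = #|K|.-1 by exact: (cardC1 (0 : K)).
  have -> : #|(xpredT : pred K)| = #|K| by apply: eq_card.
  by rewrite -subn1 mulnBr muln1 mulnn.
by apply: dhomog_bigprod => p _; apply: dhomog_linf.
Qed.

Lemma dhomog_Eprod : Eprod \is [in K[3], #|Nset|.-homog].
Proof.
rewrite -sum1_card; apply: dhomog_bigprod => p _; exact: dhomog_lf.
Qed.

Lemma prime_lin n : prime_elt (lin n).
Proof. by apply: prime_lf; rewrite !xpair_eqE oner_eq0 !(andbF, andFb). Qed.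

Lemma divides_lf_point x y z x' y' z' (v : 'I_3 -> K) :
  divides (lf x y z) (lf x' y' z') ->
  x * v o0 + y * v o1 + z * v o2 = 0 ->
  x' * v o0 + y' * v o1 + z' * v o2 = 0.
Proof.
have E u u' w : meval v (lf u u' w) = u * v o0
    + u' * v o1 + w * v o2.
  by rewrite /lf !rmorphD !rmorphM /= !mevalC !mevalXU.
by case=> h e h0; rewrite -E e rmorphM /= E h0 mulr0.
Qed.

Lemma lin_inj n m : divides (lin n) (lin m) -> n = m.
Proof.
case: n m => [x y] [x' y'] d.
have := divides_lf_point (v := tnth [tuple 1; - x; 0]) d.
have := divides_lf_point (v := tnth [tuple 0; - y; 1]) d.
rewrite !tuple3E /= !mulr0 !mulr1 !mul1r ?add0r ?addr0 addNr subrr => /(_ erefl) h2.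
move=> /(_ erefl) h1.
have -> : x' = x by rewrite -[LHS]addr0 -(addNr x) addrA h1 add0r.
by have -> : y' = y by rewrite -[RHS]addr0 -h2; ring.
Qed.

Lemma Eprod_divides f : (forall n, n \in Nset -> divides (lin n) f) ->
  divides Eprod f.
Proof.
move=> h; rewrite /Eprod -big_enum /=; apply: prod_primes_divides.
- exact: enum_uniq.
- by move=> n _; apply: prime_lin.
- by move=> n m _ _; apply: lin_inj.
by move=> n; rewrite mem_enum; apply: h.
Qed.

Lemma Eprod_neq0 : Eprod != 0.
Proof. by rewrite prodf_seq_neq0; apply/allP=> n _; rewrite (prime_elt_neq0 (prime_lin n)) implybT. Qed.

Section Fiber.
Variables (L : finFieldType) (io : {rmorphism K -> L}) (lam : L).
Hypothesis hlam : lam ^+ 2 - io tau * lam + io delta = 0.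

(** Equal planes mean C = k C0 + m for scalars k and m. Comparing characteristic polynomials, k lam
    + m is again a root of g, hence lam or mu; as 1 and lam are independent over K, either k = 1, m
    = 0 or k = -1, m = tau. *)
Lemma nline_fiber C C0 : C \in Cls -> C0 \in Cls -> nline C = nline C0 ->
  C = C0 \/ C = tau%:M - C0.
Proof.
move=> hC hC0 [h1 h2]; have n1 := Cls_neq0 hC; have n0 := Cls_neq0 hC0.
move: hC hC0; rewrite !inE !mxtrace2E !det2E.
move=> /andP[/eqP t1 /eqP d1] /andP[/eqP t0 /eqP d0].
pose k := C 1 0 / C0 1 0; pose m := C 0 0 - k * C0 0 0.
have e10 : C 1 0 = k * C0 1 0 by rewrite /k divfK.
have e01 : C 0 1 = k * C0 0 1.
  by rewrite /k -mulrA [_^-1 * _]mulrC -h2 mulrCA divff // mulr1.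
have e00 : C 0 0 = k * C0 0 0 + m by rewrite /m; ring.
have e11 : C 1 1 = k * C0 1 1 + m.
  have : C 0 0 - C 1 1 = k * (C0 0 0 - C0 1 1).
    by rewrite /k -mulrA [_^-1 * _]mulrC -h1 mulrCA divff // mulr1.
  move=> e; have -> : C 1 1 = C 0 0 - (C 0 0 - C 1 1) by ring.
  by rewrite e /m; ring.
have T : k * tau + m *+ 2 = tau by rewrite -[RHS]t1 e00 e11 -t0; ring.
have D : k ^+ 2 * delta + k * m * tau + m ^+ 2 = delta.
  by rewrite -[RHS]d1 e00 e11 e01 e10 -t0 -d0; ring.
(* The product is g(k lam + m): the factors are k lam + m - lam and k lam + m - mu. *)
have R : (io (k - 1) * lam + io m) * (io (k + 1) * lam + io (m - tau)) = 0.
  have -> : (io (k - 1) * lam + io m) * (io (k + 1) * lam + io (m - tau)) =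
    io (k ^+ 2 - 1) * (lam ^+ 2 - io tau * lam + io delta)
    + io (k * (k * tau + m *+ 2 - tau)) * lam
    + io (m * (k * tau + m *+ 2 - tau))
    - io (k ^+ 2 * delta + k * m * tau + m ^+ 2 - delta).
    by rewrite !(rmorphD, rmorphB, rmorphM, rmorphXn, rmorphMn, rmorph1) /=; ring.
  by rewrite hlam T D !subrr !mulr0 rmorph0 mul0r; ring.
move/eqP: R; rewrite mulf_eq0 => /orP[] /eqP /(lam_free noroot hlam) [hk hm].
  have k1 : k = 1 by apply/eqP; rewrite -subr_eq0 hk.
  left; apply: mx2P; rewrite ?e00 ?e01 ?e10 ?e11 ?k1 ?hm; ring.
have k1 : k = - 1 by apply/eqP; rewrite -subr_eq0 opprK hk.
have m1 : m = tau by apply/eqP; rewrite -subr_eq0 hm.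
by right; apply: mx2P; rewrite ?e00 ?e01 ?e10 ?e11 ?k1 ?m1 !mxE /=; ring.
Qed.

(** If tau - C were C, then 2 [C 1 0] = 0 would force characteristic 2, so tau = 2 [C 0 0] = 0, and
    the discriminant of g would vanish. *)
Lemma nline_compl C : C \in Cls ->
  [/\ tau%:M - C \in Cls, tau%:M - C != C & nline (tau%:M - C) = nline C].
Proof.
move=> hC; have n1 := Cls_neq0 hC; have h := hC.
move: h; rewrite !inE !mxtrace2E !det2E => /andP[/eqP t1 /eqP d1]; split.
- rewrite !mxE /= -t1 -d1; apply/andP; split; apply/eqP; ring.
- apply/eqP=> e.
  have e1 := congr1 (fun M : 'M[K]_2 => M 1 0) e.
  have e2 := congr1 (fun M : 'M[K]_2 => M 0 0) e.
  move: e1 e2; rewrite !mxE /= => e1 e2.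
  have two0 : 2%:R = 0 :> K.
    by apply: (mulIf n1); rewrite mul0r mulr_natl mulr2n -{1}e1 mulr0n; ring.
  have := disc_neq0 noroot hlam; have -> : tau = C 0 0 * 2%:R by rewrite mulr_natr mulr2n -{1}e2 mulr1n; ring.
  by rewrite two0 mulr0 -mulr_natr (natrM _ 2 2) two0 mul0r mulr0 subr0 expr0n eqxx.
by rewrite /nline !mxE /= !mulr0n !add0r !mulr1n -t1; congr (_, _);
   rewrite ?invrN ?mulrNN // -[RHS]mulrNN -invrN; congr (_ / _); ring.
Qed.

Lemma piST_f4_square : exists2 u : K, u != 0 &
  piST (f4 tau delta) = u%:MP * Eprod ^+ 2.
Proof.
exists (\prod_(C in Cls) C 1 0).
  by rewrite prodf_seq_neq0; apply/allP=> C _; apply/implyP/Cls_neq0.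
rewrite piST_f4 (eq_bigr (fun C : 'M[K]_2 => (C 1 0)%:MP * lin (nline C))); last first.
  by move=> C /Cls_neq0/linf_nline.
rewrite big_split /= -rmorph_prod /=; congr (_ * _).
rewrite (partition_big_imset nline) /= -/Nset /Eprod expr2 -big_split /=.
apply: eq_bigr => n /imsetP[C hC en].
have [c1 c2 c3] := nline_compl hC.
rewrite (eq_bigl (mem [set C; tau%:M - C])); last first.
  move=> C'; transitivity (C' \in [set C; tau%:M - C]) => //; rewrite in_set2.
  apply/andP/orP => [[hC' /eqP e]|].
    have [|->|->] := nline_fiber hC' hC; rewrite ?eqxx //; [by rewrite e|by left|by right].
  by case=> /eqP ->; rewrite ?hC ?c1 ?c3 en.
rewrite (eq_bigr (fun _ => lin n)); last first.
  by move=> C'; rewrite !inE => /orP[] /eqP ->; rewrite ?c3 en.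
by rewrite prodr_const cards2 eq_sym c2 /= expr2.
Qed.
End Fiber.

End Cls.

Section SubAlg.
Variables (K : fieldType) (n k : nat) (t : k.-tuple {mpoly K[n]}).

Lemma in_subalgC e : in_subalg t e%:MP.
Proof. by exists e%:MP; rewrite comp_mpolyC. Qed.
Lemma in_subalg0 : in_subalg t 0.
Proof. by rewrite -(mpolyC0 n K); apply: in_subalgC. Qed.
Lemma in_subalgD x y : in_subalg t x -> in_subalg t y -> in_subalg t (x + y).
Proof. by case=> P -> [Q ->]; exists (P + Q); rewrite comp_mpolyD. Qed.
Lemma in_subalgM x y : in_subalg t x -> in_subalg t y -> in_subalg t (x * y).
Proof. by case=> P -> [Q ->]; exists (P * Q); rewrite rmorphM. Qed.
Lemma in_subalgX x e : in_subalg t x -> in_subalg t (x ^+ e).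
Proof. by case=> P ->; exists (P ^+ e); rewrite rmorphXn. Qed.
Lemma in_subalg_gen i : in_subalg t (tnth t i).
Proof. by exists 'X_i; rewrite tnth_comp_mpolyXU. Qed.
Lemma in_subalg_sum (I : Type) (s : seq I) (P : pred I) F :
  (forall i, P i -> in_subalg t (F i)) -> in_subalg t (\sum_(i <- s | P i) F i).
Proof. by move=> h; apply: big_ind => //; [apply: in_subalg0|apply: in_subalgD]. Qed.
End SubAlg.

(** Serves for a point rescaled by a group element, for the sign change of all variables, and for
    restriction to a line. *)
Lemma hom_scale n (R S : comNzRingType) (f g : {rmorphism {mpoly R[n]} -> S}) (k : S) d p :
  (forall c, f c%:MP = g c%:MP) -> (forall i, f 'X_i = k * g 'X_i) ->
  p \is d.-homog -> f p = k ^+ d * g p.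
Proof.
move=> hC hX /dhomogP hp; rewrite [in LHS](mpolyE p) [in RHS](mpolyE p) !rmorph_sum mulr_sumr.
rewrite !big_seq; apply: eq_bigr => m /hp <-.
rewrite -mul_mpolyC !rmorphM hC mulrCA; congr (_ * _).
rewrite mpolyXE_id !rmorph_prod /= mdegE -prodrXr -big_split /=.
by apply: eq_bigr => i _; rewrite !rmorphXn hX exprMn.
Qed.

Section PihomogM.
Variables (K : fieldType) (n : nat).
Implicit Types p q : {mpoly K[n]}.

Lemma pihomogM p q e d : p \is e.-homog ->
  pihomog mdeg (e + d) (p * q) = p * pihomog mdeg d q.
Proof.
move=> hp; elim/mpolyind: q => [|c m q _ _ IH]; first by rewrite mulr0 !pihomog0 mulr0.
rewrite mulrDr !pihomogD mulrDr IH -scalerAr !linearZ /= -scalerAr; congr (_ *: _ + _).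
have hm : p * 'X_[m] \is (e + mdeg m).-homog by apply: dhomogM => //; rewrite dhomogX.
rewrite pihomogX; case: eqP => [<-|/eqP ne]; first exact: pihomog_dE.
by rewrite mulr0; apply: pihomog_ne0 hm; rewrite eqn_add2l.
Qed.

Lemma pihomogM_lt p q e d : p \is e.-homog -> (d < e)%N ->
  pihomog mdeg d (p * q) = 0.
Proof.
move=> hp lt; elim/mpolyind: q => [|c m q _ _ IH]; first by rewrite mulr0 !pihomog0.
rewrite mulrDr !pihomogD IH -scalerAr !linearZ /= addr0.
have hm : p * 'X_[m] \is (e + mdeg m).-homog by apply: dhomogM => //; rewrite dhomogX.
rewrite (pihomog_ne0 _ hm) ?scaler0 //; lia.
Qed.
End PihomogM.

(** * Invariance of det and P1(det) *)

Section Invariants.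
Variable K : finFieldType.
Local Notation T := {mpoly K[3]}.
Local Notation a := (aT K).
Local Notation b := (bT K).
Local Notation c := (cT K).
Local Notation q := #|K|.
Local Notation P1 := (steenrodP1 (detT K)).

Definition frobT (x : T) : T := x ^+ q.
Lemma frobT_zmod : zmod_morphism frobT.
Proof.
by move=> x y; rewrite /frobT (expr_cardD (@mpolyC 3 K)) (expr_cardN (@mpolyC 3 K)).
Qed.
Lemma frobT_monoid : monoid_morphism frobT.
Proof. by split=> [|x y]; rewrite /frobT ?expr1n ?exprMn. Qed.
HB.instance Definition _ := GRing.isZmodMorphism.Build T T frobT frobT_zmod.
HB.instance Definition _ := GRing.isMonoidMorphism.Build T T frobT frobT_monoid.

Lemma detT_genX : detT K = \det (genX K).
Proof. by rewrite det2E !mx2E /detT; ring. Qed.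

Lemma P1E : P1 = - a ^+ q * a *+ 2 - b ^+ q * c - b * c ^+ q.
Proof.
rewrite /steenrodP1 /detT; move: #|K| => n.
rewrite rmorphB rmorphN rmorphXn rmorphM /= /aT /bT /cT !mmapX !mmap1U.
have E (x y x' y' : T) : ((x%:P + x'%:P * 'X) * (y%:P + y'%:P * 'X))`_1
   = x * y' + x' * y.
  have -> : (x%:P + x'%:P * 'X) * (y%:P + y'%:P * 'X) =
     (x * y)%:P + (x * y' + x' * y)%:P * 'X + (x' * y')%:P * 'X^2.
    by rewrite !(polyCD, polyCM); ring.
  by rewrite !(coefD, coefCM, coefC, coefX, coefXn) /=; ring.
rewrite [(_ + _) ^+ 2]expr2 coefB coefN.
transitivity (- (a * a ^+ n + a ^+ n * a) - (b * c ^+ n + b ^+ n * c)).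
  by congr (- _ - _); apply: E.
move: (a ^+ n) (b ^+ n) (c ^+ n) => x y z.
rewrite -[RHS]/(- x * a *+ 2 - y * c - b * z); ring.
Qed.

(** Raising entries to the q-th power fixes matrices over K, so X and its entrywise q-th power are
    conjugated by the same matrix. The trace of their product is therefore invariant. *)
Lemma P1_tr : P1 = - \tr (genX K *m map_mx frobT (genX K)).
Proof.
rewrite P1E mxtrace2E !mulmx2E ![map_mx _ _ _ _]mxE !mx2E /= /frobT.
rewrite (expr_cardN (@mpolyC 3 K)).
by move: (a ^+ q) (b ^+ q) (c ^+ q) => x y z; ring.
Qed.

Lemma detT_inv : detT K \in invT K.
Proof.
apply/invTP=> s; rewrite detT_genX -det_map_mx actT_genX /conj_gen !det_mulmx.
rewrite mulrAC -det_mulmx -map_mxM mulVmx ?map_mx1 ?det1 ?mul1r //.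
exact: GLval_unitmx.
Qed.

Lemma P1_inv : P1 \in invT K.
Proof.
apply/invTP=> s; rewrite P1_tr rmorphN; congr (- _).
have fC (M : 'M[K]_2) : map_mx frobT (map_mx (@mpolyC 3 K) M) = map_mx (@mpolyC 3 K) M.
  by apply/matrixP=> i j; rewrite !mxE /frobT (expr_card_rmorph (@mpolyC 3 K)).
rewrite /= -trace_map_mx map_mxM.
have -> : map_mx (actT s) (map_mx frobT (genX K)) = map_mx frobT (map_mx (actT s) (genX K)).
  by apply/matrixP=> i j; rewrite [LHS]mxE [in LHS]mxE [RHS]mxE [in RHS]mxE /frobT rmorphXn.
rewrite actT_genX /conj_gen !map_mxM !fC !mulmxA.
rewrite -[_ *m _ *m map_mx _ (GLval s) *m map_mx _ (invmx _)]mulmxA -map_mxM mulmxV; last exact: GLval_unitmx.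
rewrite map_mx1 mulmx1 mxtrace_mulC !mulmxA -map_mxM mulmxV; last exact: GLval_unitmx.
by rewrite map_mx1 mul1mx.
Qed.

Lemma dhomog_detT : detT K \is 2.-homog.
Proof.
rewrite /detT rpredB ?rpredN //; first exact: (dhomogMn 2 (dhomog_var _ _)).
exact: (dhomogM (dhomog_var _ _) (dhomog_var _ _)).
Qed.

Lemma dhomog_P1 : P1 \is (q + 1).-homog.
Proof.
rewrite P1E; have X i : ('X_i : T) ^+ q \is q.-homog.
  by rewrite -[X in X.-homog]mul1n; apply: dhomogMn (dhomog_var _ _).
have M i j : ('X_i : T) ^+ q * 'X_j \is (q + 1).-homog.
  by apply: dhomogM (dhomog_var _ _).
rewrite [b * _]mulrC mulNr mulNrn; apply: rpredB; last exact: M.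
by apply: rpredB; [rewrite rpredN rpredMn //|]; apply: M.
Qed.

Lemma GL_of_mx (A : 'M[K]_2) : \det A != 0 -> exists s : {'GL_2[K]}, GLval s = A.
Proof.
move=> h; have uA : A \is a GRing.unit by rewrite -[_ \is a _]/(A \in unitmx) unitmxE unitfE.
by exists (FinRing.Unit uA).
Qed.

End Invariants.

(** * The conjugacy class attached to g, and semi-invariants *)

Section Lines.
Variables (K : finFieldType) (tau delta : K).
Hypothesis noroot : forall x, x ^+ 2 - tau * x + delta != 0.
Local Notation T := {mpoly K[3]}.
Implicit Types (C : 'M[K]_2) (s : {'GL_2[K]}) (f : T).
Local Notation Cls := (Cls tau delta).
Local Notation Nset := (Nset tau delta).
Local Notation Eprod := (Eprod tau delta).
Local Notation C0 := (Cmat tau delta 0 1).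
Local Notation l0 := (lin (- tau, - delta)).

(** The base point of the class is the companion matrix of g. *)
Lemma C0E : C0 = mx2 0 (- delta) 1 tau.
Proof. by rewrite /Cmat horner_quad divr1 subr0; congr (mx2 _ (- _) _ _); ring. Qed.

Lemma C0_Cls : C0 \in Cls.
Proof. by apply/ClsP; rewrite C0E !mx2E horner_quad; split; ring. Qed.

Lemma linf_C0 : linf C0 = l0.
Proof.
by rewrite linfE C0E !mx2E /lin /=; congr (lf _ _ _); ring.
Qed.

Lemma l0_Nset : (- tau, - delta) \in Nset.
Proof.
apply/imsetP; exists C0; first exact: C0_Cls.
by rewrite /nline C0E !mx2E !divr1 sub0r.
Qed.

Lemma conj_Cls s C : C \in Cls -> GLval s *m C *m invmx (GLval s) \in Cls.
Proof.
have us := GLval_unitmx s.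
rewrite !inE mxtrace_mulC mulmxA mulVmx // mul1mx.
by rewrite !det_mulmx mulrAC -det_mulmx mulmxV // det1 mul1r.
Qed.

Lemma Cls_conj C : C \in Cls ->
  exists s, GLval s *m C0 *m invmx (GLval s) = C.
Proof.
move=> hC; have n1 := Cls_neq0 noroot hC; case/ClsP: hC => h1 h2.
(* The columns are e1 and C e1, a basis because [C 1 0] is nonzero; in this basis C becomes the
   companion matrix. *)
have [|s hs] := @GL_of_mx K (mx2 1 (C 0 0) 0 (C 1 0)).
  by rewrite det2E !mx2E mulr0 subr0 mul1r.
exists s; have us := GLval_unitmx s.
suff e : GLval s *m C0 = C *m GLval s by rewrite e -mulmxA mulmxV // mulmx1.
rewrite hs C0E; apply: mx2P; rewrite !mulmx2E !mx2E ?h1 ?h2 ?horner_quad; ring.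
Qed.

Lemma divides_act s f g : divides f g -> divides (actT s f) (actT s g).
Proof. exact: divides_rmorph. Qed.

Lemma dividesC (e : K) f : e != 0 -> divides f (e%:MP * f) /\ divides (e%:MP * f) f.
Proof.
move=> e0; split; first by exists e%:MP.
by exists (e^-1)%:MP; rewrite mulrA -rmorphM mulVf // rmorph1 mul1r.
Qed.

Lemma lin_act n : n \in Nset -> exists s k, k != 0 /\ actT s l0 = k%:MP * lin n.
Proof.
case/imsetP=> C hC ->; have [s hs] := Cls_conj hC.
exists s, (C 1 0); split; first exact: Cls_neq0 hC.
by rewrite -linf_C0 actT_linf hs linf_nline // (Cls_neq0 noroot hC).
Qed.

(** Weaker than invariance because E is preserved only up to sign, and a gcd only up to a
    constant. *)
Definition semi_inv f := forall s, exists2 k : K, k != 0 & actT s f = k%:MP * f.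

Lemma semi_inv_inv f : f \in invT K -> semi_inv f.
Proof. by move/invTP=> h s; exists 1; rewrite ?oner_eq0 // rmorph1 mul1r h. Qed.

Lemma semi_inv_lin f n : semi_inv f -> n \in Nset -> divides l0 f -> divides (lin n) f.
Proof.
move=> hf /lin_act[s [k [k0 hk]]] /(divides_act s); rewrite hk.
have [k' k0' ->] := hf s.
move=> h; apply: divides_trans (proj1 (dividesC (lin n) k0)) _.
exact: divides_trans h (proj2 (dividesC f k0')).
Qed.

Lemma semi_inv_Eprod f : semi_inv f -> divides l0 f -> divides Eprod f.
Proof. by move=> hf h; apply: Eprod_divides => n hn; apply: semi_inv_lin. Qed.

Lemma piST_f4_inv : piST (f4 tau delta) \in invT K.
Proof.
apply/invTP=> s; rewrite piST_f4 // rmorph_prod /=.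
rewrite [RHS](reindex_onto (fun C : 'M[K]_2 => GLval s *m C *m invmx (GLval s))
   (fun C => invmx (GLval s) *m C *m GLval s)) /=; last first.
  move=> C _; rewrite !mulmxA mulmxV ?GLval_unitmx // mul1mx -mulmxA.
  by rewrite mulmxV ?GLval_unitmx // mulmx1.
have K' C : invmx (GLval s) *m (GLval s *m C *m invmx (GLval s)) *m GLval s = C.
  rewrite !mulmxA mulVmx ?GLval_unitmx // mul1mx -mulmxA.
  by rewrite mulVmx ?GLval_unitmx // mulmx1.
apply: eq_big => C; last by rewrite actT_linf.
rewrite K' eqxx andbT; apply/idP/idP; first exact: conj_Cls.
by move/(conj_Cls s^-1%g); rewrite GL_VxE invmxK K'.
Qed.

Section WithExt.
Variables (L : finFieldType) (io : {rmorphism K -> L}) (lam : L).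
Hypothesis hlam : lam ^+ 2 - io tau * lam + io delta = 0.

(** A nonzero multiple of E^2 is the invariant p4, and T is a domain. *)
Lemma Eprod_act s : actT s Eprod = Eprod \/ actT s Eprod = - Eprod.
Proof.
have [u u0 hu] := piST_f4_square noroot hlam.
have := invTP _ piST_f4_inv s; rewrite hu rmorphM rmorphXn /= actTC.
have uu : u%:MP != 0 :> T by rewrite mpolyC_eq0.
move/(mulfI uu)/eqP; rewrite eqf_sqr => /orP[] /eqP ->; by [left|right].
Qed.

Lemma semi_inv_Eprod_self : semi_inv Eprod.
Proof.
move=> s; case: (Eprod_act s) => ->.
  by exists 1; rewrite ?oner_eq0 // rmorph1 mul1r.
by exists (-1); rewrite ?oppr_eq0 ?oner_eq0 // rmorphN rmorph1 mulN1r.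
Qed.
End WithExt.
End Lines.

(** * Restriction to one factor *)

Section Restriction.
Variables (K : finFieldType) (tau delta : K).
Hypothesis noroot : forall x, x ^+ 2 - tau * x + delta != 0.
Variables (L : finFieldType) (io : {rmorphism K -> L}) (lam : L).
Hypothesis hlam : lam ^+ 2 - io tau * lam + io delta = 0.
Hypothesis cardL : #|L| = (#|K| ^ 2)%N.
Local Notation T := {mpoly K[3]}.
Local Notation a := (aT K).
Local Notation b := (bT K).
Local Notation c := (cT K).
Local Notation q := #|K|.
Local Notation P1 := (steenrodP1 (detT K)).
Implicit Types (s : {'GL_2[K]}) (f g : T).
Local Notation C0 := (Cmat tau delta 0 1).
Local Notation l0 := (lin (- tau, - delta)).
Local Notation mu := (io tau - lam).

(* A point of the plane l0 = 0 on the conic det = 0, for m = lam or mu. *)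
Definition isopt (m : L) : 'I_3 -> L := tnth [tuple - m; - m ^+ 2; 1].
Local Notation ev := (mmap io).

Lemma ev_vars v : (ev v a = v o0) * (ev v b = v o1)
  * (ev v c = v o2).
Proof. by rewrite /aT /bT /cT !mmapX !mmap1U. Qed.

Lemma ev_lf v x y z : ev v (lf x y z) = io x * v o0
  + io y * v o1 + io z * v o2.
Proof. by rewrite /lf !rmorphD !rmorphM /= !mmapC !ev_vars. Qed.

Lemma ev_detT v : ev v (detT K) = - v o0 ^+ 2
  - v o1 * v o2.
Proof. by rewrite /detT rmorphB rmorphN rmorphXn rmorphM /= !ev_vars. Qed.

Lemma isopt_detT m : ev (isopt m) (detT K) = 0.
Proof. by rewrite ev_detT /isopt !tuple3E; ring. Qed.

Lemma isopt_l0 : (ev (isopt lam) l0 = 0) * (ev (isopt mu) l0 = 0).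
Proof.
rewrite /lin !ev_lf /isopt !tuple3E /= rmorph1 !rmorphN.
by split; rewrite -[RHS]oppr0 -hlam; ring.
Qed.

(** The value of X at the point [isopt m]: the column (-m, 1) times the row (1, m), a nilpotent
    matrix. *)
Definition isomx (m : L) : 'M[L]_2 := mx2 (- m) (- m ^+ 2) 1 m.

Lemma ev_genX m : map_mx (ev (isopt m)) (genX K) = isomx m.
Proof. by apply: mx2P; rewrite mxE !mx2E ?rmorphN /= ?ev_vars /isopt ?tuple3E ?opprK. Qed.

(** The matrix hypothesis is s^-1 X s = k X', with X and X' the values of the generic matrix at the
    two points and the inverse cleared. *)
Lemma ev_act s m m' k f d : f \is d.-homog ->
  isomx m *m map_mx io (GLval s) = k *: (map_mx io (GLval s) *m isomx m') ->
  ev (isopt m) (actT s f) = k ^+ d * ev (isopt m') f.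
Proof.
move=> hf h.
pose F : {rmorphism T -> L} := GRing.RMorphism.clone _ _ (ev (isopt m) \o actT s) _.
apply: (@hom_scale 3 K L F (ev (isopt m')) k d f _ _ hf) => [e|].
  by rewrite /= actTC !mmapC.
have E : map_mx (ev (isopt m)) (map_mx (actT s) (genX K)) = k *: map_mx (ev (isopt m')) (genX K).
  rewrite actT_genX /conj_gen !map_mxM !ev_genX -mulmxA.
  have mC (M : 'M[K]_2) : map_mx (ev (isopt m)) (map_mx (@mpolyC 3 K) M) = map_mx io M.
    by apply/matrixP=> i j; rewrite !mxE mmapC.
  rewrite !mC h -scalemxAr mulmxA -map_mxM mulVmx ?GLval_unitmx //.
  by rewrite map_mx1 mul1mx.
have H i j : ev (isopt m) (actT s (genX K i j)) = k * ev (isopt m') (genX K i j).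
  by have := congr1 (fun M : 'M[L]_2 => M i j) E; rewrite [LHS]mxE [in LHS]mxE [RHS]mxE [in RHS]mxE.
apply: ord3P; first by have := H 0 0; rewrite !mx2E.
  by have := H 0 1; rewrite !mx2E.
by have := H 1 0; rewrite !mx2E.
Qed.

(** Invariance modulo [l0] under the stabiliser of its plane. This weaker property passes to the
    cofactor of [detT K] modulo [l0], which makes the induction on the degree possible. *)
Definition inv_mod_l0 f :=
  forall s, (exists k : K, actT s l0 = k%:MP * l0) -> divides l0 (actT s f - f).

Lemma inv_mod_l0_inv f : f \in invT K -> inv_mod_l0 f.
Proof. by move/invTP=> h s _; rewrite h subrr; apply: divides0. Qed.

Lemma ev_divides m f : (m = lam \/ m = mu) -> divides l0 f -> ev (isopt m) f = 0.
Proof. by move=> hm [g ->]; rewrite rmorphM /=; case: hm => ->; rewrite isopt_l0 mulr0. Qed.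

(** Multiplying [isomx mu] by C0 on the right scales it by mu, on the left by lam. So x + y C0
    rescales the point by (x + y mu) / (x + y lam), and f by the d-th power of this factor. *)
Lemma torus_ev f d x y : inv_mod_l0 f -> f \is d.-homog -> (x, y) != (0, 0) ->
  (io x + io y * mu) ^+ d * ev (isopt mu) f = (io x + io y * lam) ^+ d * ev (isopt mu) f.
Proof.
move=> hf hd xy.
have nz : io y * lam + io x != 0.
  by apply/eqP=> /(lam_free noroot hlam)[h1 h2]; rewrite h1 h2 eqxx in xy.
have dm : io delta = lam * mu by rewrite (lam_mul hlam).
(* The matrix is x + y C0, of determinant (x + y lam) (x + y mu); it commutes with C0 and so fixes
   [l0]. *)
have [|s hs] := @GL_of_mx K (mx2 x (- (y * delta)) y (x + y * tau)).
  rewrite det2E !mx2E -(fmorph_eq0 io) !(rmorphB, rmorphD, rmorphM, rmorphN) /= dm.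
  have -> : io x * (io x + io y * io tau) - - (io y * (lam * mu)) * io y =
    (io y * lam + io x) * (io x + io y * mu) by ring.
  rewrite mulf_neq0 //; apply: contra_neq xy => e.
  have [h1 h2] : - y = 0 /\ x + y * tau = 0.
    by apply: (lam_free noroot hlam); rewrite rmorphN rmorphD rmorphM /= -[RHS]e; ring.
  have y0 : y = 0 by rewrite -[y]opprK h1 oppr0.
  by move: h2; rewrite y0 mul0r addr0 => ->.
have sC : GLval s *m C0 = C0 *m GLval s.
  by rewrite hs C0E; apply: mx2P; rewrite !mulmx2E !mx2E; ring.
have hl : exists k : K, actT s l0 = k%:MP * l0.
  exists 1; rewrite -(linf_C0 tau delta) actT_linf sC -mulmxA mulmxV ?GLval_unitmx //.
  by rewrite mulmx1 rmorph1 mul1r.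
have := ev_divides (or_intror erefl) (hf s hl).
have E1 : isomx mu *m map_mx io (GLval s) = (io x + io y * mu) *: isomx mu.
  rewrite hs; apply: mx2P; rewrite mulmx2E !mxE /= ?(rmorphD, rmorphM, rmorphN) /= ?dm; ring.
have E2 : map_mx io (GLval s) *m isomx mu = (io y * lam + io x) *: isomx mu.
  rewrite hs; apply: mx2P; rewrite mulmx2E !mxE /= ?(rmorphD, rmorphM, rmorphN) /= ?dm; ring.
rewrite rmorphB /= (@ev_act s mu mu ((io x + io y * mu) / (io y * lam + io x)) f d hd).
  move/eqP; rewrite subr_eq0 => /eqP H.
  by rewrite -[in RHS]H mulrA -exprMn [_ * (_ / _)]mulrC [io x + io y * lam]addrC divfK.
by rewrite E1 E2 scalerA divfK.
Qed.

Lemma ext_coord z : exists x y, z = io x + io y * lam.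
Proof.
pose F (p : K * K) := io p.1 + io p.2 * lam.
have iF : injective F.
  move=> [x y] [x' y'] /eqP; rewrite /F /= -subr_eq0 => /eqP e.
  have [|/eqP h1 /eqP h2] := @lam_free K L io tau delta lam noroot hlam (y - y') (x - x').
    by rewrite !rmorphB -[RHS]e; ring.
  by move: h1 h2; rewrite !subr_eq0 => /eqP -> /eqP ->.
have [|p ->] := codomP (@inj_card_onto _ _ F iF _ z); last by exists p.1, p.2.
by rewrite cardL card_prod mulnn.
Qed.

(** For a generator z of the units of L, whose conjugate is z^q, the torus gives z^(qd) = z^d; so
    q^2 - 1 divides (q - 1) d. *)
Lemma isopt_degree f d : inv_mod_l0 f -> f \is d.-homog -> ev (isopt mu) f != 0 ->
  (q + 1 %| d)%N.
Proof.
move=> hf hd nz; have [z hz] := finField_prim_root L.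
have [x [y ez]] := ext_coord z.
have q1 := finNzRing_gt1 K.
have xy : (x, y) != (0, 0).
  apply/eqP=> -[x0 y0]; have := prim_root_eq0 hz.
  by rewrite ez x0 y0 rmorph0 mul0r addr0 eqxx cardL; case: q q1 => [|[|k]].
have := torus_ev hf hd xy.
have -> : io x + io y * mu = z ^+ q.
  by rewrite ez (expr_cardD io) exprMn !(expr_card_rmorph io) (lam_exp noroot hlam).
rewrite -ez -exprM => /(mulIf nz)/eqP; rewrite (eq_prim_root_expr hz) cardL.
have -> : ((q ^ 2).-1 = (q - 1) * (q + 1))%N by rewrite -(subn_sqr q 1) subn1.
rewrite eqn_mod_dvd; last by rewrite leq_pmull // ltnW.
have -> : (q * d - d = (q - 1) * d)%N by rewrite mulnBl mul1n.
by rewrite dvdn_pmul2l // subn_gt0.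
Qed.

Lemma swap_ev f d : inv_mod_l0 f -> f \is d.-homog ->
  ev (isopt mu) f = (- 1) ^+ d * ev (isopt lam) f.
Proof.
move=> hf hd.
(* This matrix conjugates C0 into tau - C0. It therefore maps [l0] to its negative and exchanges the
   two eigenvalues, hence the two points. *)
have [|s hs] := @GL_of_mx K (mx2 (- 1) (- tau) 0 1).
  by rewrite det2E !mx2E !mulr0 subr0 mulr1 oppr_eq0 oner_eq0.
have sC : GLval s *m C0 = (tau%:M - C0) *m GLval s.
  have -> : tau%:M - C0 = mx2 tau delta (- 1) 0.
    by rewrite C0E; apply: mx2P; rewrite !mxE /=; ring.
  by rewrite hs C0E; apply: mx2P; rewrite !mulmx2E !mx2E; ring.
have hl : exists k : K, actT s l0 = k%:MP * l0.
  exists (-1); rewrite -(linf_C0 tau delta) actT_linf sC -mulmxA mulmxV ?GLval_unitmx //.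
  rewrite mulmx1 rmorphN rmorph1 mulN1r linfE linfE C0E !mxE /= /lf.
  by rewrite !(rmorphB, rmorphN, rmorphD, rmorph0, rmorph1, rmorphMn) /=; ring.
have := ev_divides (or_intror erefl) (hf s hl).
have dm : io delta = lam * mu by rewrite (lam_mul hlam).
rewrite rmorphB /= (@ev_act s mu lam (- 1) f d hd).
  by move/eqP; rewrite subr_eq0 => /eqP ->.
rewrite hs; apply: mx2P; rewrite mulmx2E !mxE /= big_ord_recl big_ord1 !mxE /=.
all: rewrite !(rmorphN, rmorph1, rmorph0) /=; ring.
Qed.

(** Frobenius exchanges lam and mu, so the value is lam^2 - 2 lam mu + mu^2. It is nonzero, which
    lets powers of P1(det) cancel any value in K. *)
Lemma isopt_P1 : ev (isopt mu) P1 = io (tau ^+ 2 - delta *+ 4).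
Proof.
rewrite P1E !(rmorphB, rmorphN, rmorphM, rmorphXn, rmorphMn) /= !ev_vars /isopt !tuple3E.
rewrite -(lam_mul hlam) expr1n !mulr1 !(expr_cardN io) exprAC (mu_exp noroot hlam); ring.
Qed.

(** On the plane of [l0] the conic reduces to two points off c = 0, so modulo det and [l0] the forms
    of degree d + 1 are spanned by c^d a and c^(d+1). The index is the degree minus one. *)
Definition reducible_mod (d : nat) f := exists (r s : K) g h,
  f = c ^+ d * (r%:MP * a + s%:MP * c) + detT K * g + l0 * h.

Lemma reducible_modD d f g : reducible_mod d f -> reducible_mod d g -> reducible_mod d (f + g).
Proof.
case=> [r [s [u [v ->]]]] [r' [s' [u' [v' ->]]]].
by exists (r + r'), (s + s'), (u + u'), (v + v'); rewrite !rmorphD /=; ring.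
Qed.

Lemma reducible_modZ d e f : reducible_mod d f -> reducible_mod d (e%:MP * f).
Proof.
case=> [r [s [u [v ->]]]].
by exists (e * r), (e * s), (e%:MP * u), (e%:MP * v); rewrite !rmorphM /=; ring.
Qed.

Lemma reducible_modX d i f : reducible_mod d f -> reducible_mod d.+1 ('X_i * f).
Proof.
have El : l0 = - tau%:MP * a + b - delta%:MP * c.
  by rewrite /lin /lf /= !rmorphN rmorph1; ring.
(* The rewriting rules are a^2 = - det - b c and b = l0 + tau a + delta c. *)
have Ra : reducible_mod d f -> reducible_mod d.+1 (a * f).
  case=> [r [s [u [v ->]]]].
  exists (s - r * tau), (- r * delta), (a * u - c ^+ d * r%:MP), (a * v - c ^+ d.+1 * r%:MP).
  by rewrite El /detT [c ^+ d.+1]exprS !(rmorphB, rmorphM, rmorphN) /=; ring.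
have Rc : reducible_mod d f -> reducible_mod d.+1 (c * f).
  case=> [r [s [u [v ->]]]]; exists r, s, (c * u), (c * v).
  by rewrite exprS; ring.
move: i; apply: ord3P => // hf.
have -> : 'X_o1 * f = tau%:MP * (a * f) + (delta%:MP * (c * f) + l0 * f).
  by rewrite El /bT; ring.
apply: reducible_modD; first exact: reducible_modZ (Ra hf).
apply: reducible_modD; first exact: reducible_modZ (Rc hf).
by exists 0, 0, 0, f; rewrite !rmorph0; ring.
Qed.

Lemma reducible_modP d f : f \is d.+1.-homog -> reducible_mod d f.
Proof.
have R0 e : reducible_mod e 0 by exists 0, 0, 0, 0; rewrite !rmorph0; ring.
have El : l0 = - tau%:MP * a + b - delta%:MP * c.
  by rewrite /lin /lf /= !rmorphN rmorph1; ring.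
have RX e : forall m : 'X_{1..3}, mdeg m = e.+1 -> reducible_mod e 'X_[m].
  elim: e => [|e IH] m hm.
    have /eqP/mdeg1P[i /eqP ->] := hm.
    move: i; apply: ord3P.
    - by exists 1, 0, 0, 0; rewrite rmorph1 rmorph0 /aT; ring.
    - by exists tau, delta, 0, 1; rewrite El /bT; ring.
    by exists 0, 1, 0, 0; rewrite rmorph1 rmorph0 /cT; ring.
  have [i hi] : exists i, m i != 0%N.
    apply/existsP; rewrite -negb_forall; apply/negP=> /forallP h.
    by move: hm; rewrite mdegE big1 // => i _; apply/eqP.
  have e1 : (U_(i) <= m)%MM by rewrite lep1mP.
  rewrite -(submK e1) addmC mpolyXD; apply: reducible_modX; apply: IH.
  by have := congr1 mdeg (submK e1); rewrite mdegD mdeg1 hm addn1 => -[].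
move=> hf; rewrite (mpolyE f) big_seq; apply: big_ind => //.
  exact: reducible_modD.
move=> m hm; rewrite -mul_mpolyC; apply: reducible_modZ; apply: RX.
by move/dhomogP: hf; apply.
Qed.

Lemma l0_ndiv_detT : ~ divides l0 (detT K).
Proof.
(* The sum of the two conjugate points lies on the plane, and det takes there the value (lam -
   mu)^2, nonzero in every characteristic. *)
pose v := tnth [tuple - lam - mu; - lam ^+ 2 - mu ^+ 2; 1 + 1].
move=> [h e]; have := congr1 (ev v) e; rewrite rmorphM /=.
have -> : ev v l0 = 0.
  rewrite /lin ev_lf /v !tuple3E /= rmorph1 !rmorphN -(lam_mul hlam).
  by have := hlam; rewrite -(lam_mul hlam) => H; ring.
rewrite mulr0 ev_detT /v !tuple3E => /eqP; apply/negP.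
have -> : - (- lam - mu) ^+ 2 - (- lam ^+ 2 - mu ^+ 2) * (1 + 1) = (lam - mu) ^+ 2 by ring.
by rewrite expf_eq0 /= subr_eq0 (lam_neq_mu noroot hlam).
Qed.

Lemma inv_mod_l0B f g : inv_mod_l0 f -> inv_mod_l0 g -> inv_mod_l0 (f - g).
Proof.
move=> hf hg s hs; rewrite rmorphB /=.
have -> : actT s f - actT s g - (f - g) = (actT s f - f) - (actT s g - g) by ring.
by apply: dividesB; [apply: hf|apply: hg].
Qed.

Lemma inv_mod_l0Z (e : K) f : inv_mod_l0 f -> inv_mod_l0 (e%:MP * f).
Proof.
move=> hf s hs; rewrite rmorphM /= actTC -mulrBr.
exact/divides_mull/hf.
Qed.

Section Span.
Variable th : T.
Local Notation sub := (in_subalg [tuple detT K; P1; th]).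

(** Vanishing at the point kills both coefficients of the reduced form, since 1 and lam are
    independent over K. So f is det times g' modulo [l0]. As det is invariant and the prime [l0]
    does not divide it, g' inherits [inv_mod_l0], and the induction hypothesis applies two degrees
    lower. *)
Lemma restrict_isopt0 d f :
  (forall e, (e < d)%N -> forall g, g \is e.-homog -> inv_mod_l0 g ->
     exists x, [/\ sub x, x \is e.-homog & divides l0 (g - x)]) ->
  f \is d.-homog -> inv_mod_l0 f -> ev (isopt mu) f = 0 ->
  exists x, [/\ sub x, x \is d.-homog & divides l0 (f - x)].
Proof.
case: d => [|d] IH hd hf f0.
  exists f; split=> //; last by rewrite subrr; apply: divides0.
  by rewrite (homog0C hd); apply: in_subalgC.
have [r [s [g [h e]]]] := reducible_modP hd.
have hl0 : l0 \is 1.-homog by apply: dhomog_lf.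
have [r0 s0] : r = 0 /\ s = 0.
  have : io r * lam + io (s - r * tau) = 0.
    move: f0; rewrite e !rmorphD !rmorphM rmorphXn rmorphD !rmorphM /= !mmapC isopt_detT isopt_l0.
    rewrite !ev_vars /isopt !tuple3E expr1n => f0.
    by rewrite rmorphN rmorphM /= -[RHS]f0; ring.
  by case/(lam_free noroot hlam)=> -> /eqP; rewrite mul0r subr0 => /eqP ->.
move: e; rewrite r0 s0 !rmorph0 !mul0r addr0 mulr0 add0r => e.
(* In degree 1 the det term contributes nothing, so f is a multiple of [l0]. *)
case: d => [|d] in IH hd e *.
  exists 0; split; [exact: in_subalg0|exact: rpred0|rewrite subr0].
  rewrite -(pihomog_dE hd) e pihomogD (pihomogM_lt _ (dhomog_detT K)) // add0r.
  by rewrite (pihomogM _ 0 hl0) mulrC; exists (pihomog mdeg 0 h).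
pose g' := pihomog mdeg d g.
have e' : f = detT K * g' + l0 * pihomog mdeg d.+1 h.
  by rewrite -(pihomogM _ _ hl0) -(pihomogM _ _ (dhomog_detT K)) -pihomogD -e pihomog_dE.
have hg' : inv_mod_l0 g'.
  move=> s' hs'; have [k hk] := hs'.
  have [_ _ pM] := prime_lin (- tau, - delta).
  have hdet := invTP _ (detT_inv K) s'.
  have : divides l0 (detT K * (actT s' g' - g')).
    have -> : detT K * (actT s' g' - g') = (actT s' f - f)
      + (l0 * pihomog mdeg d.+1 h - actT s' l0 * actT s' (pihomog mdeg d.+1 h)).
      by rewrite e' rmorphD !rmorphM /= hdet; ring.
    apply: dividesD; first exact: hf.
    rewrite hk; apply: dividesB; first by apply: divides_mulr; apply: dividesxx.
    by apply: divides_mulr; apply: divides_mull; apply: dividesxx.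
  by case/pM=> // /l0_ndiv_detT.
have [|x [x1 x2 x3]] := IH d _ g' (pihomogP _ _ _) hg'; first by rewrite ltnS leqnSn.
exists (detT K * x); split.
- by apply: in_subalgM => //; apply: (in_subalg_gen _ o0).
- exact: dhomogM (dhomog_detT K) x2.
rewrite e' addrAC -mulrBr; apply: dividesD; first exact: divides_mull.
by apply: divides_mulr; apply: dividesxx.
Qed.

(** If f does not vanish at the point, then d = k (q + 1). The value of the reduced form at m is s -
    r m; the swap makes the values at lam and mu equal, so r = 0 and the value lies in K.
    Subtracting a multiple of the k-th power of P1(det) reduces to the vanishing case. *)
Lemma restrict_span d f : f \is d.-homog -> inv_mod_l0 f ->
  exists x, [/\ sub x, x \is d.-homog & divides l0 (f - x)].
Proof.
elim/ltn_ind: d f => d IH f hd hf.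
have IH' e : (e < d)%N -> forall g, g \is e.-homog -> inv_mod_l0 g ->
     exists x, [/\ sub x, x \is e.-homog & divides l0 (g - x)].
  by move=> lt g; apply: IH.
have [f0|fn] := eqVneq (ev (isopt mu) f) 0; first exact: restrict_isopt0 IH' hd hf f0.
have /dvdnP[k ek] := isopt_degree hf hd fn.
have [d' ed] : exists d', d = d'.+1 \/ d = 0%N by exists d.-1; case: (d); [right|left].
have [ke ks] : exists s0 : K, ev (isopt mu) f = io s0.
  (* The exponent d is a multiple of q + 1, and (-1)^q = -1 in L in every characteristic. *)
  have sgn : (-1) ^+ d = 1 :> L.
    rewrite ek mulnC exprM exprD (expr_cardN io) expr1n expr1 mulrNN mulr1.
    by rewrite expr1n.
  have := swap_ev hf hd; rewrite sgn mul1r => e.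
  case: ed => ed'; last first.
    exists f@_0%MM; rewrite -(mmapC (isopt mu) io f@_0%MM); congr (ev _ _).
    by apply: homog0C; move: hd; rewrite ed'.
  rewrite ed' in hd; have [r [s [g [h eh]]]] := reducible_modP hd.
  have E m : m = lam \/ m = mu -> ev (isopt m) f = io s - io r * m.
    move=> hm; rewrite eh !rmorphD !rmorphM rmorphXn rmorphD !rmorphM /= !mmapC isopt_detT.
    have -> : ev (isopt m) l0 = 0 by case: hm => ->; rewrite isopt_l0.
    by rewrite !ev_vars /isopt !tuple3E expr1n; ring.
  exists s; move: e; rewrite !E; [|by left|by right].
  move/eqP; rewrite -subr_eq0.
  have -> : io s - io r * mu - (io s - io r * lam) = io r * (lam - mu) by ring.
  rewrite mulf_eq0 [lam - mu == 0]subr_eq0 (negPf (lam_neq_mu noroot hlam)) orbF => /eqP ->.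
  by rewrite mul0r subr0.
pose D := tau ^+ 2 - delta *+ 4.
have D0 : D != 0 := disc_neq0 noroot hlam.
pose e := ke / D ^+ k.
have hP : e%:MP * P1 ^+ k \is d.-homog.
  by rewrite mul_mpolyC dhomogZ // ek mulnC dhomogMn // dhomog_P1.
have iP : inv_mod_l0 (e%:MP * P1 ^+ k).
  apply/inv_mod_l0Z/inv_mod_l0_inv; apply/invTP=> s; rewrite rmorphXn /=.
  by rewrite (invTP _ (P1_inv K)).
have [|||x [x1 x2 x3]] := restrict_isopt0 (f := f - e%:MP * P1 ^+ k) IH'.
- exact: rpredB.
- exact: inv_mod_l0B.
- rewrite rmorphB rmorphM rmorphXn /= mmapC isopt_P1 ks -rmorphXn -rmorphM /=.
  by rewrite /e -/D divfK ?subrr // expf_neq0.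
exists (x + e%:MP * P1 ^+ k); split.
- apply: in_subalgD => //; apply: in_subalgM; first exact: in_subalgC.
  exact/in_subalgX/(in_subalg_gen _ o1).
- exact: rpredD.
by rewrite opprD addrA addrAC.
Qed.
End Span.

End Restriction.

(** * Descent on the degree *)

Section Generation.
Variables (K : finFieldType) (tau delta : K).
Hypothesis noroot : forall x, x ^+ 2 - tau * x + delta != 0.
Variables (L : finFieldType) (io : {rmorphism K -> L}) (lam : L).
Hypothesis hlam : lam ^+ 2 - io tau * lam + io delta = 0.
Hypothesis cardL : #|L| = (#|K| ^ 2)%N.
Local Notation T := {mpoly K[3]}.
Local Notation a := (aT K).
Local Notation b := (bT K).
Local Notation c := (cT K).
Local Notation q := #|K|.
Local Notation P1 := (steenrodP1 (detT K)).
Implicit Types (s : {'GL_2[K]}) (f g : T).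
Local Notation l0 := (lin (- tau, - delta)).
Local Notation E := (Eprod tau delta).
Local Notation e := #|Nset tau delta|.

Lemma actT_pihomog s d f : actT s (pihomog mdeg d f) = pihomog mdeg d (actT s f).
Proof.
have hc i j : conj_gen s (genX K) i j \is 1.-homog.
  have X i' j' : genX K i' j' \is 1.-homog.
    rewrite (mx2_eta (genX K)) !mxE /=.
    by case: i' j' => [[|[|//]] ?] [[|[|//]] ?]; rewrite /= ?rpredN dhomog_var.
  rewrite /conj_gen !mulmx2E ![map_mx _ _ _ _]mxE ![_ * (_)%:MP]mulrC !mul_mpolyC.
  by rewrite !(rpredD, dhomogZ).
symmetry; apply: (@pihomog_comp_mpoly 3 3 K mdeg).
by apply: ord3P; rewrite tuple3E /= mdeg1; apply: hc.
Qed.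

Lemma invT_pihomog d f : f \in invT K -> pihomog mdeg d f \in invT K.
Proof. by move/invTP=> h; apply/invTP=> s; rewrite actT_pihomog h. Qed.

Lemma invT_quot f g h : f \in invT K -> g \in invT K -> g != 0 -> f = g * h -> h \in invT K.
Proof.
move=> /invTP hf /invTP hg g0 ef; apply/invTP=> s; apply: (mulfI g0).
by rewrite -{1}(hg s) -rmorphM /= -ef hf.
Qed.

Lemma in_subalg_inv k (t : k.-tuple T) x :
  (forall i, tnth t i \in invT K) -> in_subalg t x -> x \in invT K.
Proof.
move=> h [P ->]; apply/invTP=> s; rewrite /actT comp_mpolyA; congr (_ \mPo _).
by apply: eq_from_tnth => i; rewrite tnth_map; apply/invTP.
Qed.

(** The zero alternative covers degrees below that of E. Otherwise the quotient stays homogeneous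
    and semi-invariant, so that the division can be repeated. *)
Lemma Eprod_quot d f : semi_inv f -> f \is d.-homog -> divides l0 f ->
  f = 0 \/ exists z, [/\ (e <= d)%N, z \is (d - e).-homog, f = E * z & semi_inv z].
Proof.
move=> hf hd /(semi_inv_Eprod noroot hf)[z]; rewrite mulrC => ef.
have hE := dhomog_Eprod tau delta.
have [le|lt] := leqP e d; last first.
  by left; rewrite -(pihomog_dE hd) ef (pihomogM_lt _ hE).
right; exists (pihomog mdeg (d - e) z).
have ef' : f = E * pihomog mdeg (d - e) z.
  by rewrite -(pihomogM _ _ hE) subnKC // -ef pihomog_dE.
split=> //; first exact: pihomogP.
move=> s; have [k k0 hk] := hf s; have [k' k0' hk'] := semi_inv_Eprod_self noroot hlam s.
exists (k / k'); first by rewrite mulf_neq0 // invr_neq0.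
have E0 : k'%:MP * E != 0 by rewrite mulf_neq0 ?Eprod_neq0 // mpolyC_eq0.
have kk : k%:MP = k'%:MP * (k / k')%:MP :> T by rewrite -rmorphM mulrCA divff // mulr1.
apply: (mulfI E0); rewrite -{1}hk' -rmorphM /= -ef' hk kk {1}ef'; ring.
Qed.

Lemma homog_span (t : 3.-tuple T) f :
  (forall d, in_subalg t (pihomog mdeg d f)) -> in_subalg t f.
Proof.
move=> h; rewrite (pihomog_partitionE (leqnn (mmeasure mdeg f))).
exact: in_subalg_sum.
Qed.

Lemma Nset_gt0 : (0 < e)%N.
Proof. by apply/card_gt0P; exists (- tau, - delta); apply: l0_Nset. Qed.

Section Even.
Hypothesis evq : ~~ odd q.

Lemma even_two0 (R : comNzRingType) (i : {rmorphism K -> R}) (x : R) : - x = x.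
Proof.
apply: oppr_pchar2; have [p pp pK] := finPcharP K.
have cK : q = (p ^ logn p q)%N by apply: (card_pprimeChar pK).
have p2 : p = 2%N.
  have q1 := finNzRing_gt1 K; move: evq; rewrite cK oddX negb_or.
  by case/andP=> _ /(prime_oddPn pp).
by rewrite -p2; apply: rmorph_pchar pK.
Qed.

Lemma even_Eprod_inv : E \in invT K.
Proof.
apply/invTP=> s; case: (Eprod_act noroot hlam s) => -> //.
exact: (even_two0 (@mpolyC 3 K)).
Qed.

(** The scalar k is carried along because the square root of p4 is a constant multiple of E. *)
Lemma even_generation k f : k != 0 -> f \in invT K ->
  in_subalg [tuple detT K; P1; k%:MP * E] f.
Proof.
move=> k0 hf; apply: homog_span => d.
move: (invT_pihomog d hf) (pihomogP mdeg d f); move: (pihomog _ d f) => {hf}f.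
elim/ltn_ind: d f => d IH f hf hd.
have gi i : tnth [tuple detT K; P1; k%:MP * E] i \in invT K.
  move: i; apply: ord3P; rewrite tuple3E ?detT_inv ?P1_inv //.
  by apply/invTP=> s; rewrite rmorphM /= actTC (invTP _ even_Eprod_inv).
have [x [x1 x2 x3]] := restrict_span noroot hlam cardL (k%:MP * E) hd (inv_mod_l0_inv hf).
have hx := in_subalg_inv gi x1.
have hfx : f - x \in invT K by apply/invTP=> s; rewrite rmorphB /= !(invTP _ _).
have [h|[z [le hz ez _]]] := Eprod_quot (semi_inv_inv hfx) (rpredB hd x2) x3.
  by rewrite -[f](subrK x) h add0r.
rewrite -[f](subrK x); apply: in_subalgD => //; rewrite ez.
have -> : E * z = (k^-1)%:MP * ((k%:MP * E) * z).
  by rewrite !mulrA -rmorphM mulVf // rmorph1 mul1r.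
apply: in_subalgM; first exact: in_subalgC.
apply: in_subalgM; first exact: (in_subalg_gen _ o2).
apply: (IH (d - e)%N) => //; first by have := Nset_gt0; lia.
exact: invT_quot hfx even_Eprod_inv (Eprod_neq0 _ _) ez.
Qed.
End Even.

Definition negT f : T := f \mPo [tuple - a; - b; - c].
HB.instance Definition _ := GRing.LRMorphism.copy negT (comp_mpoly _).

Lemma negT_homog d f : f \is d.-homog -> negT f = (-1) ^+ d * f.
Proof.
pose g : {rmorphism T -> T} := GRing.RMorphism.clone _ _ idfun _.
move=> hd; apply: (@hom_scale 3 K T negT g (-1) d f) => // [x|].
  by rewrite /= /negT comp_mpolyC.
by apply: ord3P; rewrite /= /negT tnth_comp_mpolyXU tuple3E mulN1r.
Qed.

Local Notation Cm := (map_mx (@mpolyC 3 K)).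

(** For traceless s, polarising Cayley-Hamilton gives s X + X s = tr (s X). Hence X + s^-1 X s is tr
    (s X) times s^-1, so minus the conjugation by s is the identity modulo [linf] of s. *)
Lemma reflection_divides s f : \tr (GLval s) = 0 ->
  divides (linf (GLval s)) (f - negT (actT s f)).
Proof.
move=> tr0; have us := GLval_unitmx s.
pose g : {rmorphism T -> T} := GRing.RMorphism.clone _ _ idfun _.
pose r : {rmorphism T -> T} := GRing.RMorphism.clone _ _ (negT \o actT s) _.
have negX : map_mx negT (genX K) = - genX K.
  apply: mx2P; rewrite mxE [in RHS]mxE !mx2E /= ?rmorphN /= /negT;
  by rewrite tnth_comp_mpolyXU tuple3E.
have negC (M : 'M[K]_2) : map_mx negT (Cm M) = Cm M.
  by apply/matrixP=> i j; rewrite !mxE /negT comp_mpolyC.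
have Y : genX K - map_mx negT (map_mx (actT s) (genX K)) =
   linf (GLval s) *: Cm (invmx (GLval s)).
  rewrite actT_genX /conj_gen !map_mxM !negC negX.
  have e1 : Cm (GLval s) *m genX K + genX K *m Cm (GLval s) = (linf (GLval s))%:M.
    have := tr0; rewrite mxtrace2E => /eqP; rewrite addr_eq0 => /eqP h0.
    rewrite linfE h0; apply: mx2P; rewrite mxE [in RHS]mxE !mulmx2E !mx2E ![map_mx _ _ _ _]mxE ?h0 /lf /=;
    by rewrite ?mulr1n ?mulr0n ?rmorphB ?rmorphN /=; ring.
  transitivity (Cm (invmx (GLval s)) *m (Cm (GLval s) *m genX K + genX K *m Cm (GLval s))).
    rewrite mulmxDr !mulmxA -map_mxM mulVmx // map_mx1 mul1mx; congr (_ + _).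
    by rewrite mulmxN mulNmx opprK.
  by rewrite e1 mul_mx_scalar.
have H i j : divides (linf (GLval s)) (genX K i j - negT (actT s (genX K i j))).
  have := congr1 (fun M : 'M[T]_2 => M i j) Y.
  rewrite mxE [in X in _ + X]mxE [(map_mx negT _) i j]mxE [(map_mx (actT s) _) i j]mxE => ->.
  by rewrite mxE; apply: divides_mulr; apply: dividesxx.
apply: (@mpoly_hom_divides 3 K T g r) => [x|].
  by rewrite /= actTC /negT comp_mpolyC.
apply: ord3P; first by have := H 0 0; rewrite !mx2E.
  by have := H 0 1; rewrite !mx2E.
by have := H 1 0; rewrite !mx2E.
Qed.

End Generation.

Lemma odd_two_neq0 (K : finFieldType) : odd #|K| -> 2%:R != 0 :> K.
Proof.
move=> oq; have [p pp pK] := finPcharP K.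
have cK : #|K| = (p ^ logn p #|K|)%N by apply: (card_pprimeChar pK).
rewrite -(dvdn_pcharf pK) dvdn_prime2 //; apply/eqP=> p2.
have q1 := finNzRing_gt1 K; move: oq q1; rewrite cK p2 oddX orbF.
by move/eqP=> ->.
Qed.

(** * Invariants of even degree for odd q *)

Section OddGeneration.
Variables (K : finFieldType) (tau delta : K).
Hypothesis noroot : forall x, x ^+ 2 - tau * x + delta != 0.
Variables (L : finFieldType) (io : {rmorphism K -> L}) (lam : L).
Hypothesis hlam : lam ^+ 2 - io tau * lam + io delta = 0.
Hypothesis cardL : #|L| = (#|K| ^ 2)%N.
Hypothesis oddq : odd #|K|.
Local Notation T := {mpoly K[3]}.
Local Notation P1 := (steenrodP1 (detT K)).
Implicit Types (s : {'GL_2[K]}) (f g : T).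
Local Notation C0 := (Cmat tau delta 0 1).
Local Notation l0 := (lin (- tau, - delta)).
Local Notation E := (Eprod tau delta).
Local Notation e := #|Nset tau delta|.
Local Notation p4 := (piST (f4 tau delta)).

Let two_neq0 : 2%:R != 0 :> K := odd_two_neq0 oddq.

Lemma divides2 (f g : T) : divides f (g *+ 2) -> divides f g.
Proof.
move=> h; have -> : g = (2%:R^-1)%:MP * (g *+ 2).
  by rewrite mulrnAr -mulrnAl -rmorphMn /= -[_ *+ 2]mulr_natr mulVf // rmorph1 mul1r.
exact: divides_mull.
Qed.

(* The matrix 2 C0 - tau, whose conjugation action is minus the reflection in
   the plane l0 = 0. *)
Lemma refl_mx : exists s, [/\ \tr (GLval s) = 0, linf (GLval s) = 2%:R * l0
  & actT s l0 = l0].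
Proof.
have [|s hs] := @GL_of_mx K (mx2 (- tau) (- (delta *+ 2)) 2%:R tau).
  rewrite det2E !mx2E.
  have -> : - tau * tau - - (delta *+ 2) * 2%:R = - (tau ^+ 2 - delta *+ 4) by ring.
  by rewrite oppr_eq0 (disc_neq0 noroot hlam).
have l2 : linf (GLval s) = 2%:R * l0.
  rewrite hs linfE !mx2E /lin /lf /=.
  rewrite !(rmorphB, rmorphD, rmorphN, rmorphMn, rmorph1, rmorph_nat) /=; ring.
exists s; split=> //.
  by rewrite hs mxtrace2E !mx2E addNr.
have h : actT s (2%:R * l0) = 2%:R * l0.
  by rewrite -l2 actT_linf -mulmxA mulmxV ?GLval_unitmx // mulmx1.
have n2 : 2%:R != 0 :> T by rewrite -(rmorph_nat (@mpolyC 3 K)) mpolyC_eq0.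
by apply: (mulfI n2); rewrite -[RHS]h rmorphM rmorph_nat.
Qed.

Lemma divides_refl f : exists s, actT s l0 = l0 /\ forall f, divides l0 (f - negT (actT s f)).
Proof.
have [s [h1 h2 h3]] := refl_mx; exists s; split=> // g.
by have := reflection_divides g h1; rewrite h2; apply: divides_trans; apply: divides_mull; apply: dividesxx.
Qed.

(** Write E = l0 E1. If E were fixed, then E1 would be negated, because [l0] is. But E1 is fixed
    modulo [l0], so [l0] would divide 2 E1, although E is squarefree. *)
Lemma Eprod_refl s : actT s l0 = l0 -> (forall f, divides l0 (f - negT (actT s f))) ->
  negT (actT s E) = - E.
Proof.
move=> sl sr.
pose E1 := \prod_(n in Nset tau delta | n != (- tau, - delta)) lin n.
have eE : E = l0 * E1.
  by rewrite /E1 /Eprod (bigD1 (- tau, - delta)) //= l0_Nset.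
have nE1 : ~ divides l0 E1.
  rewrite /E1 -big_filter => /(prime_elt_prod (prime_lin _))[n].
  by rewrite mem_filter => /andP[/andP[_ /eqP h] _] /lin_inj hn; case: h.
have nl : negT l0 = - l0.
  by rewrite (negT_homog (dhomog_lf _ _ _)) expr1 mulN1r.
have [h|h] : negT (actT s E) = E \/ negT (actT s E) = - E.
  have hE := negT_homog (dhomog_Eprod tau delta).
  have sg : (-1) ^+ e = 1 :> T \/ (-1) ^+ e = -1 :> T.
    by have := signr_odd T e; case: (odd e) => <-; [right; rewrite expr1|left; rewrite expr0].
  case: (Eprod_act noroot hlam s) => ->; rewrite ?rmorphN /= hE;
  by case: sg => ->; rewrite ?mulN1r ?mul1r ?opprK; auto.
case: nE1; apply: divides2.
have l00 : - l0 != 0 by rewrite oppr_eq0; case: (prime_lin (-tau,-delta)).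
have {}h : negT (actT s E1) = - E1.
  apply: (mulfI l00); rewrite -{1}nl -{1}sl -!rmorphM /= -eE h eE; ring.
by have := sr E1; rewrite h opprK mulr2n.
by [].
Qed.

Lemma odd_even_generation d f : f \in invT K -> f \is d.-homog -> ~~ odd d ->
  in_subalg [tuple detT K; P1; p4] f.
Proof.
elim/ltn_ind: d f => d IH f hf hd evd.
have [u u0 hu] := piST_f4_square noroot hlam.
have gi i : tnth [tuple detT K; P1; p4] i \in invT K.
  move: i; apply: ord3P; rewrite tuple3E ?detT_inv ?P1_inv //.
  exact: piST_f4_inv.
have [x [x1 x2 x3]] := restrict_span noroot hlam cardL p4 hd (inv_mod_l0_inv hf).
have hx := in_subalg_inv gi x1.
have hfx : f - x \in invT K by apply/invTP=> s; rewrite rmorphB /= !(invTP _ _).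
have hdx := rpredB hd x2.
have [h|[z [le hz ez siz]]] := Eprod_quot noroot hlam (semi_inv_inv hfx) hdx x3.
  by rewrite -[f](subrK x) h add0r.
have [s [sl sr]] := divides_refl 0.
have E0 := Eprod_neq0 tau delta.
(* The reflection fixes f - x, which has even degree, and negates E; so it negates z, and [l0]
   divides 2 z. *)
have nz : negT (actT s z) = - z.
  have h : negT (actT s (f - x)) = f - x.
    by rewrite (invTP _ hfx) (negT_homog hdx) -signr_odd (negPf evd) expr0 mul1r.
  have nE : - E != 0 by rewrite oppr_eq0.
  by apply: (mulfI nE); rewrite -{1}(Eprod_refl sl sr) -!rmorphM /= -ez h ez mulrNN.
have dz : divides l0 z by apply: divides2; have := sr z; rewrite nz opprK mulr2n.
rewrite -[f](subrK x); apply: in_subalgD => //.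
have [z0|[w [le' hw ew siw]]] := Eprod_quot noroot hlam siz hz dz.
  by rewrite ez z0 mulr0; apply: in_subalg0.
have efx : f - x = p4 * ((u^-1)%:MP * w).
  rewrite hu ez ew.
  have -> : u%:MP * E ^+ 2 * ((u^-1)%:MP * w) = (u%:MP * (u^-1)%:MP) * (E * (E * w)) by ring.
  by rewrite -rmorphM divff // rmorph1 mul1r.
have p40 : p4 != 0 by rewrite hu mulf_neq0 ?expf_neq0 // mpolyC_eq0.
rewrite efx; apply: in_subalgM; first exact: (in_subalg_gen _ o2).
apply: (IH (d - e - e)%N).
- move: (Nset_gt0 tau delta) le; move: e => n n0 le; clear -n0 le; lia.
- exact: invT_quot hfx (piST_f4_inv noroot) p40 efx.
- by rewrite mul_mpolyC dhomogZ.
- by rewrite -subnDA oddB ?addnn ?odd_double ?addbF // -addnn -leq_subRL.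
Qed.

End OddGeneration.

(** * Jacobians *)

Definition det3 (R : comNzRingType) (x y z x' y' z' x'' y'' z'' : R) : R :=
  x * (y' * z'' - z' * y'') - y * (x' * z'' - z' * x'') + z * (x' * y'' - y' * x'').

Lemma big_ord3 (R : nmodType) (F : 'I_3 -> R) : \sum_i F i = F o0 + F o1 + F o2.
Proof.
rewrite !big_ord_recl big_ord0 addr0 addrA.
by congr (F _ + F _ + F _); apply/val_inj.
Qed.

Lemma det3P (R : comNzRingType) (A : 'M[R]_3) :
  \det A = det3 (A o0 o0) (A o0 o1) (A o0 o2) (A o1 o0) (A o1 o1) (A o1 o2)
    (A o2 o0) (A o2 o1) (A o2 o2).
Proof.
rewrite (expand_det_row _ o0) big_ord3 /cofactor !det2E !mxE /=.
have L00 : lift o0 (0 : 'I_2) = o1 by apply/val_inj.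
have L01 : lift o0 (1 : 'I_2) = o2 by apply/val_inj.
have L10 : lift o1 (0 : 'I_2) = o0 by apply/val_inj.
have L11 : lift o1 (1 : 'I_2) = o2 by apply/val_inj.
have L20 : lift o2 (0 : 'I_2) = o0 by apply/val_inj.
have L21 : lift o2 (1 : 'I_2) = o1 by apply/val_inj.
rewrite !(L00, L01, L10, L11, L20, L21) /det3 /= expr0 expr1 expr2; ring.
Qed.

Lemma mpoly_ring_ind n (R : comNzRingType) (P : {mpoly R[n]} -> Prop) :
  (forall c, P c%:MP) -> (forall i, P 'X_i) ->
  (forall p r, P p -> P r -> P (p + r)) -> (forall p r, P p -> P r -> P (p * r)) ->
  forall p, P p.
Proof.
move=> hC hX hD hM p; elim/mpolyind: p => [|e m p _ _ IH].
  by rewrite -(mpolyC0 n R).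
apply: (hD) => //; rewrite -mul_mpolyC; apply: (hM) => //.
have h1 : P 1 by rewrite -(mpolyC1 n R).
rewrite mpolyXE_id; apply: (big_ind P) => // i _.
elim: (X in 'X_i ^+ X) => [|k IHk]; first by rewrite expr0.
by rewrite exprS; apply: (hM).
Qed.

Lemma mderivXU n (R : comNzRingType) (i j : 'I_n) :
  ('X_i : {mpoly R[n]})^`M(j) = (i == j)%:R.
Proof.
rewrite mderivX mnm1E; case: eqP => [->|_]; last by rewrite scale0r.
rewrite scale1r -(mpolyX0 n R); congr (mpolyX _ _); apply/mnmP => k.
by rewrite !mnmE subnn.
Qed.

Lemma mderiv_comp n k (R : comNzRingType) (t : n.-tuple {mpoly R[k]}) (p : {mpoly R[n]}) j :
  (p \mPo t)^`M(j) = \sum_(i < n) (p^`M(i) \mPo t) * (tnth t i)^`M(j).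
Proof.
elim/mpoly_ring_ind: p => [e|i|p r hp hr|p r hp hr].
- by rewrite comp_mpolyC mderivC big1 // => i _; rewrite mderivC comp_mpoly0 mul0r.
- rewrite tnth_comp_mpolyXU (bigD1 i) //= mderivXU eqxx rmorph1 mul1r big1 ?addr0 // => i' ne.
  by rewrite mderivXU eq_sym (negPf ne) comp_mpoly0 mul0r.
- rewrite comp_mpolyD mderivD hp hr -big_split /=; apply: eq_bigr => i _.
  by rewrite mderivD comp_mpolyD mulrDl.
rewrite rmorphM /= mderivM hp hr mulr_suml mulr_sumr -big_split /=.
apply: eq_bigr => i _; rewrite mderivM comp_mpolyD !rmorphM /=; ring.
Qed.

Lemma mderivXn n (R : comNzRingType) (p : {mpoly R[n]}) i k :
  (p ^+ k)^`M(i) = p ^+ k.-1 * p^`M(i) *+ k.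
Proof.
elim: k => [|k IH]; first by rewrite expr0 -(mpolyC1 n R) mderivC mulr0n.
rewrite exprS mderivM IH; move: (p^`M(i)) => d {IH}.
case: k => [|k] /=; first by rewrite !expr0; ring.
by rewrite [RHS]mulrSr !exprS; ring.
Qed.

Lemma dhomog_mderiv n (R : comNzRingType) (p : {mpoly R[n]}) i d :
  p \is d.+1.-homog -> p^`M(i) \is d.-homog.
Proof.
move=> /dhomogP hp; apply/dhomogP=> m; rewrite mcoeff_msupp mcoeff_deriv => h.
have /hp : (m + U_(i))%MM \in msupp p.
  by rewrite mcoeff_msupp; apply: contra_neq h => ->; rewrite mul0rn.
by rewrite /= mdegD mdeg1 addn1 => -[].
Qed.

Lemma natr_card0 (K : finFieldType) : #|K|%:R = 0 :> K.
Proof.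
have [p pp pK] := finPcharP K.
have [k ek] : exists k, #|K| = (p ^ k)%N by exists (logn p #|K|); apply: (card_pprimeChar pK).
have := finNzRing_gt1 K; apply: contraTeq; rewrite -(dvdn_pcharf pK) ek.
by case: k {ek} => // k; rewrite expnS dvdn_mulr.
Qed.

Section Jacobian.
Variable K : finFieldType.
Local Notation T := {mpoly K[3]}.
Local Notation a := (aT K).
Local Notation b := (bT K).
Local Notation c := (cT K).
Local Notation q := #|K|.
Local Notation P1 := (steenrodP1 (detT K)).
Implicit Types (F G H : T) (s : {'GL_2[K]}).

Definition jac F G H : T := jacobian [tuple F; G; H].

Lemma jacE F G H : jac F G H =
  det3 F^`M(o0) F^`M(o1) F^`M(o2) G^`M(o0) G^`M(o1) G^`M(o2) H^`M(o0) H^`M(o1) H^`M(o2).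
Proof. by rewrite /jac /jacobian det3P !mxE. Qed.

Lemma mderiv_vars :
  (a^`M(o0) = 1) * (a^`M(o1) = 0) * (a^`M(o2) = 0) *
  ((b^`M(o0) = 0) * (b^`M(o1) = 1) * (b^`M(o2) = 0)) *
  ((c^`M(o0) = 0) * (c^`M(o1) = 0) * (c^`M(o2) = 1)).
Proof. by rewrite /aT /bT /cT !mderivXU. Qed.

Lemma mderiv_lf x y z : ((lf x y z)^`M(o0) = x%:MP :> T) *
  ((lf x y z)^`M(o1) = y%:MP :> T) * ((lf x y z)^`M(o2) = z%:MP :> T).
Proof.
by rewrite /lf !mderivD !mderiv_mulC !mderiv_vars !mulr0 !mulr1 ?addr0 ?add0r.
Qed.

Lemma mderiv_frob (p : T) i : (p ^+ q)^`M(i) = 0.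
Proof.
rewrite mderivXn -mulr_natr -(rmorph_nat (@mpolyC 3 K)) natr_card0.
by rewrite rmorph0 mulr0.
Qed.

Lemma mderiv_detT : ((detT K)^`M(o0) = - a *+ 2) * ((detT K)^`M(o1) = - c)
  * ((detT K)^`M(o2) = - b).
Proof.
by rewrite /detT !mderivB !mderivN !mderivXn !mderivM !mderiv_vars /=;
   split; [split|]; ring.
Qed.

(** As q-th powers have derivative zero, this is the gradient of [detT K] with a, b, c replaced by
    their q-th powers. *)
Lemma mderiv_P1 : (P1^`M(o0) = - a ^+ q *+ 2) * (P1^`M(o1) = - c ^+ q)
  * (P1^`M(o2) = - b ^+ q).
Proof.
rewrite P1E !mderivB !mderivMn !mderivM !mderivN !mderiv_frob !mderiv_vars.
move: (a ^+ q) (b ^+ q) (c ^+ q) => x y z.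
by split; [split|]; ring.
Qed.

Lemma dhomog_jac F G H d1 d2 d3 : F \is d1.+1.-homog -> G \is d2.+1.-homog ->
  H \is d3.+1.-homog -> jac F G H \is (d1 + d2 + d3).-homog.
Proof.
move=> hF hG hH; rewrite jacE /det3.
have h i j k : F^`M(i) * (G^`M(j) * H^`M(k)) \is (d1 + d2 + d3).-homog.
  rewrite -addnA; apply: dhomogM; first exact: dhomog_mderiv.
  by apply: dhomogM; apply: dhomog_mderiv.
by rewrite !mulrBr; apply: rpredD; [apply: rpredB|]; apply: rpredB; apply: h.
Qed.

(** That the substitution has determinant 1 is what makes Jacobians of invariants invariant, and not
    merely semi-invariant. *)
Lemma actT_lf s : exists t : 'I_3 -> 'I_3 -> K,
  [/\ forall i, actT s 'X_i = lf (t i o0) (t i o1) (t i o2) &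
   det3 (t o0 o0) (t o0 o1) (t o0 o2) (t o1 o0) (t o1 o1) (t o1 o2)
    (t o2 o0) (t o2 o1) (t o2 o2) = 1].
Proof.
set M := GLval s; have us := GLval_unitmx s.
pose D := M 0 0 * M 1 1 - M 0 1 * M 1 0.
have D0 : D != 0 by rewrite /D -det2E; move: us; rewrite unitmxE unitfE.
pose N := mx2 (M 1 1 / D) (- M 0 1 / D) (- M 1 0 / D) (M 0 0 / D).
have hN : invmx M = N.
  suff h : M *m N = 1%:M by rewrite -[LHS]mulmx1 -h mulmxA mulVmx // mul1mx.
  by apply: mx2P; rewrite mulmx2E !mx2E mxE /=; [rewrite /D in D0 *; field..].
pose X x y z := tnth [tuple x; y; z] : 'I_3 -> K.
pose r i j := X (N i 0 * M 0 j - N i 1 * M 1 j) (N i 0 * M 1 j) (N i 1 * M 0 j).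
have hr i j : conj_gen s (genX K) i j = lf (r i j o0) (r i j o1) (r i j o2).
  rewrite /conj_gen -/M hN !mulmx2E ![map_mx _ _ _ _]mxE !mx2E /r /X !tuple3E /lf.
  by rewrite rmorphB !rmorphM /=; ring.
exists (fun i => tnth [tuple r 0 0; r 0 1; r 1 0] i); split.
  by apply: ord3P; rewrite tuple3E actT_vars hr.
rewrite !tuple3E /r /X !tuple3E /N !mx2E /det3 /D in D0 *.
by field.
Qed.

Lemma jac_inv F G H : F \in invT K -> G \in invT K -> H \in invT K ->
  jac F G H \in invT K.
Proof.
move=> hF hG hH; apply/invTP=> s.
have [t [ht dt]] := actT_lf s.
pose A := \matrix_(i < 3, j < 3) (tnth [tuple F; G; H] i)^`M(j).
pose N : 'M[T]_3 := \matrix_(i < 3, j < 3) (t i j)%:MP.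
have hA : A = map_mx (actT s) A *m N.
  apply/matrixP=> i j; rewrite [LHS]mxE [RHS]mxE.
  have <- : actT s (tnth [tuple F; G; H] i) = tnth [tuple F; G; H] i.
    by apply/invTP; move: i; apply: ord3P; rewrite tuple3E.
  rewrite {1}/actT mderiv_comp; apply: eq_bigr => k _.
  rewrite [map_mx _ _ _ _]mxE [A i k]mxE [N k j]mxE; congr (_ * _).
  rewrite -tnth_comp_mpolyXU -[comp_mpoly _ _]/(actT s 'X_k) ht.
  by move: j; apply: ord3P; rewrite mderiv_lf.
have dN : \det N = 1.
  by rewrite det3P !mxE -(mpolyC1 3 K) -dt /det3 !(rmorphB, rmorphD, rmorphM).
by rewrite /jac /jacobian -/A [in RHS]hA det_mulmx dN mulr1 det_map_mx.
Qed.

End Jacobian.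

(** * The Jacobian and invariants of odd degree *)

Section OddStructure.
Variables (K : finFieldType) (tau delta : K).
Hypothesis noroot : forall x, x ^+ 2 - tau * x + delta != 0.
Variables (L : finFieldType) (io : {rmorphism K -> L}) (lam : L).
Hypothesis hlam : lam ^+ 2 - io tau * lam + io delta = 0.
Hypothesis cardL : #|L| = (#|K| ^ 2)%N.
Hypothesis oddq : odd #|K|.
Local Notation T := {mpoly K[3]}.
Local Notation q := #|K|.
Local Notation P1 := (steenrodP1 (detT K)).
Implicit Types (s : {'GL_2[K]}) (f g : T).
Local Notation l0 := (lin (- tau, - delta)).
Local Notation E := (Eprod tau delta).
Local Notation p4 := (piST (f4 tau delta)).
Local Notation J := (jac (detT K) P1 p4).
Local Notation mu := (io tau - lam).
Local Notation ev := (mmap io).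
Local Notation pt := (isopt mu).

Let two_neq0 : 2%:R != 0 :> K := odd_two_neq0 oddq.

Lemma ev_lin_neq0 n : n != (- tau, - delta) -> ev pt (lin n) != 0.
Proof.
case: n => x y ne; rewrite /lin ev_lf /isopt !tuple3E /= rmorph1.
apply: contra_neq ne => h.
have [h1 h2] : x + tau = 0 /\ y + delta - tau * (x + tau) = 0.
  apply: (lam_free noroot hlam); rewrite !(rmorphN, rmorphD, rmorphM) /=.
  by have := congr2 +%R h hlam; rewrite addr0 => <-; ring.
move: h2; rewrite h1 mulr0 subr0 => /eqP; rewrite addr_eq0 => /eqP ->.
by move/eqP: h1; rewrite addr_eq0 => /eqP ->.
Qed.

(** J is 2 u E times the Jacobian with E in place of p4. At the point, [l0] vanishes, so the
    gradient of E is a nonzero multiple of that of [l0], and the determinant becomes (lam - mu)^3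
    times this multiple. *)
Lemma jac_neq0 : J != 0.
Proof.
have [u u0 hu] := piST_f4_square noroot hlam.
have -> : J = u%:MP * E *+ 2 * jac (detT K) P1 E.
  rewrite !jacE hu !mderiv_mulC !mderivXn /= !expr1 /det3.
  by move: (P1^`M(o0)) (P1^`M(o1)) (P1^`M(o2)) => x y z; ring.
have uE : u%:MP * E *+ 2 != 0.
  rewrite -mulr_natr -(rmorph_nat (@mpolyC 3 K)) !mulf_neq0 ?Eprod_neq0 //.
    by rewrite mpolyC_eq0.
  by rewrite mpolyC_eq0.
rewrite mulf_neq0 //; apply/eqP => h; have := congr1 (ev pt) h.
pose E1 := \prod_(n in Nset tau delta | n != (- tau, - delta)) lin n.
have eE : E = l0 * E1.
  by rewrite /E1 /Eprod (bigD1 (- tau, - delta)) //= l0_Nset.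
have nE1 : ev pt E1 != 0.
  rewrite rmorph_prod /= prodf_seq_neq0; apply/allP=> n _; apply/implyP=> /andP[_].
  exact: ev_lin_neq0.
have l00 : ev pt l0 = 0 by rewrite (isopt_l0 hlam).
have dE i : ev pt E^`M(i) = ev pt l0^`M(i) * ev pt E1.
  by rewrite eE mderivM rmorphD !rmorphM /= l00 mul0r addr0.
rewrite rmorph0 jacE /det3 !(rmorphB, rmorphD, rmorphM) /= !dE !mderiv_lf.
rewrite !mderiv_detT !mderiv_P1 !(rmorphN, rmorphMn, rmorphXn) /= !mmapC !ev_vars /isopt !tuple3E /=.
rewrite !(expr_cardN io) exprAC (mu_exp noroot hlam) expr1n rmorph1 ?rmorphN -(lam_mul hlam).
move=> /eqP; apply/negP.
set w := ev pt E1 in nE1 *.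
rewrite [X in X != 0](_ : _ = (lam - mu) ^+ 3 * w); last by ring.
by rewrite mulf_neq0 // expf_neq0 // subr_eq0 (lam_neq_mu noroot hlam).
Qed.

Lemma dhomog_jac4 : J \is (q ^ 2).-homog.
Proof.
have q1 := finNzRing_gt1 K.
have h4 : p4 \is ((q ^ 2 - q).-1.+1).-homog.
  by rewrite prednK ?dhomog_piST_f4 // subn_gt0 -[X in (X < _)%N](expn1 q) ltn_exp2l.
have h1 : P1 \is q.+1.-homog by have := dhomog_P1 K; rewrite [(q + 1)%N]addn1.
have -> : (q ^ 2 = 1 + q + (q ^ 2 - q).-1)%N.
  have : (q < q ^ 2)%N by rewrite -[X in (X < _)%N](expn1 q) ltn_exp2l.
  by move: (q ^ 2)%N q => m n lt; clear -lt; lia.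
exact: dhomog_jac (dhomog_detT K) h1 h4.
Qed.

(* The planes whose orthogonal reflections lie in - Ad(G). *)
Definition nonisotropic : {set (K * K) + K} :=
  [set i | match i with inl n => n.1 ^+ 2 + n.2 *+ 4 != 0 | inr _ => true end].
(** Planes are normalised by the coefficient 1 of b, or of a if b is absent. The remaining plane c =
    0 is tangent to the conic. For [inl n], the quantity tested in [nonisotropic] is the
    discriminant of det on the plane. *)
Definition plane (i : (K * K) + K) : T :=
  match i with inl n => lin n | inr z => lf 1 0 z end.

(** Each x excludes the single value y = - x^2 / 4, and every plane of the second kind counts: q (q
    - 1) + q. *)
Lemma card_nonisotropic : #|nonisotropic| = (q ^ 2)%N.
Proof.
have four0 : 4%:R != 0 :> K by rewrite (natrM _ 2 2) mulf_neq0.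
rewrite -sum1_card big_sumType /=.
rewrite (eq_bigl (fun n : K * K => true && (n.2 != - n.1 ^+ 2 / 4%:R))); last first.
  move=> [x y]; rewrite !inE /=; congr (~~ _); apply/eqP/eqP => [h|->].
    apply: (mulIf four0); rewrite divfK // mulr_natr.
    by apply/eqP; rewrite -addr_eq0 addrC h.
  by rewrite -[(_ / _) *+ 4]mulr_natr divfK // subrr.
rewrite -(pair_big_dep xpredT (fun x y : K => y != - x ^+ 2 / 4%:R) (fun _ _ => 1%N)) /=.
rewrite (eq_bigr (fun _ => q.-1)); last first.
  by move=> x _; rewrite sum1_card; apply: (cardC1 (- x ^+ 2 / 4%:R)).
rewrite sum_nat_const (eq_bigl xpredT) => [|z]; last by rewrite inE.
rewrite sum_nat_const muln1.
have -> : #|(xpredT : pred K)| = q by apply: eq_card.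
by have := finNzRing_gt1 K; case: q => // n _; rewrite /= -mulnSr mulnn.
Qed.

Lemma prime_plane i : prime_elt (plane i).
Proof.
case: i => [n|z] /=; first exact: prime_lin.
by apply: prime_lf; rewrite !xpair_eqE oner_eq0.
Qed.

Lemma plane_inj i j : divides (plane i) (plane j) -> i = j.
Proof.
case: i j => [[x y]|z] [[x' y']|z'] /= d.
- by rewrite (lin_inj d).
- have := divides_lf_point (v := tnth [tuple 1; - x; 0]) d.
  rewrite !tuple3E /= !mulr0 !mul0r !mulr1 mul1r !addr0 subrr => /(_ erefl)/eqP.
  by rewrite oner_eq0.
- have := divides_lf_point (v := tnth [tuple 0; 1; 0]) d.
  rewrite !tuple3E /= !mulr0 !mul0r !mulr1 !addr0 add0r => /(_ erefl)/eqP.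
  by rewrite oner_eq0.
have := divides_lf_point (v := tnth [tuple - z; 0; 1]) d.
rewrite !tuple3E /= !mul0r !mulr1 !mul1r !addr0 addNr addrC => /(_ erefl)/eqP.
by rewrite subr_eq0 => /eqP ->.
Qed.

Lemma dhomog_plane i : plane i \is 1.-homog.
Proof. by case: i => [n|z]; apply: dhomog_lf. Qed.

(** A traceless s with [linf] equal to twice the equation of the plane gives minus a conjugation
    that is trivial modulo the plane. It negates an invariant of odd degree, so the plane divides 2
    f. *)
Lemma odd_degree_plane d f i : f \in invT K -> f \is d.-homog -> odd d ->
  i \in nonisotropic -> divides (plane i) f.
Proof.
move=> hf hd od hi; apply: (divides2 oddq).
have [s [tr0 hl]] : exists s, \tr (GLval s) = 0 /\ divides (plane i) (linf (GLval s)).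
  case: i hi => [[x y]|z] /=; rewrite inE /= => h.
    have [|s hs] := @GL_of_mx K (mx2 x (y *+ 2) 2%:R (- x)).
      rewrite det2E !mx2E (_ : _ - _ = - (x ^+ 2 + y *+ 4)) ?oppr_eq0 //; ring.
    exists s; split; first by rewrite hs mxtrace2E !mx2E subrr.
    exists 2%:R; rewrite hs linfE !mx2E /lin /lf /=.
    by rewrite !(rmorphB, rmorphN, rmorphMn, rmorph1, rmorph_nat) /=; ring.
  have [|s hs] := @GL_of_mx K (mx2 1 (z *+ 2) 0 (- 1)).
    by rewrite det2E !mx2E mulr0 subr0 mul1r oppr_eq0 oner_eq0.
  exists s; split; first by rewrite hs mxtrace2E !mx2E subrr.
  exists 2%:R; rewrite hs linfE !mx2E /lf /=.
  by rewrite !(rmorphB, rmorphN, rmorphMn, rmorph1, rmorph0) /=; ring.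
have := reflection_divides f tr0; rewrite (invTP _ hf) (negT_homog hd).
rewrite -signr_odd od expr1 mulN1r opprK -mulr2n.
exact: divides_trans.
Qed.

Definition planes_prod : T := \prod_(i in nonisotropic) plane i.

Lemma dhomog_planes_prod : planes_prod \is (q ^ 2).-homog.
Proof.
by rewrite -card_nonisotropic -sum1_card; apply: dhomog_bigprod => i _; apply: dhomog_plane.
Qed.

Lemma planes_prod_divides f : (forall i, i \in nonisotropic -> divides (plane i) f) ->
  divides planes_prod f.
Proof.
move=> h; rewrite /planes_prod -big_enum /=; apply: prod_primes_divides.
- exact: enum_uniq.
- by move=> i _; apply: prime_plane.
- by move=> i j _ _; apply: plane_inj.
by move=> i; rewrite mem_enum; apply: h.
Qed.

Lemma jac4_inv : J \in invT K.
Proof. by apply: jac_inv; [exact: detT_inv|exact: P1_inv|exact: piST_f4_inv]. Qed.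

Lemma oddX2 : odd (q ^ 2). Proof. by rewrite oddX. Qed.

(** The distinct planes all divide J, which has odd degree q^2; their product has the same degree,
    so the quotient is a constant. *)
Lemma jac4E : exists2 k : K, k != 0 & J = k%:MP * planes_prod.
Proof.
have [z ez] : divides planes_prod J.
  apply: planes_prod_divides => i; apply: odd_degree_plane jac4_inv dhomog_jac4 oddX2.
have : J = planes_prod * pihomog mdeg 0 z.
  by rewrite -(pihomogM _ _ dhomog_planes_prod) addn0 mulrC -ez (pihomog_dE dhomog_jac4).
rewrite (homog0C (pihomogP _ 0 z)) mulrC => e; exists (pihomog mdeg 0 z)@_0%MM => //.
by apply: contraNneq jac_neq0 => h; rewrite e h rmorph0 mul0r.
Qed.

Local Notation sub := (in_subalg [tuple detT K; P1; p4]).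

Lemma odd_degree_generation d f : f \in invT K -> f \is d.-homog -> odd d ->
  exists2 y, sub y & f = y * J.
Proof.
move=> hf hd od; have [k k0 ek] := jac4E.
have [z ez] : divides J f.
  have : divides planes_prod f.
    by apply: planes_prod_divides => i; apply: odd_degree_plane hf hd od.
  by apply: divides_trans; rewrite ek; exact: (proj2 (dividesC _ k0)).
have [lt|le] := ltnP d (q ^ 2).
  exists 0; first exact: in_subalg0.
  by rewrite mul0r -(pihomog_dE hd) ez mulrC (pihomogM_lt _ dhomog_jac4).
have ef : f = J * pihomog mdeg (d - q ^ 2) z.
  by rewrite -(pihomogM _ _ dhomog_jac4) subnKC // mulrC -ez pihomog_dE.
exists (pihomog mdeg (d - q ^ 2) z); last by rewrite mulrC.
apply: (odd_even_generation noroot hlam cardL oddq (d := (d - q ^ 2)%N)) (pihomogP _ _ _) _.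
  exact: invT_quot hf jac4_inv jac_neq0 ef.
by rewrite oddB // od oddX2.
Qed.

Lemma odd_generation f : f \in invT K ->
  exists x y, [/\ sub x, sub y & f = x + y * J].
Proof.
move=> hf; rewrite (pihomog_partitionE (leqnn (mmeasure mdeg f))).
apply: (big_ind (fun g => exists x y, [/\ sub x, sub y & g = x + y * J])).
- by exists 0, 0; split; rewrite ?mul0r ?addr0 //; apply: in_subalg0.
- move=> _ _ [x [y [hx hy ->]]] [x' [y' [hx' hy' ->]]].
  exists (x + x'), (y + y'); split; [exact: in_subalgD|exact: in_subalgD|ring].
move=> d _; have hd := invT_pihomog d hf; have pd := pihomogP mdeg d f.
have [od|ed] := boolP (odd d).
  have [y hy ->] := odd_degree_generation hd pd od.
  by exists 0, y; split; rewrite ?add0r //; apply: in_subalg0.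
exists (pihomog mdeg d f), 0; split; rewrite ?mul0r ?addr0 //; last exact: in_subalg0.
exact: (odd_even_generation noroot hlam cardL oddq hd pd ed).
Qed.

Lemma sub_inv x : sub x -> x \in invT K.
Proof.
apply: in_subalg_inv; apply: ord3P; rewrite tuple3E ?detT_inv ?P1_inv //.
exact: piST_f4_inv.
Qed.

Lemma sub_even x : sub x -> negT x = x.
Proof.
case=> P ->; rewrite /negT comp_mpolyA; congr (_ \mPo _).
apply: eq_from_tnth => i; rewrite tnth_map -[LHS]/(negT _); move: i; apply: ord3P; rewrite tuple3E.
- by rewrite (negT_homog (dhomog_detT K)) sqrrN expr1n mul1r.
- by rewrite (negT_homog (dhomog_P1 K)) -signr_odd oddD oddq expr0 mul1r.
rewrite (negT_homog (dhomog_piST_f4 tau delta)) -signr_odd oddB ?oddX ?oddq ?expr0 ?mul1r //.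
by rewrite -[X in (X <= _)%N](expn1 q) leq_exp2l // finNzRing_gt1.
Qed.

(** Changing the sign of all variables fixes K[det, P1(det), p4] and negates J, which separates the
    two summands. *)
Lemma odd_direct x y : sub x -> sub y -> x + y * J = 0 -> x = 0 /\ y = 0.
Proof.
move=> hx hy h; have := congr1 (@negT K) h.
rewrite rmorphD rmorphM rmorph0 /= (sub_even hx) (sub_even hy).
rewrite (negT_homog dhomog_jac4) -signr_odd oddX2 expr1 mulN1r mulrN => h'.
have x0 : x = 0.
  apply: (mulIf (_ : 2%:R != 0 :> T)); first by rewrite -(rmorph_nat (@mpolyC 3 K)) mpolyC_eq0.
  by have := congr2 +%R h h'; rewrite addr0 mul0r => <-; ring.
split=> //; move: h; rewrite x0 add0r => /eqP; rewrite mulf_eq0 (negPf jac_neq0) orbF.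
by move/eqP.
Qed.

Lemma jac4_sq : sub (J ^+ 2).
Proof.
apply: (odd_even_generation noroot hlam cardL oddq (d := (q ^ 2 * 2)%N)).
- by apply/invTP=> s; rewrite rmorphXn /= (invTP _ jac4_inv).
- exact: dhomogMn dhomog_jac4.
by rewrite muln2 odd_double.
Qed.

End OddStructure.

(** * Algebraic independence *)

Section Kill.
Variables (K : fieldType) (n : nat).
Local Notation R := {mpoly K[n]}.
Implicit Types (P Q : R) (J : seq 'I_n).

Definition kill J : R -> R := comp_mpoly [tuple (if i \in J then 0 else 'X_i) | i < n].
HB.instance Definition _ J := GRing.LRMorphism.copy (kill J) (comp_mpoly _).

Lemma killX J i : kill J 'X_i = if i \in J then 0 else 'X_i.
Proof. by rewrite /kill tnth_comp_mpolyXU tnth_mktuple. Qed.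

Lemma killC J e : kill J e%:MP = e%:MP.
Proof. by rewrite /kill comp_mpolyC. Qed.

Lemma kill_cat J J' P : kill J (kill J' P) = kill (J ++ J') P.
Proof.
pose f : {rmorphism R -> R} := GRing.RMorphism.clone _ _ (kill J \o kill J') _.
apply: (@mpoly_hom_eq n K R f (kill (J ++ J'))) => [e|i] /=; first by rewrite !killC.
by rewrite !killX mem_cat; case: (i \in J'); rewrite ?orbT ?orbF ?killX // rmorph0.
Qed.

Lemma kill_eq J J' P : J =i J' -> kill J P = kill J' P.
Proof.
move=> h; apply: (@mpoly_hom_eq n K R (kill J) (kill J')) => [e|i] /=; first by rewrite !killC.
by rewrite !killX h.
Qed.

Lemma kill_nil P : kill [::] P = P.
Proof.
by rewrite /kill -[RHS]comp_mpoly_id; congr (_ \mPo _); apply: eq_from_tnth => i; rewrite !tnth_mktuple.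
Qed.

Lemma kill1 i P : exists Q, P = kill [:: i] P + 'X_i * Q.
Proof.
pose f : {rmorphism R -> R} := GRing.RMorphism.clone _ _ idfun _.
have [||Q hQ] := @mpoly_hom_divides n K R f (kill [:: i]) 'X_i _ _ P.
- by move=> e; rewrite /= killC.
- move=> j; rewrite /= killX inE; case: eqP => [->|_].
    by rewrite subr0; apply: dividesxx.
  by rewrite subrr; apply: divides0.
by exists Q; rewrite mulrC -hQ /= addrC subrK.
Qed.

Lemma mpolyX_neq0 i : 'X_i != 0 :> R.
Proof. by rewrite -msize_poly_eq0 msizeX. Qed.

(* The injectivity of Phi on the polynomials free of J, up to I, is reduced to
   that on the polynomials also free of 'X_i, up to a larger I'. *)
Lemma peel (S : comNzRingType) (Phi : {rmorphism R -> S}) (I I' : S -> Prop) J i :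
  i \notin J -> (forall x, I (Phi 'X_i * x) -> I x) ->
  (forall x, I x -> I' x) ->
  (forall x y, I' (x + Phi 'X_i * y) -> I' x) ->
  (forall P, kill (i :: J) P = P -> I' (Phi P) -> P = 0) ->
  forall P, kill J P = P -> I (Phi P) -> P = 0.
Proof.
move=> niJ Ic II' I'a A P.
(* Split P into its value at x_i = 0 and a multiple x_i Q. The first part is zero by the assumption
   on I', and cancelling x_i leaves the smaller Q. *)
have [N] := ubnP (msize P); elim: N P => // N IH P lt kP hI.
have [Q eP] := kill1 i P.
have P0 : kill [:: i] P = 0.
  apply: (A).
    rewrite kill_cat -{2}kP kill_cat; apply: kill_eq => j.
    by rewrite mem_cat !inE; case: (j == i); rewrite /= ?orbT ?orbF.
  by apply: (I'a _ (Phi Q)); rewrite -rmorphM -rmorphD -eP; apply: (II').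
have {}eP : P = 'X_i * Q by rewrite eP P0 add0r.
have [->|P_neq0] := eqVneq P 0; first by [].
have Q0 : Q != 0 by apply: contraNneq P_neq0 => h; rewrite eP h mulr0.
case/eqP: (Q0); apply: IH.
- move: lt; rewrite eP msizeM ?mpolyX_neq0 ?Q0 // mmeasureX /= mdeg1 !ltnS.
  exact.
- apply: (mulfI (mpolyX_neq0 i)); rewrite -eP -[in RHS]kP eP rmorphM /=.
  by rewrite killX (negPf niJ).
by apply: (Ic); rewrite -rmorphM -eP.
Qed.

Lemma kill_all P : kill (enum 'I_n) P = (P@_0%MM)%:MP.
Proof.
pose f : {rmorphism R -> R} := GRing.RMorphism.clone _ _ (@mpolyC n K \o @mcoeff n K 0%MM) _.
apply: (@mpoly_hom_eq n K R (kill _) f) => [e|i] /=.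
  by rewrite killC mcoeffC eqxx mulr1.
by rewrite killX mem_enum mcoeffX mnm1_eq0 /= mpolyC0.
Qed.
End Kill.

Section AlgIndep.
Variables (K : finFieldType) (tau delta : K).
Hypothesis noroot : forall x, x ^+ 2 - tau * x + delta != 0.
Variables (L : finFieldType) (io : {rmorphism K -> L}) (lam : L).
Hypothesis hlam : lam ^+ 2 - io tau * lam + io delta = 0.
Local Notation T := {mpoly K[3]}.
Local Notation P1 := (steenrodP1 (detT K)).
Local Notation l0 := (lin (- tau, - delta)).
Local Notation mu := (io tau - lam).

(* The restriction to the isotropic line through a point of the conic. *)
Definition evline : T -> {poly L} :=
  mmap (polyC \o io) (fun i => (isopt mu i)%:P * 'X).
HB.instance Definition _ := GRing.RMorphism.copy evline (mmap (polyC \o io) _).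

Lemma evline_homog d (f : T) : f \is d.-homog ->
  evline f = (mmap io (isopt mu) f)%:P * 'X^d.
Proof.
move=> hf; pose g : {rmorphism T -> {poly L}} :=
  GRing.RMorphism.clone _ _ (polyC \o mmap io (isopt mu)) _.
rewrite [RHS]mulrC; apply: (@hom_scale 3 K {poly L} evline g 'X d f _ _ hf) => [e|i] /=.
  by rewrite /evline !mmapC.
by rewrite /evline !mmapX !mmap1U mulrC.
Qed.

(** The variables for [th], det and P1(det) are peeled off in this order. After [th], one works
    modulo [l0], a prime that does not divide det; after det, on the isotropic line, where P1(det)
    is the discriminant times X^(q+1). Only constants remain. *)
Lemma alg_indep_theta th : th != 0 -> divides l0 th ->
  alg_indep [tuple detT K; P1; th].
Proof.
move=> th0 dth P0 hP0.
have [l00 l01 lM] := prime_lin (- tau, - delta).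
have ev0 f : divides l0 f -> evline f = 0.
  case=> z ->; rewrite rmorphM /= (evline_homog (dhomog_lf _ _ _)).
  by rewrite (isopt_l0 hlam) mul0r mulr0.
have evd : evline (detT K) = 0 by rewrite (evline_homog (dhomog_detT K)) isopt_detT mul0r.
set t := [tuple detT K; P1; th] in hP0.
have tX i : 'X_i \mPo t = tnth t i by rewrite tnth_comp_mpolyXU.
apply: (@peel K 3 T (comp_mpoly t) (fun x => x = 0) (divides l0) [::] o2) hP0 => //.
- by move=> x /eqP; rewrite /= tX mulf_eq0 (negPf th0) => /eqP.
- by move=> x ->; apply: divides0.
- move=> x y h; rewrite -[x](addrK (('X_o2 \mPo t) * y)); apply: dividesB => //.
  by rewrite tX; apply: divides_mulr.
- move=> P kP; apply: (@peel K 3 T (comp_mpoly t) (divides l0) (fun x => evline x = 0) [:: o2] o0) kP => //.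
  + by move=> x; rewrite /= tX => /lM[] // /(l0_ndiv_detT noroot hlam).
  + by move=> x y; rewrite /= tX rmorphD rmorphM /= evd mul0r addr0.
  move=> Q kQ; apply: (@peel K 3 T (comp_mpoly t) (fun x => evline x = 0) (fun x => (evline x).[0] = 0) [:: o0; o2] o1) kQ => //.
  + move=> x; rewrite /= tX rmorphM /= (evline_homog (dhomog_P1 K)).
    rewrite (isopt_P1 noroot hlam) => /eqP; rewrite !mulf_eq0 polyC_eq0 fmorph_eq0.
    by rewrite (negPf (disc_neq0 noroot hlam)) expf_eq0 polyX_eq0 andbF => /eqP.
  + by move=> x ->; rewrite horner0.
  + move=> x y; rewrite /= tX rmorphD rmorphM /= (evline_homog (dhomog_P1 K)).
    by rewrite !hornerE expr0n addn1 mulr0 mul0r addr0.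
  move=> U kU; rewrite -kU.
  have -> : kill [:: o1; o0; o2] U = (U@_0%MM)%:MP.
    rewrite -kill_all; apply: kill_eq => j; rewrite mem_enum !inE.
    by move: j; apply: ord3P.
  by rewrite /= comp_mpolyC /evline mmapC /= hornerC => /eqP; rewrite fmorph_eq0 => /eqP ->; rewrite mpolyC0.
exact: kill_nil.
Qed.

End AlgIndep.

(** * Free modules over polynomial subrings *)

(** Declared as a measure below, so that homogeneous components are available for weighted
    degrees. *)
Definition wdeg k (w : 'I_k -> nat) (m : 'X_{1..k}) : nat := (\sum_(i < k) w i * m i)%N.

Lemma wdeg0 k (w : 'I_k -> nat) : wdeg w 0%MM = 0%N.
Proof. by rewrite /wdeg big1 // => i _; rewrite mnm0E muln0. Qed.
Lemma wdegD k (w : 'I_k -> nat) : {morph wdeg w : m1 m2 / (m1 + m2)%MM >-> (m1 + m2)%N}.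
Proof.
by move=> m1 m2; rewrite /wdeg -big_split /=; apply: eq_bigr => i _; rewrite mnmDE mulnDr.
Qed.
HB.instance Definition _ k (w : 'I_k -> nat) := isMeasure.Build k (wdeg w) (wdeg0 w) (wdegD w).

Lemma wdeg1 k (w : 'I_k -> nat) i : wdeg w U_(i)%MM = w i.
Proof.
rewrite /wdeg (bigD1 i) //= mnm1E eqxx muln1 big1 ?addn0 // => j ne.
by rewrite mnm1E eq_sym (negPf ne) muln0.
Qed.

Lemma kill_ideal (K : fieldType) k (I : finType) (idx : I -> 'I_k) (s : seq I) (P : {mpoly K[k]}) :
  uniq s -> exists Q : I -> {mpoly K[k]},
  P = kill [seq idx l | l <- s] P + \sum_(l <- s) 'X_(idx l) * Q l.
Proof.
elim: s => [|l s IH] /=.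
  by move=> _; exists (fun=> 0); rewrite big_nil addr0 kill_nil.
case/andP=> nl us; have [Q eQ] := IH us.
have [Q0 eQ0] := kill1 (idx l) (kill [seq idx l | l <- s] P).
exists (fun x => if x == l then Q0 else Q x).
rewrite big_cons eqxx addrA -[idx l :: _]/([:: idx l] ++ _) -kill_cat -eQ0 {1}eQ.
congr (_ + _); rewrite !big_seq; apply: eq_bigr => j js.
by case: eqP => // ej; rewrite -ej js in nl.
Qed.

Section FreeModule.
Variables (K : fieldType) (n k r : nat) (A : {pred {mpoly K[n]}}).
Variables (th : k.-tuple {mpoly K[n]}) (w : 'I_k -> nat).
Variables (eta : r.-tuple {mpoly K[n]}) (e : 'I_r -> nat).
Hypothesis w_gt0 : forall i, (0 < w i)%N.
Hypothesis th_homog : forall i, tnth th i \is (w i).-homog.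
Hypothesis eta_homog : forall j, tnth eta j \is (e j).-homog.
Hypothesis thA : forall i, tnth th i \in A.

(** Together, [AP] and [comb_inj] say that A is free over the polynomial ring on [th] with basis
    [eta]. The basis is 1 for even q and 1, J for odd q. *)
Definition comb (P : 'I_r -> {mpoly K[k]}) : {mpoly K[n]} :=
  \sum_(j < r) (P j \mPo th) * tnth eta j.

Hypothesis AP : forall x, x \in A <-> exists P, x = comb P.
Hypothesis comb_inj : forall P, comb P = 0 -> forall j, P j = 0.

Lemma combB P Q : comb P - comb Q = comb (fun j => P j - Q j).
Proof.
rewrite /comb -sumrB; apply: eq_bigr => j _.
by rewrite comp_mpolyB mulrBl.
Qed.

Lemma comb_eq P Q : comb P = comb Q -> forall j, P j = Q j.
Proof.
move=> h j; apply/eqP; rewrite -subr_eq0; apply/eqP.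
by apply: (comb_inj (P := fun j => P j - Q j)); rewrite -combB h subrr.
Qed.

Lemma comb_sum (I : Type) (s : seq I) (Q : I -> 'I_r -> {mpoly K[k]}) (X : I -> 'I_k) :
  \sum_(l <- s) comb (Q l) * tnth th (X l) = comb (fun j => \sum_(l <- s) 'X_(X l) * Q l j).
Proof.
rewrite /comb; under eq_bigr do rewrite mulr_suml.
rewrite exchange_big /=; apply: eq_bigr => j _.
rewrite rmorph_sum mulr_suml /=; apply: eq_bigr => l _.
by rewrite rmorphM /= tnth_comp_mpolyXU; ring.
Qed.

(** By freeness, membership is decided coefficientwise: each coordinate must lie in the ideal of the
    first i variables, that is, vanish when they are set to 0. *)
Lemma in_idealP (i : 'I_k) P :
  in_ideal A (take i th) (comb P) <-> forall j, kill (take i (enum 'I_k)) (P j) = 0.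
Proof.
have szi : size (take i th) = i by rewrite size_take size_tuple ltn_ord.
have lt (l : 'I_(size (take i th))) : (l < k)%N.
  by apply: ltn_trans (ltn_ord i); rewrite -{2}szi ltn_ord.
pose idx l := Ordinal (lt l).
have nthE (l : 'I_(size (take i th))) : (take i th)`_l = tnth th (idx l).
  by rewrite nth_take ?(tnth_nth 0) // -{2}szi ltn_ord.
have eJ : take i (enum 'I_k) =i [seq idx l | l <- enum 'I_(size (take i th))].
  move=> j; have -> : (j \in take i (enum 'I_k)) = (j < i)%N.
    rewrite in_take ?mem_enum // -[X in index X _](nth_ord_enum j j).
    by rewrite index_uniq ?size_enum_ord ?enum_uniq.
  apply/idP/mapP => [ji|[l _ ->]]; last by rewrite /= -{2}szi ltn_ord.
  have ji' : (j < size (take i th))%N by rewrite szi.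
  by exists (Ordinal ji'); rewrite ?mem_enum //; apply/val_inj.
split=> [[y yA]|h].
  have [Q hQ] : exists Q, forall l, y l = comb (Q l).
    by apply: (fin_all_exists (P := fun l Q => y l = comb Q)) => l; apply/AP.
  under eq_bigr do rewrite hQ nthE.
  rewrite comb_sum => /comb_eq h j; rewrite h rmorph_sum big1 // => l _.
  rewrite rmorphM /= killX eJ map_f ?mul0r ?mem_enum //.
have [Q hQ] : exists Q, forall j, P j = \sum_l 'X_(idx l) * Q j l.
  apply: (fin_all_exists (P := fun j Q => P j = \sum_l 'X_(idx l) * Q l)) => j.
  have [Q hQ] := kill_ideal idx (P j) (enum_uniq 'I_(size (take i th))).
  by exists Q; rewrite {1}hQ -(kill_eq _ eJ) h add0r big_enum.
exists (fun l => comb (fun j => Q j l)) => [l|]; first by apply/AP; exists (fun j => Q j l).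
under eq_bigr do rewrite nthE.
rewrite (comb_sum _ (fun l j => Q j l)); rewrite /comb.
by apply: eq_bigr => j _; rewrite hQ.
Qed.

Lemma etaA j : tnth eta j \in A.
Proof.
apply/AP; exists (fun j' => (j' == j)%:R).
rewrite /comb (bigD1 j) //= eqxx rmorph1 mul1r big1 ?addr0 // => j' ne.
by rewrite (negPf ne) rmorph0 mul0r.
Qed.

(** Finiteness is given by the basis. For regularity, the variable x_i survives when the preceding
    ones are killed, and it can be cancelled in a domain. *)
Lemma free_module_CM : graded_CM A.
Proof.
exists k, th; split.
- by move=> i; split; [exact: thA|exists (w i)].
- exists r, eta; split; first exact: etaA.
  move=> x /AP[P ->]; exists (fun j => P j \mPo th) => // j; by exists (P j).
move=> i x /AP[P ->].
have -> : tnth th i * comb P = comb (fun j => 'X_i * P j).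
  rewrite /comb mulr_sumr; apply: eq_bigr => j _.
  by rewrite rmorphM /= tnth_comp_mpolyXU mulrA.
move/in_idealP => h; apply/in_idealP => j; have := h j.
rewrite rmorphM /= killX in_take ?mem_enum // -[X in index X _](nth_ord_enum i i).
rewrite index_uniq ?size_enum_ord ?enum_uniq // ltnn => /eqP.
by rewrite mulf_eq0 (negPf (mpolyX_neq0 _ _)) => /eqP.
Qed.

End FreeModule.

Section Hilbert.
Variables (K : fieldType) (n k r : nat) (A : {pred {mpoly K[n.+1]}}).
Variables (th : k.-tuple {mpoly K[n.+1]}) (w : 'I_k -> nat).
Variables (eta : r.-tuple {mpoly K[n.+1]}) (e : 'I_r -> nat).
Hypothesis w_gt0 : forall i, (0 < w i)%N.
Hypothesis th_homog : forall i, tnth th i \is (w i).-homog.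
Hypothesis eta_homog : forall j, tnth eta j \is (e j).-homog.
Hypothesis AP : forall x, x \in A <-> exists P, x = comb th eta P.
Hypothesis comb_inj : forall P, comb th eta P = 0 -> forall j, P j = 0.

Let th_homog' i : tnth th i \is (wdeg w U_(i)%MM).-homog.
Proof. by rewrite wdeg1. Qed.

Section Degree.
Variables (M d : nat).
Hypothesis dM : (d <= M)%N.
Local Notation idx := ('I_r * {ffun 'I_k -> 'I_M.+1})%type.

(** Exponents are cut off at M to make the index type finite. Weights being positive, no monomial of
    weighted degree at most d is lost. The bound is kept apart from d so that one M serves all
    degrees up to M. *)
Definition idx_mon (x : idx) : 'X_{1..k} := [multinom (x.2 i : nat) | i < k].
Definition idx_deg (x : idx) : nat := (e x.1 + wdeg w (idx_mon x))%N.
Definition idx_set : {set idx} := [set x | idx_deg x == d].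
Definition idx_elt (x : idx) : {mpoly K[n.+1]} := ('X_[idx_mon x] \mPo th) * tnth eta x.1.

Lemma idx_elt_homog x : x \in idx_set -> idx_elt x \is d.-homog.
Proof.
rewrite inE => /eqP <-; rewrite /idx_deg addnC; apply: dhomogM (eta_homog _).
exact: (@dhomog_compX k n.+1 K (wdeg w) th th_homog').
Qed.

Lemma idx_mon_inj (x y : idx) : x.1 = y.1 -> idx_mon x = idx_mon y -> x = y.
Proof.
case: x y => [j f] [j' f'] /= -> h; congr (_, _); apply/ffunP => i; apply/val_inj.
by have := congr1 (fun m : 'X_{1..k} => m i) h; rewrite !mnmE.
Qed.

Lemma comb_idx (c : idx -> K) : \sum_(x in idx_set) c x *: idx_elt x =
  comb th eta (fun j => \sum_(x in idx_set | x.1 == j) c x *: 'X_[idx_mon x]).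
Proof.
rewrite (partition_big (fun x : idx => x.1) xpredT) //= /comb.
apply: eq_bigr => j _; rewrite rmorph_sum mulr_suml /=.
by apply: eq_bigr => x /andP[_ /eqP <-]; rewrite comp_mpolyZ -scalerAl.
Qed.

Definition dvec : #|idx_set|.-tuple (dhomog n.+1 K d) :=
  [tuple indhomog d (idx_elt (enum_val i)) | i < #|idx_set|].

Lemma dvecE i : val (tnth dvec i) = idx_elt (enum_val i).
Proof. by rewrite tnth_mktuple /indhomog insubdK // idx_elt_homog // enum_valP. Qed.

Lemma val_sum (I : Type) (s : seq I) (c : I -> K) (v : I -> dhomog n.+1 K d) :
  val (\sum_(i <- s) c i *: v i) = \sum_(i <- s) c i *: val (v i).
Proof. by rewrite (raddf_sum (@mpoly_of_dhomog n.+1 K d)); apply: eq_bigr. Qed.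

Lemma dvec_free : free dvec.
Proof.
apply/freeP => c /(congr1 val) h i.
have := h; rewrite val_sum.
under eq_bigr do rewrite -tnth_nth dvecE.
pose c' x := if x \in idx_set =P true is ReflectT hx then c (enum_rank_in hx x) else 0.
rewrite (_ : \sum_(i < _) _ = \sum_(x in idx_set) c' x *: idx_elt x); last first.
  rewrite [RHS]big_enum_val /=; apply: eq_bigr => l _.
  rewrite /c'; case: eqP => [hx|]; last by rewrite enum_valP.
  by rewrite enum_valK_in.
rewrite comb_idx => /comb_inj /(_ (enum_val i).1) hp.
have := congr1 (mcoeff (idx_mon (enum_val i))) hp; rewrite mcoeff0 raddf_sum /=.
rewrite (bigD1 (enum_val i)) /=; last by rewrite enum_valP eqxx.
rewrite mcoeffZ mcoeffX eqxx mulr1 big1 ?addr0 => [|x /andP[/andP[hx /eqP h1] ne]]; last first.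
  rewrite mcoeffZ mcoeffX; case: eqP => [h2|_]; last by rewrite mulr0.
  by case/eqP: ne; apply: idx_mon_inj.
rewrite /c'; case: eqP => [hx|]; last by rewrite enum_valP.
by rewrite enum_valK_in.
Qed.

Lemma degree_space : exists2 V : {vspace dhomog n.+1 K d},
  forall v, (v \in V) = (val v \in A) & \dim V = #|idx_set|.
Proof.
exists <<dvec>>%VS; last by rewrite (eqP dvec_free) size_tuple.
move=> v; apply/idP/idP.
  move/coord_span => ->; rewrite val_sum.
  under eq_bigr do rewrite -tnth_nth dvecE.
  apply/AP; exists (fun j => \sum_(i < #|idx_set| | (enum_val i).1 == j) coord dvec i v *: 'X_[idx_mon (enum_val i)]).
  rewrite (partition_big (fun i : 'I_#|idx_set| => (enum_val i).1) xpredT) //= /comb.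
  apply: eq_bigr => j _; rewrite rmorph_sum mulr_suml /=.
  by apply: eq_bigr => i /eqP <-; rewrite comp_mpolyZ -scalerAl.
case/AP=> P eP.
have vd : val v = \sum_(j < r | (e j <= d)%N) (pihomog (wdeg w) (d - e j) (P j) \mPo th) * tnth eta j.
  rewrite -(pihomog_dE (dhomog_is_dhomog v)) eP /comb raddf_sum /= [in RHS]big_mkcond /=.
  apply: eq_bigr => j _; rewrite mulrC; case: leqP => [le|lt].
    by rewrite -{1}(subnKC le) (pihomogM _ _ (eta_homog j)) (pihomog_comp_mpoly th_homog') mulrC.
  by rewrite (pihomogM_lt _ (eta_homog j)).
have elt j m : (e j <= d)%N -> wdeg w m = (d - e j)%N ->
    exists2 u, u \in <<dvec>>%VS & val u = ('X_[m] \mPo th) * tnth eta j.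
  move=> le hm.
  have mM i : (m i < M.+1)%N.
    rewrite ltnS; apply: leq_trans dM; apply: leq_trans (leq_subr (e j) d); rewrite -hm /wdeg (bigD1 i) //=.
    by apply: leq_trans (leq_addr _ _); rewrite leq_pmull.
  pose x : idx := (j, [ffun i => Ordinal (mM i)]).
  have xm : idx_mon x = m by apply/mnmP=> i; rewrite mnmE ffunE.
  have hx : x \in idx_set by rewrite inE /idx_deg xm hm /= subnKC.
  exists (tnth dvec (enum_rank_in hx x)); first exact/memv_span/mem_tnth.
  by rewrite dvecE enum_rankK_in // /idx_elt xm.
have {}vd : exists2 u, u \in <<dvec>>%VS & val u = val v.
  rewrite vd; apply: (big_ind (fun p => exists2 u, u \in <<dvec>>%VS & val u = p)).
  - by exists 0; rewrite ?mem0v.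
  - by move=> _ _ [u hu <-] [u' hu' <-]; exists (u + u'); rewrite ?memvD.
  move=> j le; rewrite {1}[pihomog _ _ _]pihomogE rmorph_sum mulr_suml /=.
  apply: (big_ind (fun p => exists2 u, u \in <<dvec>>%VS & val u = p)).
  - by exists 0; rewrite ?mem0v.
  - by move=> _ _ [u hu <-] [u' hu' <-]; exists (u + u'); rewrite ?memvD.
  move=> m /eqP hm; have [u hu eu] := elt j m le hm.
  exists ((P j)@_m *: u); first exact: memvZ.
  by rewrite comp_mpolyZ -scalerAl -eu linearZ.
by case: vd => u hu /val_inj <-.
Qed.
End Degree.

Lemma hilbert_functionA : hilbert_function A (fun d => #|idx_set d d|).
Proof. by move=> d; apply: degree_space. Qed.

(** Both cardinals are the dimension of the degree d part of A. *)
Lemma card_idx_set M d : (d <= M)%N -> #|idx_set M d| = #|idx_set d d|.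
Proof.
move=> dM; have [V hV <-] := degree_space dM; have [V' hV' <-] := degree_space (leqnn d).
by congr (\dim _); apply/vspaceP => v; rewrite hV hV'.
Qed.

Definition hilb_num : {poly rat} := \sum_(j < r) 'X^(e j).
Definition hilb_den : {poly rat} := \prod_(i < k) (1 - 'X^(w i)).

Lemma size_one_subXn m : (0 < m)%N -> size (1 - 'X^m : {poly rat}) = m.+1.
Proof.
by move=> m0; rewrite -opprB size_polyN -polyC1 size_XnsubC.
Qed.

Lemma hilb_den_neq0 : hilb_den != 0.
Proof.
rewrite prodf_seq_neq0; apply/allP=> i _; apply/implyP=> _.
by rewrite -size_poly_gt0 size_one_subXn.
Qed.

Lemma size_hilb_den : size hilb_den = (\sum_(i < k) w i).+1.
Proof.
rewrite /hilb_den size_prod => [|i _]; last by rewrite -size_poly_gt0 size_one_subXn.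
rewrite (eq_bigr (fun i => w i + 1)%N) => [|i _]; last by rewrite size_one_subXn ?addn1.
by rewrite big_split /= sum1_card -addSn addnK.
Qed.

(** The power series identity is checked at each coefficient M with a polynomial G, the generating
    function truncated at exponents M, which has the right coefficients up to M and factors as the
    numerator times truncated geometric sums. *)
Lemma hilbert_seriesA : hilbert_series A hilb_num hilb_den.
Proof.
split; first exact: hilb_den_neq0.
exists (fun d => #|idx_set d d|); first exact: hilbert_functionA.
move=> M.
pose G : {poly rat} := \sum_(x : 'I_r * {ffun 'I_k -> 'I_M.+1}) 'X^(idx_deg x).
have GE d : (d <= M)%N -> G`_d = #|idx_set d d|%:R.
  move=> dM; rewrite -(card_idx_set dM) /G coef_sum -sum1_card natr_sum.
  rewrite [RHS]big_mkcond /=; apply: eq_bigr => x _.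
  by rewrite coefXn inE eq_sym; case: eqP.
transitivity ((hilb_den * G)`_M).
  rewrite coefM; apply: eq_bigr => i _; rewrite GE ?leq_subr //.
have Gfac : G = hilb_num * \prod_(i < k) \sum_(a < M.+1) 'X^(w i * a).
  rewrite bigA_distr_bigA /= /hilb_num mulr_suml.
  rewrite /G -(pair_bigA _ (fun j f => 'X^(idx_deg (j, f)))) /=.
  apply: eq_bigr => j _; rewrite mulr_sumr; apply: eq_bigr => f _.
  rewrite /idx_deg /= exprD; congr (_ * _); rewrite /wdeg -prodrXr; apply: eq_bigr => i _.
  by rewrite mnmE.
rewrite Gfac mulrCA /hilb_den -big_split /=.
have [Z ->] : exists Z : {poly rat}, \prod_(i < k) ((1 - 'X^(w i)) * \sum_(a < M.+1) 'X^(w i * a)) = 1 + 'X^(M.+1) * Z.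
  apply: (big_ind (fun p => exists Z : {poly rat}, p = 1 + 'X^(M.+1) * Z)).
  - by exists 0; rewrite mulr0 addr0.
  - by move=> _ _ [Z ->] [Z' ->]; exists (Z + Z' + 'X^(M.+1) * Z * Z'); ring.
  (* The geometric sum telescopes to 1 - X^(w (M + 1)), and w >= 1 allows X^(M + 1) to be factored
     out. *)
  move=> i _; exists (- 'X^(w i * M.+1 - M.+1)).
  under eq_bigr do rewrite exprM.
  rewrite -opprB mulNr -subrX1 opprB -exprM mulrN -exprD subnKC //.
  by rewrite leq_pmull.
rewrite mulrDr mulr1 coefD mulrCA coefXnM ltnS leqnn addr0 //.
Qed.
End Hilbert.

(** * Tight closure *)

Lemma euler n (R : comNzRingType) (p : {mpoly R[n]}) d : p \is d.-homog ->
  \sum_(i < n) 'X_i * p^`M(i) = p *+ d.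
Proof.
move/dhomogP=> hp; rewrite [in LHS](mpolyE p) [in RHS](mpolyE p) -sumrMnl.
under eq_bigr do rewrite raddf_sum mulr_sumr /=.
rewrite exchange_big /= !big_seq; apply: eq_bigr => m /hp <-.
rewrite /= mdegE -sumrMnr; apply: eq_bigr => i _.
rewrite mderivZ mderivX -!scalerAr scalerA mulr_natr -scalerMnl.
case: (posnP (m i)) => [->|mi]; first by rewrite !mulr0n.
rewrite -mpolyXD; have -> // : (U_(i) + (m - U_(i)) = m)%MM.
by rewrite addmC submK // lep1mP -lt0n.
Qed.

Section Koszul.
Variable K : finFieldType.
Local Notation T := {mpoly K[3]}.
Local Notation a := (aT K).
Local Notation b := (bT K).
Local Notation c := (cT K).
Implicit Types x y z : T.

(** Exactness of the Koszul complex on the variables. Setting b = c = 0 gives a x = 0, so x = b r +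
    c s; then y + a r vanishes at c = 0, which gives t. *)
Lemma koszul3 x y z : a * x + b * y + c * z = 0 ->
  exists r s t, [/\ x = b * r + c * s, y = - a * r + c * t & z = - a * s - b * t].
Proof.
move=> h.
have [r er] := kill1 o1 x; have [s es] := kill1 o2 (kill [:: o1] x).
have kv J : (kill J a = if o0 \in J then 0 else a) *
   (kill J b = if o1 \in J then 0 else b) * (kill J c = if o2 \in J then 0 else c).
  by rewrite /aT /bT /cT !killX.
have ab := (mpolyX_neq0 K o0, mpolyX_neq0 K o1, mpolyX_neq0 K o2).
have w0 : kill [:: o2] (kill [:: o1] x) = 0.
  rewrite kill_cat; have := congr1 (kill ([:: o2] ++ [:: o1])) h.
  rewrite !rmorphD !rmorphM rmorph0 /= !kv /= !mul0r !addr0 => /eqP.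
  by rewrite mulf_eq0 (negPf (ab.1.1)) => /eqP.
have ex : x = b * r + c * s by rewrite er es w0 add0r addrC.
have [t et] := kill1 o2 (y + a * r).
have h2 : b * (y + a * r) + c * (z + a * s) = 0 by rewrite -h ex; ring.
have w1 : kill [:: o2] (y + a * r) = 0.
  have := congr1 (kill [:: o2]) h2; rewrite rmorphD !(rmorphM (kill [:: o2])) rmorph0 /= !kv /= mul0r addr0 => /eqP.
  by rewrite mulf_eq0 (negPf (ab.1.2)) => /eqP.
exists r, s, t; rewrite w1 add0r in et; split=> //.
  by rewrite -[y](addrK (a * r)) et -/c; ring.
have : c * (b * t + z + a * s) = 0 by rewrite -h2 et -/c; ring.
move/eqP; rewrite mulf_eq0 (negPf (ab.2)) /= => /eqP h3.
by rewrite -[LHS](subr0) -h3; ring.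
Qed.
End Koszul.

(** * The trace from T to the invariants *)

Section Trace.
Variable K : finFieldType.
Local Notation T := {mpoly K[3]}.
Implicit Types (s r : {'GL_2[K]}) (x y : T).

Definition trace x : T := \sum_(s : {'GL_2[K]}) actT s x.

Lemma trace_inv x : trace x \in invT K.
Proof.
apply/invTP=> s; rewrite /trace rmorph_sum /= [RHS](reindex_inj (mulgI s)) /=.
by apply: eq_bigr => r _; rewrite actTM.
Qed.

Lemma traceD x y : trace (x + y) = trace x + trace y.
Proof. by rewrite /trace -big_split; apply: eq_bigr => s _; rewrite rmorphD. Qed.

Lemma traceM x y : x \in invT K -> trace (x * y) = x * trace y.
Proof.
move/invTP=> hx; rewrite /trace mulr_sumr; apply: eq_bigr => s _.
by rewrite rmorphM /= hx.
Qed.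

(** The trace is linear over invariants. The multiplier [trace u] does not depend on the relation,
    so one u serves for all Frobenius powers. *)
Lemma trace_comb u f g h x y : f \in invT K -> g \in invT K -> h \in invT K ->
  f = g * x + h * y -> trace u * f = trace (u * x) * g + trace (u * y) * h.
Proof.
move=> hf hg hh e.
rewrite [LHS]mulrC -(traceM _ hf) [X in X + _]mulrC [X in _ + X]mulrC.
rewrite -(traceM _ hg) -(traceM _ hh) -traceD; congr (trace _).
by rewrite e; ring.
Qed.

Definition same_act s r := [forall i, actT s 'X_i == actT r 'X_i].

Lemma same_actP s r x : same_act s r -> actT s x = actT r x.
Proof.
move/forallP => h; apply: (@mpoly_hom_eq 3 K T (actT s) (actT r)) => [e|i].
  by rewrite /= !actTC.
by have /eqP := h i.
Qed.

(** Dedekind's independence of characters. As distinct matrices may act alike, the conclusion is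
    about the sum of the coefficients over one class of equal actions. *)
Lemma act_independent (S : {set {'GL_2[K]}}) (k : {'GL_2[K]} -> T) r :
  (forall x, \sum_(s in S) k s * actT s x = 0) ->
  \sum_(s in S | same_act s r) k s = 0.
Proof.
have [n] := ubnP #|S|; elim: n S k => // n IH S k ltS h.
have [/existsP[s0 /andP[s0S]]|] := boolP [exists s0, (s0 \in S) && ~~ same_act s0 r]; last first.
  rewrite negb_exists => /forallP hs; rewrite -[RHS](h 1).
  apply: eq_big => [s|s _]; last by rewrite rmorph1 mulr1.
  by have := hs s; case: (s \in S) => //=; rewrite negbK.
rewrite negb_forall => /existsP[i ne].
set y := 'X_i in ne.
have h' x : \sum_(s in S :\ s0) (k s * (actT s y - actT s0 y)) * actT s x = 0.
  transitivity (\sum_(s in S) (k s * (actT s y - actT s0 y)) * actT s x).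
    rewrite [RHS](big_setD1 s0 s0S) [X in _ = X + _](_ : _ = 0) ?add0r //.
    by rewrite subrr mulr0 mul0r.
  rewrite (eq_bigr (fun s => k s * actT s (y * x) - actT s0 y * (k s * actT s x))).
    by rewrite big_split /= sumrN -mulr_sumr !h mulr0 subr0.
  have aux (p A B C : T) : p * (A - B) * C = p * (A * C) - B * (p * C) by ring.
  move=> s _; have -> : actT s (y * x) = actT s y * actT s x by apply: rmorphM.
  exact: (aux).
have lt' : (#|S :\ s0| < n)%N by move: ltS; rewrite (cardsD1 s0) s0S.
have := IH _ _ lt' h'.
have nr : actT r y - actT s0 y != 0 by rewrite subr_eq0 eq_sym.
rewrite (eq_big (fun s => (s \in S) && same_act s r) (fun s => k s * (actT r y - actT s0 y))).
- by rewrite -mulr_suml => /eqP; rewrite mulf_eq0 (negPf nr) orbF => /eqP.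
- move=> s; rewrite !inE; case: eqP => [->|//] /=; rewrite s0S /=.
  by apply/esym/negbTE; rewrite negb_forall; apply/existsP; exists i.
by move=> s /andP[_ hs]; rewrite (same_actP _ hs).
Qed.

Lemma same_act1 s : same_act s 1%g -> GLval s = (GLval s 0 0)%:M.
Proof.
move=> h; have us := GLval_unitmx s.
have : conj_gen s (genX K) = genX K.
  rewrite -actT_genX; apply/matrixP=> i j; rewrite mxE.
  by rewrite (same_actP _ h) actT1.
rewrite /conj_gen => /(congr1 (fun M => map_mx (@mpolyC 3 K) (GLval s) *m M)).
rewrite !mulmxA -map_mxM mulmxV // map_mx1 mul1mx => e.
have e00 := congr1 (fun M : 'M[T]_2 => M 0 0) e.
have e01 := congr1 (fun M : 'M[T]_2 => M 0 1) e.
move: e00 e01; rewrite !mulmx2E !mx2E ![map_mx _ _ _ _]mxE => e00 e01.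
have cf (p p' : T) i : p = p' -> p@_(U_(i)) = p'@_(U_(i)) by move=> ->.
have z0 : GLval s 1 0 = 0.
  have := cf _ _ o1 e00; rewrite !mcoeffD !(mulrC (aT K)) !(mulrC (bT K)) !mcoeffCM !mcoeffXU /=.
  by rewrite !mulr0 ?mulr1 ?add0r ?addr0.
have y0 : GLval s 0 1 = 0.
  have := cf _ _ o2 e00; rewrite !mcoeffD !(mulrC (aT K)) !(mulrC (bT K)) !mcoeffCM !mcoeffXU /=.
  by rewrite !mulr0 ?mulr1 ?add0r ?addr0 => <-.
have w0 : GLval s 1 1 = GLval s 0 0.
  have := cf _ _ o1 e01; rewrite mulrN mcoeffD mcoeffB !(mulrC (aT K)) !(mulrC (bT K)) !mcoeffCM !mcoeffXU /=.
  by rewrite !mulr0 !mulr1 ?subr0 ?add0r ?addr0 => ->.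
by apply: mx2P; rewrite ?z0 ?y0 ?w0 !mxE.
Qed.

Lemma card_same_act1 : #|[set s | same_act s 1%g]| = #|K|.-1.
Proof.
rewrite -(cardC1 (0 : K)) -(card_in_imset (f := fun s : {'GL_2[K]} => GLval s 0 0)).
  apply: eq_card => k; rewrite !inE; apply/imsetP/idP => [[s]|k0].
    rewrite inE => /same_act1 es ->; apply/eqP=> e0.
    have := GLval_unitmx s; rewrite es e0 unitmxE unitfE det2E !mxE /=.
    by rewrite ?(mulr0n, mul0r, subrr, eqxx).
  have [|s hs] := @GL_of_mx K (k%:M).
    by rewrite det2E !mxE /= ?(mulr0n, mul0r, subr0) mulf_neq0.
  exists s; last by rewrite hs mxE.
  have E : conj_gen s (genX K) = genX K.
    rewrite /conj_gen hs map_scalar_mx /= mul_mx_scalar -mul_scalar_mx mulmxA -map_scalar_mx /=.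
    by rewrite -hs -map_mxM mulmxV ?GLval_unitmx // map_mx1 mul1mx.
  rewrite inE; apply/forallP => i; rewrite actT1; apply/eqP; move: i.
  by apply: ord3P; rewrite actT_vars E mx2E.
move=> s s'; rewrite !inE => /same_act1 e /same_act1 e' h.
by apply/val_inj; rewrite /= -[LHS]/(GLval s) -[RHS]/(GLval s') e e' h.
Qed.

(** If the trace vanished identically, independence would make the number of matrices acting
    trivially zero in K; these are the q - 1 scalars, and q - 1 = -1 in K. *)
Lemma trace_neq0 : exists u, trace u != 0.
Proof.
apply: NNPP => hn.
have h x : \sum_(s in [set: {'GL_2[K]}]) 1 * actT s x = 0.
  rewrite (eq_bigl xpredT) => [|s]; last by rewrite inE.
  under eq_bigr do rewrite mul1r.
  by apply/eqP; apply: contraT => nz; case: hn; exists x.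
have := act_independent 1%g h.
rewrite (eq_bigl (mem [set s | same_act s 1%g])) => [|s]; last by rewrite !inE.
rewrite sumr_const card_same_act1 => /eqP; apply/negP.
rewrite -(rmorph_nat (@mpolyC 3 K)) mpolyC_eq0.
have K1 := finNzRing_gt1 K.
have : #|K|.-1%:R + 1 = 0 :> K by rewrite natr1 prednK ?natr_card0 // ltnW.
by move/eqP; rewrite addr_eq0 => /eqP ->; rewrite oppr_eq0 oner_eq0.
Qed.
End Trace.

Section NotFRegular.
Variables (K : finFieldType) (tau delta : K).
Hypothesis noroot : forall x, x ^+ 2 - tau * x + delta != 0.
Variables (L : finFieldType) (io : {rmorphism K -> L}) (lam : L).
Hypothesis hlam : lam ^+ 2 - io tau * lam + io delta = 0.
Hypothesis cardL : #|L| = (#|K| ^ 2)%N.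
Hypothesis oddq : odd #|K|.
Local Notation T := {mpoly K[3]}.
Local Notation a := (aT K).
Local Notation b := (bT K).
Local Notation c := (cT K).
Local Notation q := #|K|.
Local Notation P1 := (steenrodP1 (detT K)).
Local Notation p4 := (piST (f4 tau delta)).
Local Notation J := (jac (detT K) P1 p4).

(* Since deg p4 is divisible by the characteristic, Euler's formula makes the
   gradient of p4 a Koszul cycle, so it is a cross product with (a, b, c). *)
Lemma jac_in_ideal : exists x y : T, J = detT K * x + P1 * y.
Proof.
have := euler (dhomog_piST_f4 tau delta); rewrite big_ord3.
have -> : p4 *+ (q ^ 2 - q) = 0.
  rewrite -mulr_natr -(rmorph_nat (@mpolyC 3 K)) natrB; last by rewrite -mulnn leq_pmulr // ltnW // finNzRing_gt1.
  by rewrite natrX natr_card0 expr0n subrr rmorph0 mulr0.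
move/koszul3 => [r [s [t [e0 e1 e2]]]].
rewrite jacE e0 e1 e2 !mderiv_detT !mderiv_P1 P1E /detT /det3.
move: (a ^+ q) (b ^+ q) (c ^+ q) => x y z.
(* With w = (t, -s, r), the gradient of p4 is (a, b, c) x w. Lagrange's identity gives J = 2 det
   (grad P1 . w) - P1 (grad det . w), since (a, b, c) pairs to 2 det with grad det and to P1 with
   grad P1. *)
exists (2%:R * (t * (- x *+ 2) - s * (- z) + r * (- y))).
exists (- (t * (- a *+ 2) - s * (- c) + r * (- b))).
ring.
Qed.

(** Comparing the coefficients of J in the direct sum would give 1 as a combination of det and
    P1(det), which have no constant term. *)
Lemma jac_notin_ideal (x y : T) : x \in invT K -> y \in invT K ->
  J = detT K * x + P1 * y -> False.
Proof.
move=> /(odd_generation noroot hlam cardL oddq)[x0 [x1 [hx0 hx1 ->]]].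
move=> /(odd_generation noroot hlam cardL oddq)[y0 [y1 [hy0 hy1 ->]]] e.
have g0 : in_subalg [tuple detT K; P1; p4] (detT K) by apply: (in_subalg_gen _ o0).
have g1 : in_subalg [tuple detT K; P1; p4] P1 by apply: (in_subalg_gen _ o1).
have [|||_ h] := @odd_direct _ _ _ noroot _ _ _ hlam oddq (detT K * x0 + P1 * y0) (detT K * x1 + P1 * y1 + (- 1)%:MP).
- by apply: in_subalgD; apply: in_subalgM.
- apply: in_subalgD; last exact: in_subalgC.
  by apply: in_subalgD; apply: in_subalgM.
- by rewrite -(subrr J) {2}e rmorphN rmorph1; ring.
have := congr1 (mcoeff 0%MM) h.
have d0 : (detT K)@_0%MM = 0.
  by apply: dhomog_nemf_coeff (dhomog_detT K) _; rewrite /= mdeg0.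
have p0 : P1@_0%MM = 0.
  by apply: dhomog_nemf_coeff (dhomog_P1 K) _; rewrite /= mdeg0 addn1.
rewrite !mcoeffD !(rmorphM (mcoeff 0%MM)) /= d0 p0 !mul0r !add0r mcoeffC eqxx mulr1 mcoeff0.
by move/eqP; rewrite oppr_eq0 oner_eq0.
Qed.

Lemma not_F_regular p : p \in [pchar K] -> ~ F_regular p (ringTG K).
Proof.
move=> pK Freg.
pose B := ringTG K.
pose D : B := RingTG (detT_inv K); pose P : B := RingTG (P1_inv K).
pose j : B := RingTG (jac4_inv noroot).
(* The failure already occurs in the trivial localization, T^G itself. *)
pose W (x : B) := x = 1.
have hW : mult_set W by split=> // [/eqP|x y -> ->]; rewrite ?mulr1 // /W eq_sym oner_eq0.
pose I (x : {fraction B}) := exists y z : B, x = (D * y + P * z)%:F.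
have Wb (b' : B) : localization W b'%:F by exists b', 1; rewrite rmorph1 divr1.
have hI : ideal_of (localization W) I.
  split.
  - by move=> _ [y [z ->]].
  - by exists 0, 0; rewrite !mulr0 addr0 rmorph0.
  - by move=> _ _ [y [z ->]] [y' [z' ->]]; exists (y + y'), (z + z'); rewrite -rmorphD; congr (_%:F); ring.
  move=> _ _ [b' [w' [-> ->]]] [y [z ->]]; exists (b' * y), (b' * z).
  by rewrite rmorph1 divr1 -rmorphM; congr (_%:F); ring.
have [x [y exy]] := jac_in_ideal.
have [u u0] := trace_neq0 K.
pose c0 : B := RingTG (trace_inv u).
have [|y' [z' e]] := Freg W hW I hI j%:F.
  split; first exact: Wb.
  exists c0%:F; split; first exact: Wb.
    by rewrite tofrac_eq0 -val_eqE.
  (* The Frobenius turns J = det x + P1 y into the same relation between Q-th powers, to which the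
     trace is applied; the nonzero [trace u] is the multiplier for every e. *)
  exists 0%N => e _; set Q := (p ^ e)%N.
  have pT : p \in [pchar T] by apply: (rmorph_pchar (@mpolyC 3 K)).
  have QT : [pchar T].-nat Q.
    by rewrite /Q pnatX (eq_pnat _ (pcharf_eq pT)) pnat_id // (pcharf_prime pK).
  pose b1 : B := RingTG (trace_inv (u * x ^+ Q)).
  pose b2 : B := RingTG (trace_inv (u * y ^+ Q)).
  have E : c0 * j ^+ Q = b1 * D ^+ Q + b2 * P ^+ Q.
    have valX (v : B) m : val (v ^+ m) = val v ^+ m by rewrite rmorphXn.
    apply/val_inj; rewrite [LHS]rmorphM [RHS]rmorphD !rmorphM /= !valX /=.
    have jQ : J ^+ Q \in invT K by apply/invTP=> s; rewrite rmorphXn /= (invTP _ (jac4_inv noroot)).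
    have dQ : detT K ^+ Q \in invT K by apply/invTP=> s; rewrite rmorphXn /= (invTP _ (detT_inv K)).
    have pQ : P1 ^+ Q \in invT K by apply/invTP=> s; rewrite rmorphXn /= (invTP _ (P1_inv K)).
    apply: (trace_comb _ jQ dQ pQ).
    by rewrite {1}exy (exprDn_pchar _ _ QT) !exprMn.
  exists 2%N, (fun i => if i == 0 then b1%:F else b2%:F), (fun i => if i == 0 then D%:F else P%:F).
  split.
  - by move=> i; case: (i == 0); apply: Wb.
  - move=> i; case: (i == 0).
      by exists 1, 0; rewrite mulr1 mulr0 addr0.
    by exists 0, 1; rewrite mulr1 mulr0 add0r.
  by rewrite big_ord_recl big_ord1 /= -!rmorphXn -!rmorphM -rmorphD /= E.
move/eqP: e; rewrite tofrac_eq => /eqP /(congr1 val) /= e.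
by apply: (jac_notin_ideal (x := val y') (y := val z')) e; exact: valP.
Qed.

End NotFRegular.

(** * Factoriality of polynomial rings *)

(** Factorisations into prime rather than irreducible elements; uniqueness up to units is then
    automatic. The unit is expressed by [divides u 1]. *)
Definition ufd (R : idomainType) : Prop := forall x : R, x != 0 ->
  exists (s : seq R) (u : R),
  [/\ forall p, p \in s -> prime_elt p, divides u 1 & x = u * \prod_(p <- s) p].

Section Primes.
Variable R : idomainType.
Implicit Types p x y u : R.

Lemma prime_assoc p p' : prime_elt p -> prime_elt p' -> divides p p' -> divides p' p.
Proof.
move=> [p0 p1 pM] [p0' p1' pM'] [v e].
have [//|[z ez]|//] := pM' v p _; first by rewrite -e; apply: dividesxx.
case: p1; exists z; apply: (mulfI p0').
by rewrite mulr1 {1}e ez; ring.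
Qed.

Lemma prime_unitM p u x : prime_elt p -> divides u 1 -> divides p (u * x) -> divides p x.
Proof.
move=> [_ p1 pM] [v uv] /pM[h|//]; case: p1; exact: divides_trans h (ex_intro _ v uv).
Qed.

Lemma ufd_nonunit_prime x : ufd R -> x != 0 -> ~ divides x 1 ->
  exists2 p, prime_elt p & divides p x.
Proof.
move=> U x0 nx; have [s [u [hs hu e]]] := U x x0.
case: s hs e => [|p s] hs e.
  by case: nx; rewrite e big_nil mulr1.
exists p; first by apply: hs; rewrite mem_head.
by rewrite e big_cons; apply: divides_mull; apply: divides_mulr; apply: dividesxx.
Qed.
End Primes.

Section Gauss.
Variable R : idomainType.
Hypothesis U : ufd R.
Implicit Types (f g h : {poly R}) (p c : R).

Lemma dividesCP p f : divides p%:P f <-> forall i, divides p f`_i.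
Proof.
split=> [[g ->] i|h]; first by rewrite coefMC; exists g`_i.
have [z hz] : exists z : 'I_(size f) -> R, forall i : 'I_(size f), f`_i = z i * p.
  by apply: (fin_all_exists (P := fun (i : 'I_(size f)) z => f`_i = z * p)) => i; apply: (h).
exists (\poly_(i < size f) (if insub i is Some j then z j else 0)).
apply/polyP => i; rewrite coefMC coef_poly; case: ltnP => lt.
  by rewrite insubT /= -hz.
by rewrite mul0r nth_default.
Qed.

(** Gauss's lemma. If p divides f g, it divides one of the leading coefficients; removing that
    leading term preserves the hypothesis and lowers the total size. *)
Lemma prime_eltC p : prime_elt p -> prime_elt p%:P.
Proof.
move=> [p0 p1 pM]; split; first by rewrite polyC_eq0.
  by move/dividesCP/(_ 0%N); rewrite coef1.
move=> f g; have [n] := ubnP (size f + size g); elim: n f g => // n IH f g lt d.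
have [->|f0] := eqVneq f 0; first by left; apply: divides0.
have [->|g0] := eqVneq g 0; first by right; apply: divides0.
have strip h : h != 0 -> divides p (lead_coef h) ->
    exists h', (size h' < size h)%N /\ divides p%:P (h - h').
  move=> h0 dl; exists (h - (lead_coef h)%:P * 'X^((size h).-1)); split.
    have e : size h = (size h).-1.+1 by rewrite prednK // size_poly_gt0.
    rewrite {2}e ltnS; apply/leq_sizeP => j; rewrite leq_eqVlt => /orP[/eqP <-|lt'].
      by rewrite coefB coefCM coefXn eqxx mulr1 subrr.
    rewrite coefB coefCM coefXn gtn_eqF // mulr0 subr0 nth_default //.
    by rewrite e.
  have -> : h - (h - (lead_coef h)%:P * 'X^((size h).-1)) =
      (lead_coef h)%:P * 'X^((size h).-1) by ring.
  by apply: divides_mulr; apply: divides_rmorph dl.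
have : divides p (lead_coef f * lead_coef g).
  by rewrite -lead_coefM; exact: (proj1 (dividesCP _ _) d).
case/pM => dl.
  have [f' [ltf df]] := strip f f0 dl.
  have [|||h] := IH f' g; [by rewrite -ltnS (leq_trans _ lt) // ltnS ltn_add2r| |move=> h; left|by right].
    have -> : f' * g = f * g - (f - f') * g by ring.
    by apply: dividesB => //; apply: divides_mulr.
  by rewrite -[f](subrK f'); apply: dividesD.
have [g' [ltg dg]] := strip g g0 dl.
have [|||h] := IH f g'; [by rewrite -ltnS (leq_trans _ lt) // ltnS ltn_add2l| |by move=> h; left|right].
  have -> : f * g' = f * g - f * (g - g') by ring.
  by apply: dividesB => //; apply: divides_mull.
by rewrite -[g](subrK g'); apply: dividesD.
Qed.

Definition prim_poly f := forall p, prime_elt p -> ~ divides p%:P f.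

(** Each prime factor of c divides the product k f but not f, so it can be divided off k. *)
Lemma prim_poly_cancel f h c : c != 0 -> prim_poly f -> divides f (c%:P * h) -> divides f h.
Proof.
move=> c0 pf; have [s [u [hs [v uv] ->]]] := U c0.
elim: s hs h => [|p s IH] hs h.
  rewrite big_nil mulr1 => d.
  have -> : h = v%:P * (u%:P * h) by rewrite mulrA -polyCM -uv polyC1 mul1r.
  exact: divides_mull.
rewrite big_cons => -[k ek].
have pp := prime_eltC (hs p (mem_head _ _)).
have p0 := prime_elt_neq0 pp.
have [_ _ pM] := pp.
have [|[k' ek']|d] := pM k f.
- by rewrite -ek !polyCM; exists (u%:P * (\prod_(j <- s) j)%:P * h); ring.
- apply: IH; first by move=> q qs; apply: hs; rewrite inE qs orbT.
  exists k'; apply: (mulfI p0); transitivity (k * f).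
    by rewrite -ek !polyCM; ring.
  by rewrite ek'; ring.
by case: (pf p (hs p (mem_head _ _)) d).
Qed.

(* Pulling the constant c out of c f = e d keeps the degrees of the factors. *)
Lemma clear_denominator c f e d : c != 0 -> c%:P * f = e * d ->
  exists e' d' r, [/\ f = e' * d', size d' = size d, r != 0 & d = r%:P * d'].
Proof.
move=> c0; have [s [u [hs [v uv] ec]]] := U c0.
move: c0; rewrite ec {c ec} => c0.
elim: s hs c0 e d => [|p s IH] hs c0 e d.
  rewrite big_nil mulr1 => h; exists (v%:P * e), d, 1; split; rewrite ?oner_eq0 ?polyC1 ?mul1r //.
  by rewrite -mulrA -h mulrA -polyCM -uv polyC1 mul1r.
rewrite big_cons => h.
have pp := prime_eltC (hs p (mem_head _ _)).
have p0 := prime_elt_neq0 pp.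
have p0' : p != 0 by rewrite -polyC_eq0.
have [_ _ pM] := pp.
have hs' q : q \in s -> prime_elt q by move=> qs; apply: hs; rewrite inE qs orbT.
have c0' : u * \prod_(j <- s) j != 0.
  by apply: contraNneq c0 => E; rewrite big_cons mulrCA E mulr0.
have h' : p%:P * ((u * \prod_(j <- s) j)%:P * f) = e * d by rewrite -h !polyCM; ring.
have [|[z ez]|[z ez]] := pM e d.
- by rewrite -h'; apply: divides_mulr; apply: dividesxx.
- apply: (IH hs' c0' z d); apply: (mulfI p0); rewrite h' ez; ring.
have [|e' [d' [r [h1 h2 h3 h4]]]] := IH hs' c0' e z.
  by apply: (mulfI p0); rewrite h' ez; ring.
exists e', d', (p * r); split=> //; last by rewrite ez h4 polyCM; ring.
  by rewrite h2 ez mulrC mul_polyC size_scale.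
by rewrite mulf_neq0.
Qed.

(** Irreducibility with respect to the degree: a constant factor need not be a unit. *)
Definition irreducible_elt f :=
  forall g h, f = g * h -> size g = 1%N \/ size h = 1%N.

(** If f and g are coprime over the fraction field, Bezout gives a nonzero constant r with f
    dividing r h, and r cancels by primitivity. Otherwise their gcd is nonconstant, hence f up to
    constants after clearing denominators, and f divides g. *)
Lemma prim_irreducible_prime f : (1 < size f)%N -> prim_poly f -> irreducible_elt f ->
  prime_elt f.
Proof.
move=> sf pf irr; have f0 : f != 0 by rewrite -size_poly_gt0 ltnW.
split=> //.
  move=> [z /(congr1 (fun r : {poly R} => size r))]; rewrite size_poly1.
  have [->|z0] := eqVneq z 0; first by rewrite mul0r size_poly0.
  rewrite size_mul // => e; move: sf; rewrite -(size_poly_gt0 z) in z0.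
  by move: e z0; case: (size z) => // k; case: (size f) => [|[|m]] //; rewrite addSn !addnS.
move=> g h dgh.
have [cop|ncop] := boolP (coprimep f g).
  right; have [[u v] /= /eqp_size] := Bezout_coprimepP _ _ cop.
  rewrite size_poly1 => /eqP/size_poly1P[r r0 er].
  apply: (prim_poly_cancel r0 pf); rewrite -er mulrDl.
  apply: dividesD; first by exists (u * h); ring.
  by rewrite -mulrA; apply: divides_mull.
left; set d := gcdp f g.
have sd : (1 < size d)%N.
  have : size d != 1%N by move: ncop; rewrite coprimep_def.
  have : size d != 0%N by rewrite size_poly_eq0 gcdp_eq0 negb_and f0.
  by case: (size d) => [|[|k]].
have [[c e] /= c0 ec] := Pdiv.Idomain.dvdpP _ _ (dvdp_gcdl f g).
have [[c' k] /= c0' ek] := Pdiv.Idomain.dvdpP _ _ (dvdp_gcdr f g).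
rewrite -mul_polyC in ec; rewrite -mul_polyC in ek.
have [e' [d' [r [h1 h2 h3 h4]]]] := clear_denominator c0 ec.
have [/eqP/size_poly1P[w w0 ew]|sd'] := irr _ _ h1; last by move: sd; rewrite -/d -h2 sd'.
have [v uv] : divides w 1.
  apply: NNPP => /(ufd_nonunit_prime U w0)[p pp dp].
  apply: (pf p pp); rewrite h1 ew; apply: divides_mulr; apply: divides_rmorph dp.
apply: (prim_poly_cancel c0' pf); rewrite ek h4; apply: divides_mull; apply: divides_mull.
exists v%:P; rewrite h1 ew mulrA -polyCM -uv polyC1 mul1r //.
Qed.

(** A prime dividing f divides its leading coefficient and is associated to one of the finitely many
    prime factors there; removing them one at a time terminates. *)
Lemma extract_content f : f != 0 -> exists s f1,
  [/\ forall p : R, p \in s -> prime_elt p, prim_poly f1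
    & f = (\prod_(p <- s) p%:P) * f1].
Proof.
move=> f0; have l0 : lead_coef f != 0 by rewrite lead_coef_eq0.
have [s [u [hs hu el]]] := U l0.
have [N eN] : exists N, size s = N by exists (size s).
elim: N f f0 l0 s hs el eN => [|N IHN] f f0 l0 s hs el eN;
  (have [pf|np] := classic (prim_poly f);
     [by exists [::], f; split=> //; rewrite big_nil mul1r|]).
  move/size0nil: eN => es; case: np => p pp /dividesCP/(_ (size f).-1).
  rewrite -[f`_ _]/(lead_coef f) el es big_nil mulr1 => h.
  by case: pp => _ p1 _; case: p1; apply: divides_trans h hu.
have [p [pp dp]] : exists p, prime_elt p /\ divides p%:P f.
  by apply: NNPP => h; apply: np => p pp dp; apply: h; exists p.
have [p' p's dpp'] : exists2 p', p' \in s & divides p p'.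
  apply: (prime_elt_prod (F := id) pp); apply: (prime_unitM pp hu).
  by rewrite -el; exact: (proj1 (dividesCP _ _) dp).
have pp' := hs p' p's; have [p'0 _ _] := pp'.
have [f' ef] : divides p'%:P f.
  by apply: divides_trans dp; apply: divides_rmorph; apply: prime_assoc.
have f'0 : f' != 0 by apply: contraNneq f0 => h; rewrite ef h mul0r.
have [||||s' [f1 [h1 h2 h3]]] := IHN f' f'0 _ (rem p' s).
- by rewrite lead_coef_eq0.
- by move=> q /mem_rem/hs.
- have eP : \prod_(j <- s) j = p' * \prod_(j <- rem p' s) j by rewrite (big_rem p').
  apply: (mulfI p'0); rewrite mulrCA -eP -el ef lead_coefM lead_coefC.
  by rewrite mulrC.
- by rewrite size_rem // eN.
exists (p' :: s'), f1; split=> //.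
  by move=> q; rewrite inE => /orP[/eqP ->|/h1].
by rewrite big_cons ef h3; ring.
Qed.

Lemma ufd_poly : ufd {poly R}.
Proof.
move=> f; have [n] := ubnP (size f); elim: n f => // n IH f lt f0.
have [s [f1 [hs pf ef]]] := extract_content f0.
have f10 : f1 != 0 by apply: contraNneq f0 => h; rewrite ef h mulr0.
have P0 : \prod_(p <- s) p%:P != 0 :> {poly R}.
  by apply: contraNneq f0 => h; rewrite ef h mul0r.
have hs' q : q \in [seq p%:P | p <- s] -> prime_elt q.
  by case/mapP=> p ps ->; apply: prime_eltC (hs p ps).
have sf1 : (size f1 <= size f)%N.
  rewrite ef size_mul //; move: P0; rewrite -size_poly_gt0.
  by move: (\prod_(p <- s) _) => P; case: (size P) => // k _; rewrite addSn leq_addl.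
suff [s' [u [h1 h2 h3]]] : exists (s' : seq {poly R}) (u : {poly R}),
    [/\ forall g, g \in s' -> prime_elt g, divides u 1 & f1 = u * \prod_(g <- s') g].
  exists ([seq p%:P | p <- s] ++ s'), u; split=> //.
    by move=> q; rewrite mem_cat => /orP[/hs'|/h1].
  by rewrite big_cat /= big_map ef h3; ring.
have [s1|s1] := leqP (size f1) 1.
  have [w w0 ew] : exists2 w, w != 0 & f1 = w%:P.
    by apply/size_poly1P; rewrite eqn_leq s1 size_poly_gt0.
  exists [::], f1; split=> //; last by rewrite big_nil mulr1.
  apply: NNPP => nu; have [|p pp dp] := @ufd_nonunit_prime R w U w0.
    by move=> hw; apply: nu; rewrite ew -polyC1; apply: divides_rmorph hw.
  by apply: (pf p pp); rewrite ew; apply: divides_rmorph dp.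
have [irr|nirr] := classic (irreducible_elt f1).
  exists [:: f1], 1; split; [|exact: dividesxx|by rewrite big_seq1 mul1r].
  by move=> q; rewrite inE => /eqP ->; apply: prim_irreducible_prime.
have [g [h [e sg sh]]] : exists g h, [/\ f1 = g * h, size g != 1%N & size h != 1%N].
  apply: NNPP => H; apply: nirr => g h e.
  have [/eqP|sg] := boolP (size g == 1%N); first by left.
  have [/eqP|sh] := boolP (size h == 1%N); first by right.
  by case: H; exists g, h.
have g0 : g != 0 by apply: contraNneq f10 => E; rewrite e E mul0r.
have h0 : h != 0 by apply: contraNneq f10 => E; rewrite e E mulr0.
have [lg lh] : (size g < n)%N /\ (size h < n)%N.
  move: sg sh lt sf1; rewrite e size_mul //; move: g0 h0; rewrite -!size_poly_gt0.
  move: (size g) (size h) (size f) => x y z; clear; lia.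
have [sg' [ug [a1 a2 a3]]] := IH g lg g0.
have [sh' [uh [b1 b2 b3]]] := IH h lh h0.
exists (sg' ++ sh'), (ug * uh); split.
- by move=> q; rewrite mem_cat => /orP[/a1|/b1].
- by rewrite -(mulr1 1); apply: divides_mul.
by rewrite big_cat /= e {1}a3 {1}b3; ring.
Qed.

End Gauss.

Lemma ufd_iso (R S : idomainType) (f : {rmorphism R -> S}) (g : {rmorphism S -> R}) :
  cancel f g -> cancel g f -> ufd R -> ufd S.
Proof.
move=> fK gK U x x0.
have [|s [u [hs hu e]]] := U (g x).
  by rewrite -(inj_eq (can_inj fK)) gK rmorph0.
exists (map f s), (f u); split.
- move=> _ /mapP[p /hs [p0 p1 pM] ->]; split.
  + by rewrite -(inj_eq (can_inj gK)) fK rmorph0.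
  + by move/(divides_rmorph g); rewrite fK rmorph1.
  move=> y z /(divides_rmorph g); rewrite fK rmorphM => /pM[] /(divides_rmorph f).
    by rewrite gK; left.
  by rewrite gK; right.
- by rewrite -(rmorph1 f); apply: divides_rmorph.
by rewrite big_map -rmorph_prod -rmorphM -e gK.
Qed.

Section MPolyUfd.
Variables (K : fieldType) (n : nat).
Local Notation M := {mpoly K[n]}.

Definition unmuni (p : {poly M}) : {mpoly K[n.+1]} := (map_poly (@mwiden n K) p).['X_ord_max].

Lemma unmuni_zmod : zmod_morphism unmuni.
Proof. by move=> p r; rewrite /unmuni rmorphB hornerD hornerN. Qed.
Lemma unmuni_monoid : monoid_morphism unmuni.
Proof. by split=> [|p r]; rewrite /unmuni ?rmorph1 ?hornerC // rmorphM hornerM. Qed.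
HB.instance Definition _ := GRing.isZmodMorphism.Build {poly M} {mpoly K[n.+1]} unmuni unmuni_zmod.
HB.instance Definition _ := GRing.isMonoidMorphism.Build {poly M} {mpoly K[n.+1]} unmuni unmuni_monoid.

Lemma unmuniC p : unmuni p%:P = mwiden p.
Proof. by rewrite /unmuni map_polyC hornerC. Qed.

Lemma unmuniX : unmuni 'X = 'X_ord_max.
Proof. by rewrite /unmuni map_polyX hornerX. Qed.

Lemma muniXU (i : 'I_n.+1) : muni ('X_i : {mpoly K[n.+1]}) =
  if unlift ord_max i is Some j then ('X_j)%:P else 'X.
Proof.
rewrite muniE msuppX big_seq1 mcoeffX eqxx scale1r mnm1E.
case: unliftP => [j|] ->.
  rewrite eq_sym eq_liftF expr0 -mul_polyC mulr1; congr ('X_[_])%:P.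
  apply/mnmP => k; rewrite mnmE !mnm1E -!val_eqE /= /bump.
  by rewrite leqNgt ltn_ord.
rewrite eqxx expr1 -mul_polyC (_ : [multinom _ | _ < n] = 0%MM) ?mpolyX0 ?mul1r //.
by apply/mnmP => k; rewrite mnmE mnm1E mnm0E eq_sym -val_eqE /= ltn_eqF.
Qed.

Lemma unmuni_muni : cancel (@muni n K) unmuni.
Proof.
move=> p; apply: (mpoly_hom_eq (f := unmuni \o @muni n K) (g := idfun)) => [c|i] /=.
  by rewrite muniC unmuniC mwidenC.
rewrite muniXU; case: unliftP => [j|] ->; rewrite ?unmuniX // unmuniC mwidenX mnmwiden1.
by congr ('X_[U_(_)]); apply/val_inj; rewrite /= /bump leqNgt ltn_ord.
Qed.

Lemma muni_mwiden p : muni (mwiden p : {mpoly K[n.+1]}) = p%:P.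
Proof.
apply: (mpoly_hom_eq (f := @muni n K \o @mwiden n K) (g := polyC)) => [c|i] /=.
  by rewrite mwidenC muniC.
rewrite mwidenX mnmwiden1 muniXU; case: unliftP => [j|] /(congr1 val) /=.
  by rewrite /bump leqNgt ltn_ord => /val_inj ->.
by move/eqP; rewrite ltn_eqF.
Qed.

Lemma muni_unmuni : cancel unmuni (@muni n K).
Proof.
elim/poly_ind => [|p c IH]; first by rewrite !rmorph0.
by rewrite !rmorphD !rmorphM /= IH unmuniX muniXU unlift_none unmuniC muni_mwiden.
Qed.
End MPolyUfd.

Lemma ufd_mpoly (K : fieldType) n : ufd {mpoly K[n]}.
Proof.
elim: n => [|n IH]; last exact: ufd_iso (@muni_unmuni K n) (@unmuni_muni K n) (ufd_poly IH).
move=> x x0; exists [::], x; split=> //; last by rewrite big_nil mulr1.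
have e : x = (x@_0%MM)%:MP.
  by apply/mpolyP => m; rewrite mcoeffC; have -> : m = 0%MM; [apply/mnmP => -[]|rewrite eqxx mulr1].
exists (x@_0%MM)^-1%:MP; rewrite {2}e -mpolyCM mulVf ?mpolyC1 //.
by apply: contraNneq x0 => h; rewrite e h mpolyC0.
Qed.

(** * Divisor classes *)

(** Each prime factor of w fails to divide some x in S, so it divides u and can be cancelled from
    both. *)
Lemma coprime_family (R : idomainType) (S : R -> Prop) (s0 : R) : ufd R -> S s0 -> s0 != 0 ->
  (forall p, prime_elt p -> exists2 x, S x & ~ divides p x) ->
  forall u w, (forall x, S x -> divides w (u * x)) -> divides w u.
Proof.
move=> U Ss0 s00 cop u w h.
have [w0|w0] := eqVneq w 0.
  have [z /eqP] := h _ Ss0; rewrite w0 mulr0 mulf_eq0 (negbTE s00) orbF => /eqP ->.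
  exact: divides0.
have [s [e [hs [v he] ew]]] := U w w0.
suff [z ez] : divides (\prod_(p <- s) p) u.
  by exists (z * v); rewrite {1}ez ew -[LHS]mulr1 he; ring.
have {}h x : S x -> divides (\prod_(p <- s) p) (u * x).
  by move=> /h; apply: divides_trans; rewrite ew; apply: divides_mull; apply: dividesxx.
elim: s hs u h {ew} => [|p s IH] hs u h; first by rewrite big_nil; apply: divides1.
have pp := hs p (mem_head _ _); have [p0 _ pM] := pp.
have [x Sx npx] := cop p pp.
have [|[u' eu]|//] := pM u x.
  by apply: divides_trans (h x Sx); rewrite big_cons; apply: divides_mulr; apply: dividesxx.
rewrite big_cons eu mulrC; apply: divides_mul; last exact: dividesxx.
apply: IH => [r rs|y Sy]; first by apply: hs; rewrite inE rs orbT.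
by apply: (dividesM2 p0); have := h y Sy; rewrite big_cons eu mulrCA mulrA.
Qed.

(** The factor u in the characterisation expresses that gcds commute with multiplication, the form
    needed to compute colon ideals. A prime common to S is associated to a prime factor of s0, so
    dividing such primes off terminates at a coprime family. *)
Lemma ufd_gcd (R : idomainType) (S : R -> Prop) (s0 : R) : ufd R -> S s0 -> s0 != 0 ->
  exists2 g, g != 0 & forall u w, divides w (u * g) <-> forall x, S x -> divides w (u * x).
Proof.
move=> U; move=> Ss0 s00; have [s [e [hs he es]]] := U s0 s00.
have [N eN] : exists N, size s = N by exists (size s).
elim: N S s s0 Ss0 s00 hs es eN => [|N IH] S s s0 Ss0 s00 hs es eN;
  (have [cop|ncop] := classic (forall p, prime_elt p -> exists2 x, S x & ~ divides p x);
    [by exists 1; rewrite ?oner_eq0 // => u w; rewrite mulr1; split=> [h x _|];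
       [apply: divides_mulr|apply: coprime_family Ss0 s00 cop u w]|]);
  have [p [pp pS]] : exists p, prime_elt p /\ forall x, S x -> divides p x
    by (apply: NNPP => h; apply: ncop => p pp; apply: NNPP => h';
        apply: h; exists p; split=> // x Sx; apply: NNPP => h''; apply: h'; exists x).
  have := pS _ Ss0; rewrite es (size0nil eN) big_nil mulr1 => h.
  by case: pp => _ p1 _; case: p1; apply: divides_trans h he.
have [p' p's dpp'] : exists2 p', p' \in s & divides p p'.
  by apply: (prime_elt_prod (F := id) pp); apply: (prime_unitM pp he); rewrite -es; apply: pS.
have pp' := hs p' p's; have [p'0 _ _] := pp'.
have p'S x : S x -> divides p' x by move/pS; apply: divides_trans; apply: prime_assoc.
have [s1 es1] := p'S _ Ss0.
have eP : \prod_(j <- s) j = p' * \prod_(j <- rem p' s) j by rewrite (big_rem p').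
have [|||||g g0 hg] := IH (fun x => S (p' * x)) (rem p' s) s1.
- by rewrite mulrC -es1.
- by apply: contraNneq s00 => E; rewrite es1 E mul0r.
- by move=> r /mem_rem/hs.
- by apply: (mulfI p'0); rewrite mulrCA -eP -es es1 mulrC.
- by rewrite size_rem // eN.
exists (p' * g); first by rewrite mulf_neq0.
move=> u w; rewrite mulrA hg; split=> [h x Sx|h x Sx]; last by rewrite -mulrA; apply: h.
have [y ey] := p'S x Sx; rewrite ey (_ : u * _ = u * p' * y); last by ring.
by apply: h; rewrite mulrC -ey.
Qed.

(** * Characters of GL_2(K) trivial on scalars, and semi-invariants *)

Section GL2Characters.
Variables (K : finFieldType) (f : 'M[K]_2 -> K).
Hypothesis fM : forall A B, \det A != 0 -> \det B != 0 -> f (A *m B) = f A * f B.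
Hypothesis f_neq0 : forall A, \det A != 0 -> f A != 0.
Hypothesis f_scalar : forall x : K, x != 0 -> f (mx2 x 0 0 x) = 1.
Hypothesis two_neq0 : 2%:R != 0 :> K.

Lemma det_mx2 (x y z w : K) : \det (mx2 x y z w) = x * w - y * z.
Proof. by rewrite det2E !mx2E. Qed.

Lemma mulmx_mx2 (x y z w x' y' z' w' : K) :
  mx2 x y z w *m mx2 x' y' z' w' =
  mx2 (x * x' + y * z') (x * y' + y * w') (z * x' + w * z') (z * y' + w * w').
Proof. by apply: mx2P; rewrite mulmx2E !mx2E. Qed.

Let detd (x : K) : \det (mx2 x 0 0 1) = x. Proof. by rewrite det_mx2; ring. Qed.
Let detU (y : K) : \det (mx2 1 y 0 1) != 0.
Proof. by rewrite det_mx2 mulr0 subr0 mulr1 oner_eq0. Qed.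
Let detL (y : K) : \det (mx2 1 0 y 1) != 0.
Proof. by rewrite det_mx2 mul0r subr0 mulr1 oner_eq0. Qed.
Let detW : \det (mx2 0 1 1 0) != 0 :> K.
Proof. by rewrite det_mx2 mul0r mulr1 sub0r oppr_eq0 oner_eq0. Qed.

(** Conjugation by diag(-1, 1) replaces y by -y, so both have the same image. Splitting y = y/2 +
    y/2 then gives f(y) f(y/2) = f(y/2). *)
Lemma gl2_char_upper (y : K) : f (mx2 1 y 0 1) = 1.
Proof.
have m1 : -1 != 0 :> K by rewrite oppr_eq0 oner_eq0.
have conj (z : K) : f (mx2 1 (- z) 0 1) = f (mx2 1 z 0 1).
  apply: (mulIf (f_neq0 (_ : \det (mx2 (-1) 0 0 1) != 0))); rewrite ?detd //.
  rewrite [RHS]mulrC -!fM ?detd // !mulmx_mx2; congr (f (mx2 _ _ _ _)); ring.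
have h : mx2 1 y 0 1 *m mx2 1 (- (y / 2%:R)) 0 1 = mx2 1 (y / 2%:R) 0 1.
  rewrite mulmx_mx2; congr mx2; try ring.
  by rewrite -[X in _ + X * _](divfK two_neq0); ring.
have : f (mx2 1 y 0 1 *m mx2 1 (- (y / 2%:R)) 0 1) = f (mx2 1 (y / 2%:R) 0 1) by rewrite h.
rewrite fM // conj => /(canRL (mulfK (f_neq0 (detU _)))).
by rewrite mulfV // f_neq0.
Qed.

Lemma gl2_char_lower (y : K) : f (mx2 1 0 y 1) = 1.
Proof.
apply: (mulfI (f_neq0 detW)); rewrite -fM // mulr1.
rewrite (_ : _ *m _ = mx2 1 y 0 1 *m mx2 0 1 1 0) ?fM ?gl2_char_upper ?mul1r //.
by rewrite !mulmx_mx2; congr mx2; ring.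
Qed.

(** The permutation matrix conjugates diag(k, 1) into diag(1, k), and their product is scalar. *)
Lemma gl2_char_diag_sq (k : K) : k != 0 -> f (mx2 k 0 0 1) ^+ 2 = 1.
Proof.
move=> k0; have d1 : \det (mx2 1 0 0 k) != 0 by rewrite det_mx2 mul1r mul0r subr0.
have -> : f (mx2 k 0 0 1) ^+ 2 = f (mx2 k 0 0 1) * f (mx2 1 0 0 k).
  rewrite expr2; congr (_ * _); apply: (mulIf (f_neq0 detW)).
  rewrite [LHS]mulrC -!fM ?detd //; congr f.
  by rewrite !mulmx_mx2; congr mx2; ring.
rewrite -fM ?detd // mulmx_mx2 -[RHS](f_scalar k0); congr (f (mx2 _ _ _ _)); ring.
Qed.

(** Up to elementary matrices, A is diag(x, e/x) with e its determinant, which is diag(x^2/e, 1)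
    times a scalar. Since f is 1 or -1 on such diagonal matrices, x^2/e may be replaced by e. *)
Lemma gl2_charE A : \det A != 0 -> f A = f (mx2 (\det A) 0 0 1).
Proof.
rewrite {1 2 3}(mx2_eta A); move: (A 0 0) (A 0 1) (A 1 0) (A 1 1) => x y z w.
(* If the upper-left entry is zero, adding the second row to the first makes it nonzero without
   changing f or the determinant. *)
rewrite det_mx2 => e0; wlog x0 : x y e0 / x != 0.
  move: e0; have [-> e0 h|x0 e0 h] := eqVneq x 0; last exact: h.
  have z0 : z != 0 by move: e0; apply: contraNneq => ->; rewrite mul0r mulr0 subrr.
  transitivity (f (mx2 1 1 0 1 *m mx2 0 y z w)).
    by rewrite fM ?gl2_char_upper ?mul1r // det_mx2.
  have e : z * w - (y + w) * z = 0 * w - y * z by ring.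
  rewrite mulmx_mx2 -e (_ : mx2 _ _ _ _ = mx2 z (y + w) z w).
    by apply: h; rewrite ?e.
  by congr mx2; ring.
set e := x * w - y * z in e0 *.
have d1 : \det (mx2 (x ^+ 2 / e) 0 0 1) != 0.
  by rewrite detd mulf_neq0 ?invr_eq0 ?expf_neq0.
have d2 : \det (mx2 (e / x) 0 0 (e / x)) != 0.
  by rewrite det_mx2 mul0r subr0 !mulf_neq0 ?invr_eq0.
have -> : mx2 x y z w = mx2 1 0 (z / x) 1 *m
   (mx2 (x ^+ 2 / e) 0 0 1 *m mx2 (e / x) 0 0 (e / x)) *m mx2 1 (y / x) 0 1.
  rewrite !mulmx_mx2; congr mx2.
  - by field; rewrite x0 e0.
  - by field; rewrite x0 e0.
  - by field; rewrite x0 e0.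
  - rewrite /e; field; rewrite x0 //.
rewrite !fM ?det_mulmx ?mulf_neq0 // gl2_char_upper gl2_char_lower f_scalar ?mulf_neq0 ?invr_eq0 //.
rewrite mulr1 mul1r mulr1.
have de : \det (mx2 e 0 0 1) != 0 by rewrite detd.
apply: (mulIf (f_neq0 de)); rewrite -expr2 gl2_char_diag_sq // -fM //.
rewrite -[RHS](gl2_char_diag_sq x0) [f _ ^+ 2]expr2 -fM ?detd // !mulmx_mx2; congr (f (mx2 _ _ _ _)); try ring.
by field; rewrite e0.
Qed.
End GL2Characters.

Section SemiInvariants.
Variable K : finFieldType.
Hypothesis two_neq0 : 2%:R != 0 :> K.
Local Notation T := {mpoly K[3]}.
Implicit Types (g h : T) (s : {'GL_2[K]}).

Lemma actT_scalar s (x : K) : GLval s = mx2 x 0 0 x -> forall g, actT s g = g.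
Proof.
move=> hs; have us := GLval_unitmx s.
have eX : GLval s = x%:M by rewrite hs; apply: mx2P; rewrite !mx2E !mxE /= ?mulr1n ?mulr0n.
have hl C : actT s (linf C) = linf C.
  by rewrite actT_linf {1}eX -scalar_mxC -eX -mulmxA mulmxV // mulmx1.
have hX : [/\ linf (mx2 1 0 0 0) = aT K, linf (mx2 0 0 1 0) = bT K & linf (mx2 0 1 0 0) = cT K].
  by split; rewrite linfE !mx2E /lf /aT /bT /cT ?subr0 ?rmorph0 ?rmorph1; ring.
case: hX => ha hb hc.
pose f : {rmorphism T -> T} := GRing.RMorphism.clone _ _ idfun _.
move=> g; apply: (mpoly_hom_eq (f := actT s) (g := f)) => [e|] /=; first exact: actTC.
by apply: ord3P; rewrite -?[X in actT s X = X]/(aT K) -?[X in actT s X = X]/(bT K)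
  -?[X in actT s X = X]/(cT K) -?ha -?hb -?hc hl.
Qed.

Lemma semi_inv_char g : g != 0 -> semi_inv g -> exists f : 'M[K]_2 -> K,
  [/\ forall A B, \det A != 0 -> \det B != 0 -> f (A *m B) = f A * f B,
      forall A, \det A != 0 -> f A != 0,
      forall x, x != 0 -> f (mx2 x 0 0 x) = 1
    & forall s, actT s g = (f (GLval s))%:MP * g].
Proof.
move=> g0 hg; have [chi hchi] : exists chi : {'GL_2[K]} -> K,
    forall s, chi s != 0 /\ actT s g = (chi s)%:MP * g.
  apply: (fin_all_exists (P := fun s k => k != 0 /\ actT s g = k%:MP * g)) => s.
  by have [k k0 hk] := hg s; exists k.
have chi_inj (x y : K) : x%:MP * g = y%:MP * g -> x = y by move/(mulIf g0)/mpolyP/(_ 0%MM); rewrite !mcoeffC eqxx !mulr1.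
exists (fun A => if [pick s : {'GL_2[K]} | GLval s == A] is Some s then chi s else 1).
have pickE s : [pick r : {'GL_2[K]} | GLval r == GLval s] = Some s.
  case: pickP => [r /eqP/val_inj -> //|/(_ s)]; by rewrite eqxx.
split=> [A B /GL_of_mx[s <-] /GL_of_mx[r <-]|A /GL_of_mx[s <-]|x x0|s].
- rewrite -[GLval s *m GLval r]/(GLval (s * r)%g) !pickE; apply: chi_inj.
  rewrite -(hchi _).2 -actTM (hchi r).2 rmorphM /= actTC (hchi s).2 rmorphM /=; ring.
- by rewrite pickE (hchi s).1.
- have [|s hs] := @GL_of_mx K (mx2 x 0 0 x); first by rewrite det_mx2 mul0r subr0 mulf_neq0.
  by rewrite -hs pickE; apply: chi_inj; rewrite -(hchi _).2 (actT_scalar hs) mul1r.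
by rewrite pickE (hchi s).2.
Qed.

(** Both characters are nontrivial, and a nontrivial one must send s to (-1)^n, where det s = z^n
    for a generator z of the units of K. They coincide, and their product is trivial. *)
Lemma semi_inv_mul g h : g != 0 -> h != 0 -> semi_inv g -> semi_inv h ->
  g \notin invT K -> h \notin invT K -> g * h \in invT K.
Proof.
move=> g0 h0 /(semi_inv_char g0)[f1 [fM1 fn1 fs1 fa1]] /(semi_inv_char h0)[f2 [fM2 fn2 fs2 fa2]].
move=> ng nh; have [z pz] := finField_prim_root K.
have zE (x : K) : x != 0 -> exists n, x = z ^+ n.
  move=> x0; have q1 := finNzRing_gt1 K.
  have xq : x ^+ #|K|.-1 = 1.
    by apply: (mulIf x0); rewrite mul1r -exprSr prednK ?expf_card // ltnW.
  by have [i ->] := prim_rootP pz xq; exists i.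
have q1 := finNzRing_gt1 K.
have z0 : z != 0.
  apply/eqP=> e; have := prim_expr_order pz; rewrite e expr0n.
  have [q2|] := eqVneq #|K| 2; last by case: #|K| q1 => [|[|[|m]]] // _ _ /eqP; rewrite eq_sym oner_eq0.
  by case/eqP: two_neq0; have := natr_card0 K; rewrite q2.
have dP (f : 'M[K]_2 -> K) (p : T) :
    (forall A B, \det A != 0 -> \det B != 0 -> f (A *m B) = f A * f B) ->
    (forall A, \det A != 0 -> f A != 0) -> (forall x, x != 0 -> f (mx2 x 0 0 x) = 1) ->
    (forall s, actT s p = (f (GLval s))%:MP * p) -> p \notin invT K ->
    forall n, f (mx2 (z ^+ n) 0 0 1) = (-1) ^+ n.
  move=> fM fn fs fa np.
  have d k : \det (mx2 k 0 0 1) = k :> K by rewrite det_mx2; ring.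
  have key n : f (mx2 (z ^+ n) 0 0 1) = f (mx2 z 0 0 1) ^+ n.
    elim: n => [|n IH]; first by rewrite !expr0 fs ?oner_eq0.
    rewrite exprS [RHS]exprS -IH -fM ?d ?expf_neq0 // mulmx_mx2; congr (f (mx2 _ _ _ _)); ring.
  move=> n; rewrite key; congr (_ ^+ n); have /eqP := gl2_char_diag_sq fM fn fs z0.
  rewrite sqrf_eq1 => /orP[/eqP e|/eqP //]; case/negP: np; apply/invTP=> s.
  have ds : \det (GLval s) != 0 by apply: GL_det.
  have [m em] := zE _ ds.
  by rewrite fa (gl2_charE fM fn fs two_neq0 ds) em key e expr1n mul1r.
apply/invTP=> s; have ds : \det (GLval s) != 0 by apply: GL_det.
have [n en] := zE _ ds.
rewrite rmorphM /= fa1 fa2 mulrACA -rmorphM /=.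
rewrite (gl2_charE fM1 fn1 fs1 two_neq0 ds) (gl2_charE fM2 fn2 fs2 two_neq0 ds) en.
by rewrite (dP f1 g) // (dP f2 h) // -exprD addnn -signr_odd odd_double expr0 mul1r.
Qed.
End SemiInvariants.

Section Fraction.
Local Open Scope quotient_scope.
Lemma fractionE (R : idomainType) (x : {fraction R}) :
  exists u v : R, v != 0 /\ x = u%:F / v%:F.
Proof.
elim/quotW: x => r; exists \n_r, \d_r; split; first exact: denom_ratioP.
have d0 := denom_ratioP r.
apply: (mulIf (_ : (\d_r)%:F != 0)); first by rewrite tofrac_eq0.
rewrite divfK ?tofrac_eq0 //.
rewrite [RHS]/FracField.tofrac; unlock.
rewrite -[LHS]/(FracField.mul _ _) /FracField.tofrac; unlock.
rewrite !piE; apply/eqmodP => /=.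
by rewrite FracField.equivfE /FracField.mulf !numden_Ratio ?mulr1 ?oner_eq0 // mulrC.
Qed.

End Fraction.

Lemma mutual_divides_mpoly (K : fieldType) n (f g : {mpoly K[n]}) : f != 0 ->
  divides f g -> divides g f -> exists2 k : K, k != 0 & g = k%:MP * f.
Proof.
move=> f0 [z ez] [w ew]; have wz : w * z = 1.
  by apply: (mulIf f0); rewrite mul1r -mulrA -ez -ew.
have /andP[/eqP e u] := mpoly_intro_unit wz.
by exists z@_0; rewrite -?e // -unitfE.
Qed.

Section FieldIdentities.
Variable F : fieldType.
Implicit Types a b d m n u v x : F.
Lemma frac_mul_denom u v x d : v != 0 -> d != 0 -> u / v * x = u * (d * x) / (v * d).
Proof. by move=> v0 d0; field; rewrite v0 d0. Qed.
Lemma frac_cancel x m n : m != 0 -> n != 0 -> x = x * (n / m) * (m / n).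
Proof. by move=> m0 n0; field; rewrite m0 n0. Qed.
Lemma frac_mul3 a m n u v : n != 0 -> v != 0 ->
  a * (m / n) * (u / v) = a * (u * m) / (v * n).
Proof. by move=> n0 v0; field; rewrite n0 v0. Qed.
Lemma frac_clear a d m n : m != 0 -> m * (d * (a * (n / m))) = a * (d * n).
Proof. by move=> m0; field; rewrite m0. Qed.
Lemma frac_simpl a b m n : a != 0 -> m != 0 -> n != 0 -> n / m * (b * m / (a * n)) = b / a.
Proof. by move=> a0 m0 n0; field; rewrite a0 m0 n0. Qed.
End FieldIdentities.

Section ClassGroup.
Variable K : finFieldType.
Hypothesis two_neq0 : 2%:R != 0 :> K.
Local Notation T := {mpoly K[3]}.
Local Notation B := (ringTG K).
Local Notation F := {fraction B}.
Implicit Types (g h z : T) (s : {'GL_2[K]}) (I X : F -> Prop) (u v w d : B).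

Lemma val_invT u s : actT s (val u) = val u.
Proof. exact: (invTP _ (valP u)). Qed.

(** A quotient in T of two invariants is invariant, so T^G is the intersection of T with its own
    fraction field. This turns questions on fractional ideals into divisibility in T. *)
Lemma fraction_integralP u v : v != 0 ->
  (exists a : B, u%:F / v%:F = a%:F) <-> divides (val v) (val u).
Proof.
move=> v0; have vF : v%:F != 0 by rewrite tofrac_eq0.
have v0' : val v != 0 by rewrite -val_eqE in v0.
split=> [[a e]|[z e]].
  exists (val a); rewrite -rmorphM; congr (val _); apply/eqP.
  by rewrite -tofrac_eq rmorphM /= -e divfK.
have hz : z \in invT K.
  by apply: (invT_quot (valP u) (valP v) v0'); rewrite e mulrC.
exists (RingTG hz); apply: (mulIf vF); rewrite divfK // -rmorphM; congr (_%:F).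
by apply/val_inj; rewrite rmorphM.
Qed.

(* The second argument d is a denominator of I, and g a gcd of d I in T. *)
Definition ideal_gcd I d g :=
  [/\ d != 0, g != 0, forall x, I x -> exists b : B, d%:F * x = b%:F
    & forall f h : T, divides h (f * g) <->
        forall (b : B) x, I x -> d%:F * x = b%:F -> divides h (f * val b)].

Lemma ideal_gcd_exists I : fractional_ideal I -> exists d g, ideal_gcd I d g.
Proof.
case=> I0 ID IM [x0 x00 Ix0] [d d0 hd].
pose S (f : T) := exists b x, [/\ I x, d%:F * x = b%:F & f = val b].
have [b0 eb0] := hd x0 Ix0.
have b00 : val b0 != 0.
  have : b0 != 0 by rewrite -tofrac_eq0 -eb0 mulf_neq0 ?tofrac_eq0.
  by rewrite -val_eqE.
have [|g g0 hg] := @ufd_gcd _ S (val b0) (@ufd_mpoly K 3) _ b00; first by exists b0, x0.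
exists d, g; split=> // f h; split=> [/hg H b x Ix e|H]; first by apply: H; exists b, x.
by apply/hg => _ [b [x [Ix e ->]]]; apply: H Ix e.
Qed.

Lemma ideal_gcd_divides I d g b x : ideal_gcd I d g -> I x -> d%:F * x = b%:F ->
  divides g (val b).
Proof.
move=> [_ _ _ H] Ix e; rewrite -[val b]mul1r; apply: (proj1 (H 1 g)) Ix e.
by rewrite mul1r; apply: dividesxx.
Qed.

(** The elements of d I are invariant, so [actT s g] is another gcd of them; gcds in T agree up to a
    nonzero constant. *)
Lemma ideal_gcd_semi_inv I d g : ideal_gcd I d g -> semi_inv g.
Proof.
move=> Hg; have [_ g0 _ H] := Hg.
have h1 s : divides (actT s g) g.
  rewrite -[X in divides _ X]mul1r; apply/H => b x Ix e; rewrite mul1r -(val_invT b s).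
  by apply: divides_rmorph; apply: ideal_gcd_divides Hg Ix e.
move=> s; apply: mutual_divides_mpoly => //.
by have := divides_rmorph (actT s) (h1 s^-1%g); rewrite /= actTK.
Qed.

(** Multiplication by u / v keeps I inside T^G exactly when v d divides u b for every b in d I,
    which is the gcd property with f = u. *)
Lemma colonE I d g u v : ideal_gcd I d g -> v != 0 ->
  colon I (u%:F / v%:F) <-> divides (val v * val d) (val u * g).
Proof.
move=> [d0 g0 hd H] v0; have [vF dF] : v%:F != 0 /\ d%:F != 0 by rewrite !tofrac_eq0.
have eq x b : d%:F * x = b%:F -> u%:F / v%:F * x = (u * b)%:F / (v * d)%:F.
  by move=> e; rewrite tofracM -e tofracM; apply: (frac_mul_denom _ _ vF dF).
have vd0 : v * d != 0 by rewrite mulf_neq0.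
split=> [h|/H h x Ix].
  apply/H => b x Ix e; have [a ea] := h x Ix.
  have /(fraction_integralP _ vd0) : exists a : B, (u * b)%:F / (v * d)%:F = a%:F.
    by exists a; rewrite -(eq x b).
  by rewrite !rmorphM.
have [b e] := hd x Ix; rewrite (eq x b) //; apply/(fraction_integralP _ vd0).
by rewrite !rmorphM; apply: h Ix e.
Qed.

Lemma sub_colon2 I x : I x -> colon (colon I) x.
Proof. by move=> Ix y /(_ x Ix)[a e]; exists a; rewrite mulrC. Qed.

(** With g invariant, d / g belongs to the colon of I, and the double colon is generated by g /
    d. *)
Lemma invT_principal I d g : ideal_gcd I d g -> g \in invT K -> principal (colon (colon I)).
Proof.
move=> H hg; pose g' : B := RingTG hg.
have [d0 g0 _ _] := H; have g'0 : g' != 0 by rewrite -val_eqE.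
have [gF dF] : g'%:F != 0 /\ d%:F != 0 by rewrite !tofrac_eq0.
have c1 : colon I (d%:F / g'%:F).
  by apply/(colonE _ H g'0); rewrite /= mulrC; apply: dividesxx.
exists (g'%:F / d%:F); first exact: mulf_neq0 gF (invr_neq0 dF).
move=> x; split=> [hx|[a ->] y hy].
  have [a ea] := hx _ c1; exists a; rewrite -ea; apply: (frac_cancel _ gF dF).
have [u [v [v0 ey]]] := fractionE y; rewrite ey in hy *.
have [z ez] := proj1 (colonE _ H v0) hy.
have vF : v%:F != 0 by rewrite tofrac_eq0.
have vd0 : v * d != 0 by rewrite mulf_neq0.
have -> : a%:F * (g'%:F / d%:F) * (u%:F / v%:F) = (a * (u * g'))%:F / (v * d)%:F.
  by rewrite 3!tofracM; apply: (frac_mul3 _ _ _ dF vF).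
apply/(fraction_integralP _ vd0); rewrite !rmorphM /= ez.
by apply: divides_mull; apply: divides_mull; apply: dividesxx.
Qed.

Section TwoSemiInvariants.
Variables E J : T.
Hypotheses (E0 : E != 0) (J0 : J != 0) (hE : semi_inv E) (hJ : semi_inv J).
Hypotheses (nE : E \notin invT K) (nJ : J \notin invT K).
Hypothesis cop : forall p, prime_elt p -> divides p E -> divides p J -> False.

(** In the application the letter [J] of this section stands for the Jacobian divided by E, which
    shares no prime with E. *)
Lemma coprime_EJ f h : divides h (f * E) -> divides h (f * J) -> divides h f.
Proof.
move=> dE dJ; apply: (@coprime_family _ (fun x => x = E \/ x = J) E (@ufd_mpoly K 3)) => //.
- by left.
- move=> p pp; have [pE|npE] := classic (divides p E); last by exists E => //; left.
  by exists J; [right|move=> pJ; apply: cop pp pE pJ].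
by move=> x [] ->.
Qed.

Lemma invT_const (k : K) : k%:MP \in invT K.
Proof. by apply/invTP => s; rewrite actTC. Qed.

(* If h is a noninvariant semi-invariant not divisible by z, then h z / z^2 lies
   in the field of fractions of T^G but not in T^G, and it separates the double
   dual of I from a principal ideal. *)
Lemma principal_invT I d g : ideal_gcd I d g -> principal (colon (colon I)) -> g \in invT K.
Proof.
move=> H [x x0 hx]; have [d0 g0 hd Hd] := H.
have [n [m [m0 ex]]] := fractionE x.
have [mF dF] : m%:F != 0 /\ d%:F != 0 by rewrite !tofrac_eq0.
have n0 : n != 0 by apply: contraNneq x0 => e; rewrite ex e rmorph0 mul0r.
have nF : n%:F != 0 by rewrite tofrac_eq0.
have [z ez] : divides (val d * val n) (val m * g).
  apply/Hd => b y Iy e; have [a ea] := proj1 (hx y) (sub_colon2 Iy).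
  exists (val a); rewrite -!rmorphM; congr (val _); apply/eqP; rewrite -tofrac_eq; apply/eqP.
  by rewrite 3!tofracM -e ea ex; apply: (frac_clear _ _ _ mF).
have [vm0 [vd0 vn0]] : val m != 0 /\ (val d != 0 /\ val n != 0).
  by rewrite -val_eqE in m0; rewrite -val_eqE in d0; rewrite -val_eqE in n0.
have [hz|nz] := boolP (z \in invT K).
  apply: (invT_quot (f := z * (val d * val n)) _ (valP m) vm0); last by rewrite ez.
  by apply/invTP=> s; rewrite !rmorphM /= (invTP _ hz) !val_invT.
have z0 : z != 0 by apply: contraNneq nz => ->; rewrite -(mpolyC0 3 K) invT_const.
have sz : semi_inv z.
  move=> s; have [k k0 ek] := ideal_gcd_semi_inv H s; exists k => //.
  have dn0 : val d * val n != 0 by rewrite mulf_neq0.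
  apply: (mulIf dn0); rewrite -[RHS]mulrA -ez [RHS]mulrCA -ek.
  transitivity (actT s (val m * g)); last by rewrite rmorphM /= val_invT.
  by rewrite ez !rmorphM /= !val_invT.
have [h [h0 sh nh nzh]] : exists h, [/\ h != 0, semi_inv h, h \notin invT K & ~ divides z h].
  have [zE|nzE] := classic (divides z E); last by exists E.
  exists J; split=> // zJ; case/negP: nz.
  have z1 : divides z 1 by apply: coprime_EJ; rewrite mul1r.
  have [k k0 ->] := mutual_divides_mpoly (oner_neq0 _) (divides1 z) z1.
  by rewrite mulr1 invT_const.
pose al : B := RingTG (semi_inv_mul two_neq0 z0 z0 sz sz nz nz).
pose be : B := RingTG (semi_inv_mul two_neq0 h0 z0 sh sz nh nz).
have al0 : al != 0 by rewrite -val_eqE /= mulf_neq0.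
have aF : al%:F != 0 by rewrite tofrac_eq0.
have cy : colon I ((be * m)%:F / (al * n)%:F).
  apply/(colonE _ H (mulf_neq0 al0 n0)).
  rewrite !rmorphM /=; rewrite -[X in divides _ X]mulrA ez; exists h.
  by rewrite -[ringTG_val n]/(val n) -[ringTG_val d]/(val d); ring.
have [a ea] := proj2 (hx x) (ex_intro _ 1 (esym (mul1r _))) _ cy.
have /(fraction_integralP _ al0)/= : exists a : B, be%:F / al%:F = a%:F.
  by exists a; rewrite -ea ex 2!tofracM; rewrite (frac_simpl _ aF mF nF).
by rewrite [h * z]mulrC => /(dividesM2 z0)/nzh.
Qed.

(** The free factor f in the gcd property absorbs an element of one ideal while the property is
    applied to the other. *)
Lemma ideal_gcd_prod I X d d' g g' : ideal_gcd I d g -> ideal_gcd X d' g' ->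
  ideal_gcd (prod_ideal I X) (d * d') (g * g').
Proof.
move=> [d0 g0 hd H] [d0' g0' hd' H']; split; rewrite ?mulf_neq0 //.
  move=> x [k [y [z [hy hz ->]]]].
  have [b hb] : exists b : 'I_k -> B, forall i, d%:F * y i = (b i)%:F.
    by apply: (fin_all_exists (P := fun i b => d%:F * y i = b%:F)) => i; apply: hd.
  have [b' hb'] : exists b : 'I_k -> B, forall i, d'%:F * z i = (b i)%:F.
    by apply: (fin_all_exists (P := fun i b => d'%:F * z i = b%:F)) => i; apply: hd'.
  exists (\sum_(i < k) b i * b' i); rewrite rmorph_sum mulr_sumr; apply: eq_bigr => i _ /=.
  by rewrite 2!tofracM -hb -hb' mulrACA.
have [dF dF'] : d%:F != 0 /\ d'%:F != 0 by rewrite !tofrac_eq0.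
move=> f h; split=> [hfg b x [k [y [z [hy hz ->]]]] e|h0].
  have [c hc] : exists c : 'I_k -> B, forall i, d%:F * y i = (c i)%:F.
    by apply: (fin_all_exists (P := fun i b => d%:F * y i = b%:F)) => i; apply: hd.
  have [c' hc'] : exists c : 'I_k -> B, forall i, d'%:F * z i = (c i)%:F.
    by apply: (fin_all_exists (P := fun i b => d'%:F * z i = b%:F)) => i; apply: hd'.
  have -> : b = \sum_(i < k) c i * c' i.
    apply/eqP; rewrite -tofrac_eq -e rmorph_sum mulr_sumr; apply/eqP; apply: eq_bigr => i _ /=.
    by rewrite 2!tofracM -hc -hc' mulrACA.
  rewrite rmorph_sum mulr_sumr.
  apply: (big_ind (fun x => divides h x)) => [|x' y'|i _]; [exact: divides0|exact: dividesD|].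
  rewrite rmorphM mulrA; apply: (proj1 (H' (f * val (c i)) h)) (hz i) (hc' i).
  rewrite mulrAC; apply: (proj1 (H (f * g') h)) (hy i) (hc i).
  by rewrite mulrAC -mulrA.
rewrite mulrA; apply/H' => b' z Xz e'; rewrite mulrAC; apply/H => b y Iy e.
have -> : f * val b' * val b = f * val (b * b') by rewrite rmorphM -mulrA [val b' * _]mulrC.
apply: (h0 (b * b') (y * z)); first by exists 1%N, (fun=> y), (fun=> z); split=> //; rewrite big_ord1.
by rewrite 2!tofracM -e -e' mulrACA.
Qed.

Let EE : E * E \in invT K := semi_inv_mul two_neq0 E0 E0 hE hE nE nE.
Let EJ : E * J \in invT K := semi_inv_mul two_neq0 E0 J0 hE hJ nE nJ.
Definition multiples_E (x : F) := exists2 b : B, x = b%:F & divides E (val b).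

Lemma multiples_fractional : fractional_ideal multiples_E.
Proof.
split.
- by exists 0; [rewrite tofrac0|rewrite rmorph0; apply: divides0].
- move=> _ _ [b -> hb] [c -> hc]; exists (b + c); first by rewrite tofracD.
  by rewrite rmorphD; apply: dividesD.
- move=> a _ [b -> hb]; exists (a * b); first by rewrite tofracM.
  by rewrite rmorphM; apply: divides_mull.
- exists (RingTG EE)%:F; first by rewrite tofrac_eq0 -val_eqE mulf_neq0.
  by exists (RingTG EE) => //; apply: divides_mull; apply: dividesxx.
by exists 1; [apply: oner_neq0|move=> x [b -> _]; exists b; rewrite tofrac1 mul1r].
Qed.

(** E and J are not invariant themselves, but E E and E J are, and their gcd is E by coprimality. *)
Lemma multiples_gcd : ideal_gcd multiples_E 1 E.
Proof.
split; [exact: oner_neq0|exact: E0|by move=> x [b -> _]; exists b; rewrite tofrac1 mul1r|].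
move=> f h; split=> [d b _ [b' -> hb']|H].
  rewrite tofrac1 mul1r => /eqP; rewrite tofrac_eq => /eqP <-.
  by case: hb' => w ->; rewrite mulrCA; apply: divides_mull.
have M1 (b : B) : divides E (val b) -> divides h (f * val b).
  by move=> hb; apply: (H b b%:F); [exists b|rewrite tofrac1 mul1r].
apply: coprime_EJ; rewrite -mulrA.
  by apply: (M1 (RingTG EE)); apply: divides_mull; apply: dividesxx.
by apply: (M1 (RingTG EJ)); apply: divides_mulr; apply: dividesxx.
Qed.

(** The colon contains 1 and E J / E E. The first makes an element b of the double colon integral;
    the second gives that E divides b J, hence b. *)
Lemma multiples_divisorial : divisorial multiples_E.
Proof.
split=> [|x]; first exact: multiples_fractional.
split=> [|hx]; first exact: sub_colon2.
have ee0 : RingTG EE != 0 by rewrite -val_eqE mulf_neq0.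
have c1 : colon multiples_E 1 by move=> y [b -> _]; exists b; rewrite mul1r.
have [b eb] := hx _ c1; rewrite mulr1 in eb; rewrite eb in hx *; exists b => //.
have c2 : colon multiples_E ((RingTG EJ)%:F / (RingTG EE)%:F).
  apply/(colonE _ multiples_gcd ee0); rewrite rmorph1 mulr1 /=.
  by exists J; ring.
have [a ea] := hx _ c2.
have /(fraction_integralP _ ee0) : exists a : B, (b * RingTG EJ)%:F / (RingTG EE)%:F = a%:F.
  by exists a; rewrite -ea tofracM mulrA.
rewrite rmorphM /= mulrCA => /(dividesM2 E0) d.
by apply: coprime_EJ => //; apply: divides_mull; apply: dividesxx.
Qed.

(** The class is 0 or 1 according to whether the ideal is principal, equivalently whether its gcd is
    invariant. Additivity holds because the gcd is multiplicative and the product of two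
    noninvariant semi-invariants is invariant. *)
Lemma class_group_Z2 : class_group_iso B 'Z_2.
Proof.
pose cl I : 'Z_2 := if excluded_middle_informative (principal I) then 0 else 1.
have clP I : cl I = 0 <-> principal I by rewrite /cl; case: excluded_middle_informative.
have clN I : ~ principal I -> cl I = 1 by rewrite /cl; case: excluded_middle_informative.
have div2 I : divisorial I -> principal I -> principal (colon (colon I)).
  by case=> _ hI [x x0 hx]; exists x => // y; rewrite -hI.
have div2' I : divisorial I -> principal (colon (colon I)) -> principal I.
  by case=> _ hI [x x0 hx]; exists x => // y; rewrite hI.
exists cl; split=> [I X hI hX|i|I _]; last exact: clP.
- have [d [g Hg]] := ideal_gcd_exists hI.1; have [d' [g' Hg']] := ideal_gcd_exists hX.1.
  have Hp := ideal_gcd_prod Hg Hg'.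
  have key Y e k : divisorial Y -> ideal_gcd Y e k -> (k \in invT K -> principal Y) /\
      (principal Y -> k \in invT K).
    move=> hY HY; split=> [hk|pY]; first by apply: div2' => //; apply: invT_principal HY hk.
    by apply: principal_invT HY (div2 _ hY pY).
  have [kI kI'] := key _ _ _ hI Hg; have [kX kX'] := key _ _ _ hX Hg'.
  have [_ g0 _ _] := Hg; have [_ g0' _ _] := Hg'.
  have pP : g * g' \in invT K -> cl (div_prod I X) = 0.
    by move=> h; apply/clP; apply: invT_principal Hp h.
  have pN : g * g' \notin invT K -> cl (div_prod I X) = 1.
    by move=> /negP h; apply: clN => /(principal_invT Hp).
  have [hg|ng] := boolP (g \in invT K); have [hg'|ng'] := boolP (g' \in invT K).
  + rewrite pP ?(proj2 (clP I)) ?(proj2 (clP X)) ?addr0 //; [exact: kX|exact: kI|].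
    by apply/invTP => s; rewrite rmorphM /= (invTP _ hg) (invTP _ hg').
  + rewrite pN ?(proj2 (clP I)) ?(clN X) ?add0r //; [by move/kX'; apply/negP|exact: kI|].
    by apply: contra ng' => h; apply: (invT_quot h hg g0).
  + rewrite pN ?(proj2 (clP X)) ?(clN I) ?addr0 //; [by move/kI'; apply/negP|exact: kX|].
    by apply: contra ng => h; apply: (invT_quot h hg' g0'); rewrite mulrC.
  rewrite pP ?(clN X) ?(clN I) //; [by apply/val_inj|by move/kI'; apply/negP|by move/kX'; apply/negP|].
  by apply: semi_inv_mul => //; [apply: ideal_gcd_semi_inv Hg|apply: ideal_gcd_semi_inv Hg'].
have [->|i0] := eqVneq i 0.
  pose U (x : F) := exists a : B, x = a%:F.
  have cU1 : colon U 1 by move=> y [b ->]; exists b; rewrite mul1r.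
  exists U; last by apply/clP; exists 1; [apply: oner_neq0|move=> y; split=> -[a ->]; exists a; rewrite mulr1].
  split=> [|x]; last by split=> [|/(_ 1 cU1)[b]]; [apply: sub_colon2|rewrite mulr1 => ->; exists b].
  split.
  - by exists 0; rewrite tofrac0.
  - by move=> _ _ [b ->] [c ->]; exists (b + c); rewrite tofracD.
  - by move=> a _ [b ->]; exists (a * b); rewrite tofracM.
  - by exists 1; [apply: oner_neq0|exists 1; rewrite tofrac1].
  by exists 1; [apply: oner_neq0|move=> x [b ->]; exists b; rewrite tofrac1 mul1r].
exists multiples_E; first exact: multiples_divisorial.
rewrite clN; first by case: i i0 => -[|[|//]] ? // _; apply/val_inj.
move=> /(div2 _ multiples_divisorial)/(principal_invT multiples_gcd).
exact/negP.
Qed.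
End TwoSemiInvariants.
End ClassGroup.

(** * The map from S to T *)

Section FourVariables.
Variable K : finFieldType.
Local Notation S := {mpoly K[4]}.
Local Notation T := {mpoly K[3]}.
Implicit Types s : {'GL_2[K]}.

Definition genS : 'M[S]_2 := mx2 (aS K) (bS K) (cS K) (dS K).

Lemma ord4P (P : 'I_4 -> Prop) :
  P (@Ordinal 4 0 isT) -> P (@Ordinal 4 1 isT) -> P (@Ordinal 4 2 isT) ->
  P (@Ordinal 4 3 isT) -> forall i, P i.
Proof.
move=> h0 h1 h2 h3 [[|[|[|[|//]]]] hi].
- by rewrite (bool_irrelevance hi isT).
- by rewrite (bool_irrelevance hi isT).
- by rewrite (bool_irrelevance hi isT).
by rewrite (bool_irrelevance hi isT).
Qed.

Lemma tuple4E (A : Type) (x y z t : A) :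
  (tnth [tuple x; y; z; t] (@Ordinal 4 0 isT) = x) *
  (tnth [tuple x; y; z; t] (@Ordinal 4 1 isT) = y) *
  (tnth [tuple x; y; z; t] (@Ordinal 4 2 isT) = z) *
  (tnth [tuple x; y; z; t] (@Ordinal 4 3 isT) = t).
Proof. by []. Qed.

HB.instance Definition _ := GRing.LRMorphism.copy (@piST K) (comp_mpoly _).

(** Sends X to the traceless part of the generic 2 x 2 matrix. Since the subtracted scalar matrix is
    invariant, this is an equivariant section of [piST] when 2 is invertible. *)
Definition secTS (p : T) : S :=
  p \mPo [tuple (2%:R^-1)%:MP * (aS K - dS K); bS K; cS K].
HB.instance Definition _ := GRing.LRMorphism.copy secTS (comp_mpoly _).

Lemma piST_vars : (piST (aS K) = aT K) * (piST (bS K) = bT K) * (piST (cS K) = cT K)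
  * (piST (dS K) = - aT K).
Proof. by rewrite /piST /aS /bS /cS /dS !tnth_comp_mpolyXU !tuple4E. Qed.

Lemma actS_vars s : (actS s (aS K) = conj_gen s genS 0 0) * (actS s (bS K) = conj_gen s genS 0 1)
  * (actS s (cS K) = conj_gen s genS 1 0) * (actS s (dS K) = conj_gen s genS 1 1).
Proof. by rewrite /actS /aS /bS /cS /dS !tnth_comp_mpolyXU !tuple4E. Qed.

Lemma map_conj_gen n m s (f : {rmorphism {mpoly K[n]} -> {mpoly K[m]}}) M :
  (forall c, f c%:MP = c%:MP) -> map_mx f (conj_gen s M) = conj_gen s (map_mx f M).
Proof.
move=> fC; rewrite /conj_gen !map_mxM -!map_mx_comp.
by congr (_ *m _ *m _); apply: eq_map_mx => c /=; rewrite fC.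
Qed.

Lemma actS_genS s : map_mx (actS s) genS = conj_gen s genS.
Proof. by apply: mx2P; rewrite mxE mx2E actS_vars. Qed.

Lemma piST_genS : map_mx (@piST K) genS = genX K.
Proof. by apply: mx2P; rewrite mxE !mx2E piST_vars. Qed.

Lemma piSTC c : piST (c%:MP : S) = c%:MP.
Proof. exact: comp_mpolyC. Qed.

Lemma piST_act s p : piST (actS s p) = actT s (piST p).
Proof.
pose f : {rmorphism S -> T} := GRing.RMorphism.clone _ _ (@piST K \o actS s) _.
pose g : {rmorphism S -> T} := GRing.RMorphism.clone _ _ (actT s \o @piST K) _.
apply: (mpoly_hom_eq (f := f) (g := g)) => [c|] /=.
  by rewrite /actS comp_mpolyC !piSTC actTC.
have H i j : piST (actS s (genS i j)) = actT s (piST (genS i j)).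
  have -> : actS s (genS i j) = conj_gen s genS i j by rewrite -actS_genS [RHS]mxE.
  have -> : piST (genS i j) = genX K i j by rewrite -piST_genS [RHS]mxE.
  have -> : actT s (genX K i j) = conj_gen s (genX K) i j by rewrite -actT_genX [RHS]mxE.
  by rewrite -piST_genS -(map_conj_gen s _ piSTC) [RHS]mxE.
apply: ord4P; [have := H 0 0|have := H 0 1|have := H 1 0|have := H 1 1]; by rewrite !mx2E.
Qed.

Hypothesis two_neq0 : 2%:R != 0 :> K.

Lemma secTS_vars : (secTS (aT K) = (2%:R^-1)%:MP * (aS K - dS K)) * (secTS (bT K) = bS K)
  * (secTS (cT K) = cS K).
Proof. by rewrite /secTS /aT /bT /cT !tnth_comp_mpolyXU !tuple3E. Qed.

Lemma secTSC c : secTS (c%:MP : T) = c%:MP.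
Proof. exact: comp_mpolyC. Qed.

Let halfK (x : S) : (2%:R^-1)%:MP * (x *+ 2) = x.
Proof.
by rewrite mulrnAr -mulrnAl -rmorphMn /= -[_ *+ 2]mulr_natr mulVf // rmorph1 mul1r.
Qed.

Lemma piST_sec p : piST (secTS p) = p.
Proof.
pose f : {rmorphism T -> T} := GRing.RMorphism.clone _ _ (@piST K \o secTS) _.
pose g : {rmorphism T -> T} := GRing.RMorphism.clone _ _ idfun _.
apply: (mpoly_hom_eq (f := f) (g := g)) => [c|] /=; first by rewrite secTSC piSTC.
apply: ord3P; rewrite -/(aT K) -/(bT K) -/(cT K) secTS_vars ?piST_vars //.
rewrite rmorphM rmorphB /= piSTC !piST_vars opprK -mulr2n.
by rewrite mulrnAr -mulrnAl -rmorphMn /= -[_ *+ 2]mulr_natr mulVf // rmorph1 mul1r.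
Qed.

Lemma secTS_genX : map_mx secTS (genX K) = genS - ((2%:R^-1)%:MP * \tr genS)%:M.
Proof.
have e (x y : S) : (2%:R^-1)%:MP * (x - y) = x - (2%:R^-1)%:MP * (x + y).
  by rewrite -{2}[x]halfK; ring.
have e' (x y : S) : - ((2%:R^-1)%:MP * (x - y)) = y - (2%:R^-1)%:MP * (x + y).
  by rewrite -{2}[y]halfK; ring.
have sub_scalar (x y z w u : S) : mx2 x y z w - u%:M = mx2 (x - u) y z (w - u).
  by apply: mx2P; rewrite !mxE /= ?mulr1n ?mulr0n ?subr0.
rewrite /genS mxtrace2E !mx2E sub_scalar.
apply: mx2P; rewrite [LHS]mxE !mx2E ?rmorphN /= !secTS_vars //.
Qed.

Lemma conj_gen_scalar n s (x : {mpoly K[n]}) : conj_gen s x%:M = x%:M.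
Proof.
rewrite /conj_gen scalar_mxC -mulmxA -map_mxM mulVmx ?GLval_unitmx //.
by rewrite map_mx1 mulmx1.
Qed.

Lemma conj_genB n s (M N : 'M[{mpoly K[n]}]_2) : conj_gen s (M - N) = conj_gen s M - conj_gen s N.
Proof. by rewrite /conj_gen mulmxBr mulmxBl. Qed.

Lemma secTS_act s p : secTS (actT s p) = actS s (secTS p).
Proof.
pose f : {rmorphism T -> S} := GRing.RMorphism.clone _ _ (secTS \o actT s) _.
pose g : {rmorphism T -> S} := GRing.RMorphism.clone _ _ (actS s \o secTS) _.
have actSC c : actS s c%:MP = c%:MP by rewrite /actS comp_mpolyC.
have trS : actS s (\tr genS) = \tr genS.
  rewrite -trace_map_mx /= actS_genS /conj_gen mxtrace_mulC mulmxA -map_mxM mulmxV ?GLval_unitmx //.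
  by rewrite map_mx1 mul1mx.
have trS' : actS s ((2%:R^-1)%:MP * \tr genS) = (2%:R^-1)%:MP * \tr genS.
  by rewrite [LHS]rmorphM; congr (_ * _); [exact: actSC|exact: trS].
apply: (mpoly_hom_eq (f := f) (g := g)) => [c|] /=; first by rewrite actTC !secTSC actSC.
have H i j : secTS (actT s (genX K i j)) = actS s (secTS (genX K i j)).
  have -> : actT s (genX K i j) = conj_gen s (genX K) i j by rewrite -actT_genX [RHS]mxE.
  transitivity (map_mx secTS (conj_gen s (genX K)) i j); first by rewrite [RHS]mxE.
  transitivity (map_mx (actS s) (map_mx secTS (genX K)) i j); last by rewrite ![map_mx _ _ _ _]mxE.
  rewrite (map_conj_gen s _ secTSC) secTS_genX conj_genB conj_gen_scalar -actS_genS map_mxB; congr (fun_of_matrix (_ - _) i j).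
  by rewrite map_scalar_mx; congr (_%:M); rewrite -[LHS]trS'.
apply: ord3P; [have := H 0 0|have := H 0 1|have := H 1 0]; by rewrite !mx2E.
Qed.

Lemma invSP (p : S) : reflect (forall s, actS s p = p) (p \in invS K).
Proof. by apply: (iffP forallP) => h s; apply/eqP. Qed.

Lemma piST_inv p : p \in invS K -> piST p \in invT K.
Proof. by move/invSP=> h; apply/invTP=> s; rewrite -piST_act h. Qed.

Lemma invT_piST x : x \in invT K <-> exists2 y, y \in invS K & x = piST y.
Proof.
split=> [/invTP h|[y hy ->]]; last exact: piST_inv.
exists (secTS x); last by rewrite piST_sec.
by apply/invSP=> s; rewrite -secTS_act h.
Qed.
End FourVariables.

(** * Structure of the invariant ring *)

Section OddCase.
Variables (K : finFieldType) (tau delta : K).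
Hypothesis noroot : forall x, x ^+ 2 - tau * x + delta != 0.
Variables (L : finFieldType) (io : {rmorphism K -> L}) (lam : L).
Hypothesis hlam : lam ^+ 2 - io tau * lam + io delta = 0.
Hypothesis cardL : #|L| = (#|K| ^ 2)%N.
Hypothesis oddq : odd #|K|.
Local Notation T := {mpoly K[3]}.
Local Notation q := #|K|.
Local Notation P1 := (steenrodP1 (detT K)).
Local Notation p4 := (piST (f4 tau delta)).
Local Notation J := (jac (detT K) P1 p4).
Local Notation th := [tuple detT K; P1; p4].
Local Notation sub := (in_subalg th).
Local Notation M4 := {mpoly K[4]}.
Local Notation E := (Eprod tau delta).

Lemma l0_nonisotropic : inl (- tau, - delta) \in nonisotropic K.
Proof. by rewrite inE /= sqrrN mulNrn; apply: disc_neq0 noroot hlam. Qed.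

Lemma Eprod_divides_jac4 : divides E J.
Proof.
apply: (semi_inv_Eprod noroot (semi_inv_inv (jac4_inv noroot))).
exact: (odd_degree_plane oddq (jac4_inv noroot) (dhomog_jac4 tau delta) (oddX2 oddq) l0_nonisotropic).
Qed.

Lemma prime_divides_Eprod p : prime_elt p -> divides p E ->
  exists2 n, n \in Nset tau delta & divides p (lin n).
Proof.
move=> pp; rewrite /Eprod -big_enum => /(prime_elt_prod pp)[n hn d].
by exists n => //; rewrite mem_enum in hn.
Qed.

(** An invariant E of odd degree would be divisible by a, although every factor of E has b with
    coefficient 1. In even degree the reflection would fix E, whereas it negates it. *)
Lemma Eprod_not_inv : E \notin invT K.
Proof.
apply/negP=> hE; have hd := dhomog_Eprod tau delta.
have [od|ev] := boolP (odd #|Nset tau delta|).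
  have hz : inr 0 \in nonisotropic K by rewrite inE.
  have := odd_degree_plane oddq hE hd od hz.
  move=> /(prime_divides_Eprod (prime_plane (inr 0)))[n _ d].
  by have := @plane_inj K (inr 0) (inl n) d.
have [s [s1 s2]] := divides_refl noroot hlam oddq E.
have := Eprod_refl noroot hlam oddq s1 s2.
rewrite (invTP _ hE) (negT_homog hd) -signr_odd (negbTE ev) expr0 mul1r => /eqP.
rewrite -addr_eq0 -mulr2n -mulr_natl mulf_eq0 (negbTE (Eprod_neq0 tau delta)) orbF.
by rewrite -(rmorph_nat (@mpolyC 3 K)) mpolyC_eq0 (negbTE (odd_two_neq0 oddq)).
Qed.

(** J is a constant times a product of pairwise nonassociated planes, so no factor of E occurs in it
    twice. *)
Lemma jac4_squarefree n z : n \in Nset tau delta -> J = z * E -> ~ divides (lin n) z.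
Proof.
move=> hn ez [w ew]; have [k k0 ek] := jac4E noroot hlam oddq.
have pn := prime_plane (inl n : (K * K) + K); have n0 : lin n != 0 := prime_elt_neq0 pn.
have eE : E = lin n * \prod_(m in Nset tau delta | m != n) lin m by rewrite /Eprod (bigD1 n).
have hk : planes_prod K = k^-1%:MP * J by rewrite ek mulrA -rmorphM mulVf //= rmorph1 mul1r.
have ni : inl n \in nonisotropic K.
  have : divides (plane (inl n)) (planes_prod K).
    by rewrite hk ez ew; apply: divides_mull; apply: divides_mulr; apply: divides_mull; apply: dividesxx.
  rewrite /planes_prod -big_enum => /(prime_elt_prod pn)[j hj /plane_inj ->].
  by rewrite mem_enum in hj.
have : divides (plane (inl n)) (\prod_(j in nonisotropic K | j != inl n) plane j).
  apply: (dividesM2 n0); have := hk; rewrite /planes_prod (bigD1 (inl n)) //= => ->.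
  rewrite ez ew eE; apply: divides_mull; exists (w * \prod_(m in Nset tau delta | m != n) lin m).
  by rewrite /=; ring.
rewrite -big_enum_cond -big_filter => /(prime_elt_prod pn)[j hj /plane_inj ej].
by move: hj; rewrite mem_filter ej eqxx.
Qed.

Lemma odd_class_group : class_group_iso (ringTG K) 'Z_2.
Proof.
have [z ez] := Eprod_divides_jac4.
have J0 : J != 0 := jac_neq0 noroot hlam oddq.
have E0 := Eprod_neq0 tau delta.
have nE := Eprod_not_inv.
have z0 : z != 0 by apply: contraNneq J0 => e; rewrite ez e mul0r.
apply: (@class_group_Z2 K (odd_two_neq0 oddq) E z) => //.
- exact: (semi_inv_Eprod_self noroot hlam).
- move=> s; have := invTP _ (jac4_inv noroot) s; rewrite {1}ez rmorphM /=.
  have [k k0 ->] := semi_inv_Eprod_self noroot hlam s.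
  rewrite ez mulrA => /(mulIf E0) e.
  by exists k^-1; rewrite ?invr_eq0 // -[X in _ = _ * X]e mulrCA -rmorphM mulVf // rmorph1 mulr1.
- apply: contra nE => hz.
  by apply: (invT_quot (jac4_inv noroot) hz z0).
move=> p pp /(prime_divides_Eprod pp)[n hn pn].
move=> pz; apply: (jac4_squarefree hn ez); apply: divides_trans pz.
by apply: (prime_assoc pp) => //; apply: prime_lin.
Qed.

Lemma divides_l0_p4 : divides (lin (- tau, - delta)) p4.
Proof.
have [u u0 ->] := piST_f4_square noroot hlam.
rewrite expr2 mulrA; apply: divides_mull; rewrite /Eprod (bigD1 (- tau, - delta)) ?l0_Nset //=.
by apply: divides_mulr; apply: dividesxx.
Qed.

Lemma odd_alg_indep : alg_indep th.
Proof.
apply: (alg_indep_theta noroot hlam) divides_l0_p4.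
have [u u0 ->] := piST_f4_square noroot hlam.
by rewrite mulf_neq0 ?mpolyC_eq0 // expf_neq0 // Eprod_neq0.
Qed.

Definition oddw (i : 'I_3) : nat := nth 0%N [:: 2; q + 1; q ^ 2 - q]%N i.
Definition oddw4 (i : 'I_4) : nat := nth 0%N [:: 2; q + 1; q ^ 2 - q; q ^ 2]%N i.

Lemma oddw_gt0 i : (0 < oddw i)%N.
Proof.
have q1 := finNzRing_gt1 K; move: i; apply: ord3P; rewrite /oddw //= ?addn1 //.
by rewrite subn_gt0 -[X in (X < _)%N](expn1 q) ltn_exp2l.
Qed.

Lemma th_homog i : tnth th i \is (oddw i).-homog.
Proof.
move: i; apply: ord3P; rewrite tuple3E /oddw /=.
- exact: dhomog_detT.
- exact: dhomog_P1.
exact: dhomog_piST_f4.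
Qed.

Definition ext (p : T) : M4 := p \mPo [tuple 'X_(@Ordinal 4 0 isT); 'X_(@Ordinal 4 1 isT); 'X_(@Ordinal 4 2 isT)].
HB.instance Definition _ := GRing.LRMorphism.copy ext (comp_mpoly _).
Local Notation X3 := ('X_(@Ordinal 4 3 isT) : M4).

Lemma ext_comp x y z w p : ext p \mPo [tuple x; y; z; w] = p \mPo [tuple x; y; z] :> T.
Proof.
rewrite /ext comp_mpolyA; congr (_ \mPo _); apply: eq_from_tnth => i; rewrite tnth_map.
by move: i; apply: ord3P; rewrite !tuple3E tnth_comp_mpolyXU tuple4E.
Qed.

Lemma dhomog_ext d p : p \is d.-homog for (wdeg oddw) -> ext p \is d.-homog for (wdeg oddw4).
Proof.
move=> /dhomogP h; rewrite /ext comp_mpolyEX; rewrite big_seq rpred_sum // => m hm.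
apply: dhomogZ; rewrite comp_mpolyX -(h m hm).
have X (i : 'I_4) n : ('X_i ^+ n : M4) \is (oddw4 i * n).-homog for (wdeg oddw4).
  by apply: dhomogMn; rewrite dhomogX /= wdeg1.
rewrite /= /wdeg !big_ord_recl !big_ord0 mulr1 addn0.
by apply: dhomogM; [apply: X|apply: dhomogM; apply: X].
Qed.

Section Multiple.
Variable k : K.
Hypothesis k0 : k != 0.
Local Notation t := [tuple detT K; P1; p4; k%:MP * J].

(** Any expression of J^2 in the generators may be replaced by its weighted component of degree 2
    q^2, which makes the defining relation homogeneous. *)
Lemma jac4_sq_weighted : exists2 D : T, D \is (q ^ 2 * 2).-homog for (wdeg oddw) &
  (k%:MP * J) ^+ 2 = D \mPo th.
Proof.
have [D eD] := jac4_sq noroot hlam cardL oddq.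
exists (k ^+ 2 *: pihomog (wdeg oddw) (q ^ 2 * 2) D).
  by apply: dhomogZ; apply: pihomogP.
have hw i : tnth th i \is (wdeg oddw U_(i)%MM).-homog by rewrite wdeg1 th_homog.
rewrite comp_mpolyZ -(pihomog_comp_mpoly hw) -eD pihomog_dE; last exact: dhomogMn (dhomog_jac4 _ _).
by rewrite exprMn -mul_mpolyC rmorphXn.
Qed.

(** The relation is X3^2 = D. Dividing by it reduces any P to A + B X3; if P is a relation, the
    direct sum decomposition and algebraic independence force A = B = 0. *)
Lemma odd_hypersurface : hypersurface_on (invT K) t.
Proof.
have [D hD eD] := jac4_sq_weighted.
have t3 : X3 \mPo t = k%:MP * J by rewrite tnth_comp_mpolyXU tuple4E.
exists oddw4; split.
- apply: ord4P; rewrite tuple4E; split; rewrite // /oddw4 /=.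
  + exact: dhomog_detT.
  + by rewrite addn1.
  + exact: dhomog_P1.
  + by have := oddw_gt0 o2.
  + exact: dhomog_piST_f4.
  + by rewrite expn_gt0 (ltn_trans _ (finNzRing_gt1 K)).
  + by rewrite mul_mpolyC; apply: dhomogZ; apply: dhomog_jac4.
- move=> x; split=> [/(odd_generation noroot hlam cardL oddq)[y [z [[P ->] [Q ->] ->]]]|].
    exists (ext P + ext Q * ((k^-1)%:MP * X3)).
    rewrite rmorphD !rmorphM /= t3 !ext_comp comp_mpolyC [(k^-1)%:MP * _]mulrA -rmorphM mulVf //.
    by rewrite rmorph1 mul1r.
  apply: in_subalg_inv; apply: ord4P; rewrite tuple4E.
  + exact: detT_inv.
  + exact: P1_inv.
  + exact: piST_f4_inv.
  by apply/invTP=> s; rewrite rmorphM /= actTC (invTP _ (jac4_inv noroot)).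
exists (X3 ^+ 2 - ext D).
  have /dhomogP h : X3 ^+ 2 - ext D \is (q ^ 2 * 2).-homog for (wdeg oddw4).
    by rewrite rpredB ?dhomog_ext //; apply: dhomogMn; rewrite dhomogX /= wdeg1.
  by exists (q ^ 2 * 2)%N => m /h.
move=> P; split=> [hP|[Q ->]]; last first.
  by rewrite rmorphM rmorphB rmorphXn /= t3 ext_comp -eD subrr mulr0.
have [Q [A [B eP]]] : exists Q A B, P = Q * (X3 ^+ 2 - ext D) + ext A + ext B * X3.
  elim/mpoly_ring_ind: P {hP} => [c|i|p r [Q1 [A1 [B1 ->]]] [Q2 [A2 [B2 ->]]]|p r [Q1 [A1 [B1 ->]]] [Q2 [A2 [B2 ->]]]].
  - by exists 0, c%:MP, 0; rewrite /ext comp_mpolyC rmorph0 !mul0r add0r addr0.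
  - move: i; apply: ord4P.
    + by exists 0, (aT K), 0; rewrite rmorph0 !mul0r addr0 add0r /ext tnth_comp_mpolyXU tuple3E.
    + by exists 0, (bT K), 0; rewrite rmorph0 !mul0r addr0 add0r /ext tnth_comp_mpolyXU tuple3E.
    + by exists 0, (cT K), 0; rewrite rmorph0 !mul0r addr0 add0r /ext tnth_comp_mpolyXU tuple3E.
    by exists 0, 0, 1; rewrite rmorph0 rmorph1 !mul0r mul1r !add0r.
  - by exists (Q1 + Q2), (A1 + A2), (B1 + B2); rewrite !rmorphD /=; ring.
  exists (Q1 * (Q2 * (X3 ^+ 2 - ext D) + ext A2 + ext B2 * X3) + (ext A1 + ext B1 * X3) * Q2 + ext B1 * ext B2),
    (A1 * A2 + B1 * B2 * D), (A1 * B2 + A2 * B1).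
  by rewrite !rmorphD !rmorphM /=; ring.
exists Q; suff [a0 b0] : A = 0 /\ B = 0 by rewrite eP a0 b0 !rmorph0 mul0r !addr0.
move: hP; rewrite eP !rmorphD !rmorphM rmorphB rmorphXn /= t3 !ext_comp -eD subrr mulr0 add0r.
rewrite mulrA => h; have [||h1 /eqP] := odd_direct noroot hlam oddq _ _ h.
- by exists A.
- by apply: in_subalgM; [exists B|apply: in_subalgC].
rewrite mulf_eq0 mpolyC_eq0 (negbTE k0) orbF => /eqP h2.
by split; apply: odd_alg_indep.
Qed.
End Multiple.

Lemma piST_f123 : [/\ piST (f1 K) = 0, piST (f2 K) = detT K & piST (f3 K) = P1].
Proof.
split.
- by rewrite /f1 rmorphD /= !piST_vars subrr.
- by rewrite /f2 rmorphB !rmorphM /= !piST_vars /detT mulrN expr2.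
rewrite /f3 P1E !rmorphB rmorphD !rmorphM !rmorphXn /= !piST_vars (expr_cardN (@mpolyC 3 K)).
by ring.
Qed.

Lemma piST_subR r : in_subalg [tuple f1 K; f2 K; f3 K; f4 tau delta] r -> sub (piST r).
Proof.
case=> P ->; rewrite /piST comp_mpolyA.
set t := [tuple of map _ _].
have ht i : sub (tnth t i).
  rewrite tnth_map -[_ \mPo _]/(piST _).
  have [e1 e2 e3] := piST_f123.
  move: i; apply: ord4P; rewrite tuple4E ?e1 ?e2 ?e3.
  - exact: in_subalg0.
  - exact: (in_subalg_gen th o0).
  - exact: (in_subalg_gen th o1).
  exact: (in_subalg_gen th o2).
elim/mpoly_ring_ind: P => [e|i|x y hx hy|x y hx hy].
- by rewrite comp_mpolyC; apply: in_subalgC.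
- by rewrite tnth_comp_mpolyXU.
- by rewrite comp_mpolyD; apply: in_subalgD.
by rewrite rmorphM; apply: in_subalgM.
Qed.

(** The image of h has odd degree q^2, so it is a constant times J. If it were zero, J, which lifts
    to S^G = R + R h, would lie in the image K[det, P1(det), p4] of R, against the directness of the
    sum. *)
Lemma secondary_piST h : secondary_invariant tau delta h ->
  exists2 k : K, k != 0 & piST h = k%:MP * J.
Proof.
case=> hd hi hS _.
have pd : piST h \is (q ^ 2).-homog.
  apply: (dhomog_comp_mpoly (mf := mdeg)) hd => i; rewrite /= mdeg1.
  by move: i; apply: ord4P; rewrite tuple4E ?rpredN dhomog_var.
have [y hy ey] := odd_degree_generation noroot hlam cardL oddq (piST_inv hi) pd (oddX2 oddq).
have Jd := dhomog_jac4 tau delta.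
exists (pihomog mdeg 0 y)@_0%MM; last first.
  by rewrite -(homog0C (pihomogP mdeg 0 y)) mulrC -(pihomogM _ _ Jd) addn0 mulrC -ey (pihomog_dE pd).
apply/eqP=> c0.
have h0 : piST h = 0.
  by rewrite -(pihomog_dE pd) ey mulrC -[X in pihomog _ X](addn0 (q ^ 2)%N) (pihomogM _ _ Jd)
    (homog0C (pihomogP mdeg 0 y)) c0 mpolyC0 mulr0.
have [y' hy' eJ] := proj1 (invT_piST (odd_two_neq0 oddq) J) (jac4_inv noroot).
have [r1 [r2 [R1 R2 er]]] := proj1 (hS y') hy'.
have sJ : sub J by rewrite eJ er rmorphD rmorphM /= h0 mulr0 addr0; apply: piST_subR.
have [||_ /eqP] := odd_direct noroot hlam oddq sJ (_ : sub (-1)) _.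
- by rewrite -(mpolyC1 3 K) -rmorphN; apply: in_subalgC.
- by rewrite mulN1r subrr.
by rewrite oppr_eq0 oner_eq0.
Qed.

Definition oddeta : 2.-tuple T := [tuple 1; J].
Definition oddetadeg (j : 'I_2) : nat := nth 0%N [:: 0; q ^ 2]%N j.

Lemma oddeta_homog j : tnth oddeta j \is (oddetadeg j).-homog.
Proof.
case: j => [[|[|//]] i]; rewrite /oddetadeg (tnth_nth 0) /=; first exact: dhomog1.
exact: dhomog_jac4.
Qed.

Lemma combE2 P : comb th oddeta P = (P 0 \mPo th) + (P 1 \mPo th) * J.
Proof.
rewrite /comb big_ord_recl big_ord1 !(tnth_nth 0) /= mulr1; congr (_ + (P _ \mPo th) * _).
exact/val_inj.
Qed.

Lemma odd_combP x : x \in invT K <-> exists P, x = comb th oddeta P.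
Proof.
split=> [/(odd_generation noroot hlam cardL oddq)[y [z [[P ->] [Q ->] ->]]]|[P ->]].
  by exists (fun j => if j == 0 then P else Q); rewrite combE2.
rewrite combE2; apply/invTP=> s; rewrite rmorphD rmorphM /= (invTP _ (jac4_inv noroot)).
have h i : actT s (P i \mPo th) = P i \mPo th.
  by apply: (invTP _); apply: (sub_inv noroot); exists (P i).
by rewrite !h.
Qed.

Lemma odd_comb_inj P : comb th oddeta P = 0 -> forall j, P j = 0.
Proof.
rewrite combE2 => /(odd_direct noroot hlam oddq)[||h0 h1].
- by exists (P 0).
- by exists (P 1).
have e0 := odd_alg_indep h0; have e1 := odd_alg_indep h1.
by case=> [[|[|//]] i]; [rewrite -[RHS]e0|rewrite -[RHS]e1]; congr P; apply/val_inj.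
Qed.

Lemma odd_thA i : tnth th i \in invT K.
Proof.
by move: i; apply: ord3P; rewrite tuple3E ?detT_inv ?P1_inv ?(piST_f4_inv noroot).
Qed.

Lemma odd_hilb_num : hilb_num oddetadeg = 1 + 'X^(q ^ 2).
Proof. by rewrite /hilb_num big_ord_recl big_ord1 /oddetadeg /= expr0. Qed.

Lemma odd_hilb_den : hilb_den oddw = (1 - 'X^2) * (1 - 'X^(q + 1)) * (1 - 'X^(q ^ 2 - q)).
Proof. by rewrite /hilb_den !big_ord_recl big_ord0 /oddw /= mulr1 mulrA. Qed.

Lemma odd_hilbert_series : hilbert_series (invT K) (hilb_num oddetadeg) (hilb_den oddw).
Proof.
exact: (hilbert_seriesA oddw_gt0 th_homog oddeta_homog odd_combP odd_comb_inj).
Qed.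

Lemma odd_CM : graded_CM (invT K).
Proof.
exact: (free_module_CM oddw_gt0 th_homog odd_thA odd_combP odd_comb_inj).
Qed.

Lemma odd_a_invariant : a_invariant (invT K) (- 3%:Z).
Proof.
split; first exact: odd_CM.
have q1 := finNzRing_gt1 K.
exists (hilb_num oddetadeg), (hilb_den oddw).
have sN : size (hilb_num oddetadeg) = (q ^ 2).+1.
  by rewrite odd_hilb_num addrC -polyC1 size_XnaddC // expn_gt0 ltnW.
split; [exact: odd_hilbert_series|by rewrite -size_poly_gt0 sN|].
rewrite sN size_hilb_den => [|i]; last exact: oddw_gt0.
rewrite !big_ord_recl big_ord0 /oddw /= addn0.
have : (q <= q ^ 2)%N by rewrite -[X in (X <= _)%N](expn1 q) leq_exp2l.
move: (q ^ 2)%N (q) => m n; lia.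
Qed.
End OddCase.

Section EvenConclusions.
Variables (K : finFieldType) (tau delta : K).
Hypothesis noroot : forall x, x ^+ 2 - tau * x + delta != 0.
Variables (L : finFieldType) (io : {rmorphism K -> L}) (lam : L).
Hypothesis hlam : lam ^+ 2 - io tau * lam + io delta = 0.
Hypothesis cardL : #|L| = (#|K| ^ 2)%N.
Hypothesis evq : ~~ odd #|K|.
Local Notation T := {mpoly K[3]}.
Local Notation q := #|K|.
Local Notation P1 := (steenrodP1 (detT K)).
Local Notation p4 := (piST (f4 tau delta)).
Local Notation E := (Eprod tau delta).
Variable k : K.
Hypothesis k0 : k != 0.
Local Notation th := [tuple detT K; P1; k%:MP * E].

(** Comparing degrees in p4 = u E^2 gives twice this number as q^2 - q. *)
Lemma card_Nset : #|Nset tau delta| = 'C(q, 2).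
Proof.
have [u u0 hu] := piST_f4_square noroot hlam.
have d1 : p4 \is (#|Nset tau delta| * 2).-homog.
  by rewrite hu mul_mpolyC; apply: dhomogZ; apply: dhomogMn; apply: dhomog_Eprod.
have p0 : p4 != 0 by rewrite hu mulf_neq0 ?mpolyC_eq0 // expf_neq0 // Eprod_neq0.
have := dhomog_uniq p0 d1 (dhomog_piST_f4 tau delta).
rewrite bin2 => e; rewrite -(doubleK #|_|) -muln2 e; congr (_./2).
by move: (q) => n; rewrite -mulnn -{3}[n]muln1 -mulnBr subn1.
Qed.

Lemma even_alg_indep : alg_indep th.
Proof.
apply: (alg_indep_theta noroot hlam).
  by rewrite mulf_neq0 ?mpolyC_eq0 // Eprod_neq0.
apply: divides_mull; rewrite /Eprod (bigD1 (- tau, - delta)) ?l0_Nset //=.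
by apply: divides_mulr; apply: dividesxx.
Qed.

Lemma even_thA i : tnth th i \in invT K.
Proof.
move: i; apply: ord3P; rewrite tuple3E ?detT_inv ?P1_inv //.
apply/invTP=> s; rewrite rmorphM /= actTC.
by rewrite (invTP _ (even_Eprod_inv noroot hlam evq)).
Qed.

Lemma even_invT_subalg x : x \in invT K <-> in_subalg th x.
Proof.
split=> [hx|]; first exact: (even_generation noroot hlam cardL evq k0 hx).
exact: in_subalg_inv even_thA.
Qed.

Definition evenw (i : 'I_3) : nat := nth 0%N [:: 2; q + 1; 'C(q, 2)]%N i.

Lemma evenw_gt0 i : (0 < evenw i)%N.
Proof.
move: i; apply: ord3P; rewrite /evenw //= ?addn1 //.
by rewrite -card_Nset Nset_gt0.
Qed.

Lemma even_th_homog i : tnth th i \is (evenw i).-homog.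
Proof.
move: i; apply: ord3P; rewrite tuple3E /evenw /=.
- exact: dhomog_detT.
- exact: dhomog_P1.
by rewrite mul_mpolyC -card_Nset; apply: dhomogZ; apply: dhomog_Eprod.
Qed.

Lemma comb1 P : comb th [tuple 1] P = P ord0 \mPo th.
Proof. by rewrite /comb big_ord1 (tnth_nth 0) /= mulr1. Qed.

Lemma even_combP x : x \in invT K <-> exists P, x = comb th [tuple 1] P.
Proof.
rewrite even_invT_subalg; split=> [[P ->]|[P ->]]; first by exists (fun=> P); rewrite comb1.
by rewrite comb1; exists (P ord0).
Qed.

Lemma even_comb_inj P : comb th [tuple 1] P = 0 -> forall j, P j = 0.
Proof. by rewrite comb1 => /even_alg_indep h j; rewrite ord1. Qed.

Lemma even_a_invariant : a_invariant (invT K) (- (3 + q + 'C(q, 2))%:Z).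
Proof.
have eta_homog (j : 'I_1) : tnth [tuple 1 : T] j \is ((fun=> 0%N) j).-homog.
  by rewrite ord1 (tnth_nth 0) /=; apply: dhomog1.
split; first exact: (free_module_CM evenw_gt0 even_th_homog even_thA even_combP even_comb_inj).
exists (hilb_num (fun _ : 'I_1 => 0%N)), (hilb_den evenw).
have eN : hilb_num (fun _ : 'I_1 => 0%N) = 1 by rewrite /hilb_num big_ord1 expr0.
split; [|by rewrite eN oner_eq0|].
  exact: (hilbert_seriesA evenw_gt0 even_th_homog eta_homog even_combP even_comb_inj).
rewrite eN size_poly1 size_hilb_den; last exact: evenw_gt0.
rewrite !big_ord_recl big_ord0 /evenw /= addn0.
move: ('C(q, 2)) (q) => m n; lia.
Qed.
End EvenConclusions.

Theorem theorem7p1 (K : finFieldType) (tau delta : K)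
    (hg : irreducible_poly (quad tau delta)) :
  let q := #|K| in
  let p4 : {mpoly K[3]} := piST (f4 tau delta) in
  let P1det : {mpoly K[3]} := steenrodP1 (detT K) in
  (~~ odd q ->
     (exists s : {mpoly K[3]},
        [/\ s ^+ 2 = p4,
            alg_indep [tuple detT K; P1det; s]
          & forall x, x \in invT K <-> in_subalg [tuple detT K; P1det; s] x])
     /\ a_invariant (invT K) (- (3 + q + 'C(q, 2))%:Z))
  /\
  (odd q ->
     (forall x, x \in invT K <-> exists2 y, y \in invS K & x = piST y)
     /\ (forall h, secondary_invariant tau delta h ->
           hypersurface_on (invT K) [tuple detT K; P1det; p4; piST h])
     /\ hypersurface_on (invT K)
          [tuple detT K; P1det; p4; jacobian [tuple detT K; P1det; p4]]
     /\ hilbert_series (invT K) (1 + 'X^(q ^ 2))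
          ((1 - 'X^2) * (1 - 'X^(q + 1)) * (1 - 'X^(q ^ 2 - q)))
     /\ (forall p, p \in [pchar K] -> ~ F_regular p (ringTG K))
     /\ class_group_iso (ringTG K) 'Z_2
     /\ a_invariant (invT K) (- 3%:Z)).
Proof.
move=> q p4 P1det.
have noroot := quad_noroot hg; have [L [io [lam [hlam cardL]]]] := quadratic_extension hg.
split=> [evq|oddq].
  have [u u0 hu] := piST_f4_square noroot hlam.
  have [k k0 ek] : exists2 k : K, k != 0 & k ^+ 2 = u.
    (* In even characteristic u^q = u provides the square root u^(q/2) of the constant. *)
    exists (u ^+ q./2); first by rewrite expf_neq0.
    by rewrite -exprM muln2 even_halfK // expf_card.
  split; last exact: (even_a_invariant noroot hlam cardL evq (oner_neq0 K)).
  exists (k%:MP * Eprod tau delta); split.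
  - by rewrite exprMn -rmorphXn /= ek -hu.
  - exact: (even_alg_indep noroot hlam k0).
  exact: (even_invT_subalg noroot hlam cardL evq k0).
split; first exact: (invT_piST (odd_two_neq0 oddq)).
split.
  move=> h /(secondary_piST noroot hlam cardL oddq)[k k0 ->].
  exact: (odd_hypersurface noroot hlam cardL oddq k0).
split.
  have := odd_hypersurface noroot hlam cardL oddq (oner_neq0 K).
  by rewrite mpolyC1 mul1r.
split.
  by rewrite -odd_hilb_num -odd_hilb_den; apply: (odd_hilbert_series noroot hlam cardL oddq).
split; first by move=> p pK; apply: (not_F_regular noroot hlam cardL oddq pK).
split; first exact: (odd_class_group noroot hlam oddq).
exact: (odd_a_invariant noroot hlam cardL oddq).
Qed.
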